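(* Let $\Gamma\subset\mathbb{C}$ be a Dini-smooth Jordan curve, let $F_n$ be the $n$th Faber polynomial of $\Gamma$, and let $\phi$ be the canonical exterior conformal map of $\Gamma$, extended continuously to $\Gamma$. Then $$\lim_{n\to\infty}\phi(z)^{-n}F_n(z)=1\quad\text{uniformly for } z\in\Gamma,$$ and consequently $$\lim_{n\to\infty}\|F_n\|_\Gamma=1.$$
   Context: $\|f\|_\Gamma=\sup_{z\in\Gamma}|f(z)|$, and $\operatorname{cap}(\Gamma)$ is the logarithmic capacity of $\Gamma$. For a Jordan curve $\Gamma$, $\Omega$ denotes the component of $\overline{\mathbb{C}}\setminus\Gamma$ containing $\infty$. The canonical exterior conformal map is the conformal bijection $\phi:\Omega\to\{w\in\overline{\mathbb{C}}:|w|>1\}$ with $\phi(\infty)=\infty$ and $\phi(z)/z\to\operatorname{cap}(\Gamma)^{-1}$ as $z\to\infty$. Its inverse extends to a homeomorphism from $\{w\in\overline{\mathbb{C}}:|w|\ge1\}$ onto $\overline{\Omega}=\Omega\cup\Gamma$; accordingly $\phi$ is regarded as a homeomorphism defined on $\overline{\Omega}$. The $n$th Faber polynomial $F_n$ of $\Gamma$ is the polynomial part (the sum of the terms with nonnegative powers of $z$) of the Laurent expansion of $\phi(z)^n$ at $\infty$. A Jordan curve is Dini-smooth if it has a periodic parametrization $\gamma:\mathbb{R}\to\Gamma$ of period $1$ (injective on $[0,1)$) such that $\gamma'$ is continuous, never vanishes, and its modulus of continuity $\omega(t)=\max_{|s_1-s_2|\le t}|\gamma'(s_1)-\gamma'(s_2)|$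 satisfies $\int_0^1\frac{\omega(t)}{t}\,dt<\infty$. *)

(* Defs.v *)
(* MathComp / MathComp-Analysis, over an arbitrary R : realType; the complex
   plane is R[i]. *)
From HB Require Import structures.
From mathcomp Require Export all_boot all_order all_algebra complex.
From mathcomp Require Export all_classical all_reals all_analysis.
Set Implicit Arguments.
Unset Strict Implicit.
Unset Printing Implicit Defensive.
Import Order.TTheory GRing.Theory Num.Theory.
Export numFieldNormedType.Exports.
Local Open Scope classical_set_scope.
Local Open Scope complex_scope.
Local Open Scope ring_scope.

(* The usual topology on the complex plane, as a normed space over itself.
   Hence [derivable f z 1], for f : R[i] -> R[i], is complex
   differentiability at z. *)
HB.instance Definition _ (R : rcfType) := NormedModule.copy R[i] R[i]^o.

(* The modulus as an element of R; the norm `|z| of MathComp lives in R[i]. *)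
Notation normc := ComplexField.Normc.normc.

Notation riemann_sphere R := (one_point_compactification R[i]).

Section Definitions.
Context {R : realType}.
Implicit Types (G : set R[i]) (phi f : R[i] -> R[i]).

Definition sup_norm G f : R := sup [set normc (f z) | z in G].

Definition periodic_parametrization G (g : R -> R[i]) :=
  [/\ continuous g, forall s, g (s + 1) = g s,
      {in `[0, 1[ &, injective g} & range g = G].

Definition curve_derivative (g g' : R -> R[i]) :=
  forall s : R, (g (s + h) - g s) / h%:C @[h --> 0^'] --> g' s.

Definition modulus_of_continuity (g : R -> R[i]) (t : R) : R :=
  sup [set normc (g s.1 - g s.2) | s in [set s : R * R | `|s.1 - s.2| <= t]].

Definition dini_smooth_jordan_curve G :=
  exists g g' : R -> R[i],
    [/\ periodic_parametrization G g, curve_derivative g g', continuous g',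
        forall s, g' s != 0 &
        (\int[lebesgue_measure]_(t in `]0%R, 1%R])
            (modulus_of_continuity g' t / t)%:E < +oo)%E].

(* Logarithmic capacity: exp (- inf I(mu)) over the Borel probability measures
   mu carried by G, with I(mu) the logarithmic energy. As lne 0 = -oo, the
   kernel log (1 / |z - w|) is +oo on the diagonal. *)
Definition borelC := g_sigma_algebraType (@open R[i]).

Definition log_energy G (mu : probability borelC R) : \bar R :=
  (\int[mu]_(z in G) \int[mu]_(w in G) - lne (normc ((z : R[i]) - w))%:E)%E.

Definition log_capacity G : R :=
  fine (expeR (- ereal_inf
    [set log_energy G mu | mu in [set mu : probability borelC R | mu G = 1%E]])).

Definition cinfty : set_system R[i] :=
  filter_from setT (fun M : R => [set z | M < normc z]).

Definition on_sphere G : set (riemann_sphere R) := Some @` G.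

(* The component of the sphere minus G that contains infinity. *)
Definition exterior_domain G : set (riemann_sphere R) :=
  connected_component (~` on_sphere G) None.

Definition exterior_disk : set (riemann_sphere R) :=
  [set w | if w is Some v then 1 < normc v else True].

Definition closed_exterior_disk : set (riemann_sphere R) :=
  [set w | if w is Some v then 1 <= normc v else True].

(* phi, acting on the finite points, completed by infinity |-> infinity. *)
Definition sphere_map phi : riemann_sphere R -> riemann_sphere R := omap phi.

Definition homeomorphism_on (S T : topologicalType) (A : set S) (B : set T)
    (f : S -> T) :=
  [/\ set_bij A B f, {within A, continuous f} &
      exists g : T -> S, {within B, continuous g} /\
        (forall x, A x -> g (f x) = x)].

(* The canonical exterior conformal map, regarded as a homeomorphism defined on
   the exterior domain together with G; its values elsewhere are irrelevant.
   Being a nonzero limit of phi(z)/z, the third condition also expresses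
   conformality at infinity. *)
Definition canonical_exterior_map G phi :=
  [/\ set_bij (exterior_domain G) exterior_disk (sphere_map phi),
      forall z, exterior_domain G (Some z) -> derivable phi z 1,
      phi z / z @[z --> cinfty] --> ((log_capacity G)^-1)%:C &
      homeomorphism_on (exterior_domain G `|` on_sphere G)
        closed_exterior_disk (sphere_map phi)].

(* f(z) = sum over k in Z of a_k z^k for all large |z|, the two halves of the
   series converging separately. *)
Definition laurent_at_infinity f (a : int -> R[i]) :=
  exists r : R, forall z, r < normc z ->
    exists s t : R[i],
      [/\ [series a k%:Z * z ^+ k]_k @ \oo --> s,
          [series a (- k.+1%:Z) * z ^- k.+1]_k @ \oo --> t &
          f z = s + t].

Definition is_polynomial_part f (p : {poly R[i]}) :=
  exists a, laurent_at_infinity f a /\ (forall k : nat, p`_k = a k%:Z).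

Definition is_faber_polynomial phi (n : nat) (p : {poly R[i]}) :=
  is_polynomial_part (fun z => phi z ^+ n) p.

End Definitions.

(* Main.v *)
(* Let D be the exterior of the curve g and K := c * Int phi(g)^-1 g', where
   phi(z)/z -> c. Cauchy's theorem on D, with contours pushed off the curve by a
   C^1 normal displacement and contracted to infinity through level lines of phi,
   gives Int F(g) g' = K lim z F(z) for F holomorphic in D and continuous up to
   the curve. Applied to the Cauchy integrals of phi^n - F_n and (conjugated, as
   |phi| = 1 on the curve) of phi^-n, it yields for z in D
     K (F_n - phi^n)(z) + conj(K phi(z)^-n) = 2 i Int phi(g)^n Im(g' / (g - z)).
   When z tends to g(s) along the normal, the kernel on the right splits into a
   Poisson kernel, which produces +-pi phi(g(s))^n, and a remainder bounded by
   omega(|t|)/|t|, which is small near s uniformly in s by the Dini condition.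
   Away from s the kernel is continuous, and its integral against phi^n tends to
   0 uniformly in s: the functions phi^m conj(g'), m >= 2, have zero integral, and
   Laurent polynomials in phi are dense. Hence K (phi^-n F_n - 1) tends uniformly
   to a constant, and computing a mean value shows that this constant is 0. *)
Require Import Defs.
From mathcomp Require Import ring lra zify.
From mathcomp Require cyclic separable cyclotomic.
Set Implicit Arguments.
Unset Strict Implicit.
Unset Printing Implicit Defensive.
Import Order.TTheory GRing.Theory Num.Theory.
Local Open Scope classical_set_scope.
Local Open Scope ring_scope.
Local Open Scope complex_scope.
Local Notation Re := complex.Re.
Local Notation Im := complex.Im.

(** * Subdivision of rectangles *)

(** Why the integrals of phi^n and phi^-n are combined: near its pole the kernel [g' / (g - z)]
    looks like [1 / (t - i e)], whose real part [t / (t^2 + e^2)] has no absolute integral bounded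
    uniformly in [e], while the imaginary part is a Poisson kernel. Conjugation cancels the real
    part. Cauchy theory is built locally: Goursat on rectangles gives primitives on discs, and these
    are carried along a merely continuous deformation of the curve, with bisection doing the work of
    compactness. The kernel is cut off at a distance [d] from the diagonal. This turns it into a
    bounded equicontinuous family indexed by the base point [s], and this is what makes the
    Riemann-Lebesgue step uniform in [s]. The constant [K] stays unknown until the end. The limit
    constant is [conj K - 2 i sigma pi] up to sign, with [sigma] the side from which the exterior
    approaches the curve; the mean value shows that its product with [K] is 0, and [K = 0] is
    excluded because [2 i sigma pi] is not 0. *)

Section Cousin.
Context {R : realType}.

Lemma exp_half_lt (e : R) : 0 < e -> exists k : nat, 2^-1 ^+ k < e.
Proof.
move=> e0; have e1 : 0 < e^-1 by rewrite invr_gt0.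
exists (Num.truncn e^-1).+1.
rewrite exprVn invf_plt ?posrE ?exprn_gt0//.
apply: lt_trans (truncnS_gt _) _.
by rewrite -natrX ltr_nat ltn_expl.
Qed.

(* Only rectangles similar to the initial one are tested locally, so that
   Goursat's estimate can compare diameter times perimeter with the area. *)
Lemma rect_induction (Q : R -> R -> R -> R -> Prop) (a b c d : R) :
  a <= b -> c <= d ->
  (forall x1 x2 y1 y2, x1 <= x2 -> y1 <= y2 ->
     Q x1 ((x1 + x2) / 2) y1 ((y1 + y2) / 2) ->
     Q ((x1 + x2) / 2) x2 y1 ((y1 + y2) / 2) ->
     Q x1 ((x1 + x2) / 2) ((y1 + y2) / 2) y2 ->
     Q ((x1 + x2) / 2) x2 ((y1 + y2) / 2) y2 -> Q x1 x2 y1 y2) ->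
  (forall p q, a <= p <= b -> c <= q <= d -> exists2 e, 0 < e &
     forall l x y, 0 < l -> l < e ->
       a <= x -> x <= p -> p <= x + l * (b - a) -> x + l * (b - a) <= b ->
       c <= y -> y <= q -> q <= y + l * (d - c) -> y + l * (d - c) <= d ->
       Q x (x + l * (b - a)) y (y + l * (d - c))) ->
  Q a b c d.
Proof.
move=> ab cd glue loc; apply: contrapT => nQ.
pose L (k : nat) : R := 2^-1 ^+ k.
have L00 : L 0%N = 1 by rewrite /L expr0.
have LS k : L k.+1 = L k / 2 by rewrite /L exprSr.
have L0 k : 0 < L k by rewrite /L exprn_gt0// invr_gt0.
pose bad k (p : R * R) := [/\ [/\ a <= p.1, p.1 + L k * (b - a) <= b,
  c <= p.2 & p.2 + L k * (d - c) <= d] &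
  ~ Q p.1 (p.1 + L k * (b - a)) p.2 (p.2 + L k * (d - c))].
have step (kp : nat * (R * R)) : exists p' : R * R, bad kp.1 kp.2 ->
    [/\ bad kp.1.+1 p', kp.2.1 <= p'.1, kp.2.2 <= p'.2,
      p'.1 + L kp.1.+1 * (b - a) <= kp.2.1 + L kp.1 * (b - a) &
      p'.2 + L kp.1.+1 * (d - c) <= kp.2.2 + L kp.1 * (d - c)].
  case: kp => k [x y] /=.
  have [[[ax xb cy yd] nQk]|nb] := pselect (bad k (x, y)); last by exists (x, y).
  move: ax xb cy yd nQk => /= ax xb cy yd nQk.
  pose x' := x + L k.+1 * (b - a); pose y' := y + L k.+1 * (d - c).
  have w0 : 0 <= L k.+1 * (b - a) by rewrite mulr_ge0 ?subr_ge0// ltW.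
  have h0 : 0 <= L k.+1 * (d - c) by rewrite mulr_ge0 ?subr_ge0// ltW.
  have wE : L k * (b - a) = L k.+1 * (b - a) + L k.+1 * (b - a).
    by rewrite LS; field.
  have hE : L k * (d - c) = L k.+1 * (d - c) + L k.+1 * (d - c).
    by rewrite LS; field.
  apply: contrapT => nex; apply: nQk.
  have x'E : (x + (x + L k * (b - a))) / 2 = x' by rewrite /x' LS; field.
  have y'E : (y + (y + L k * (d - c))) / 2 = y' by rewrite /y' LS; field.
  have H u v : (u = x \/ u = x') -> (v = y \/ v = y') ->
      Q u (u + L k.+1 * (b - a)) v (v + L k.+1 * (d - c)).
    move=> hu hv; apply: contrapT => nQuv; apply: nex; exists (u, v) => _.
    rewrite /bad /=; split; [split; [split|exact: nQuv]| | | |];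
      by case: hu => hu; case: hv => hv; rewrite ?hu ?hv /x' /y'; clear -ax xb cy yd w0 h0 wE hE; lra.
  apply: glue; rewrite ?x'E ?y'E ?wE ?hE ?lerDl ?addr_ge0//.
  - by apply: (H x y); left.
  - have := H x' y (or_intror erefl) (or_introl erefl).
    by rewrite {2}/x' -addrA -wE.
  - have := H x y' (or_introl erefl) (or_intror erefl).
    by rewrite {3}/y' -addrA -hE.
  - have := H x' y' (or_intror erefl) (or_intror erefl).
    by rewrite {2}/x' {3}/y' -2!addrA -wE -hE.
have [f Hf] := choice step.
pose u := fix u (k : nat) : R * R := if k is j.+1 then f (j, u j) else (a, c).
have badu k : bad k (u k).
  elim: k => [|k ih].
    by split; [split|]; rewrite /= ?L00 ?mul1r ?lexx// 1?[a + _]addrC 1?[c + _]addrC ?subrK.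
  by have [] := Hf (k, u k) ih.
have mono k : [/\ (u k).1 <= (u k.+1).1, (u k).2 <= (u k.+1).2,
    (u k.+1).1 + L k.+1 * (b - a) <= (u k).1 + L k * (b - a) &
    (u k.+1).2 + L k.+1 * (d - c) <= (u k).2 + L k * (d - c)].
  by have [] := Hf (k, u k) (badu k).
(* Nested intervals with increasing left ends and decreasing right ends: the supremum of the left
   ends lies in all of them. *)
have limit (v : nat -> R) (w : R) : 0 <= w ->
    (forall k, v k <= v k.+1 /\ v k.+1 + L k.+1 * w <= v k + L k * w) ->
    exists p, forall k, v k <= p <= v k + L k * w.
  move=> w0 mv.
  have up m n : v m <= v (m + n)%N.
    by elim: n => [|n ih]; rewrite ?addn0// addnS (le_trans ih)//; case: (mv (m + n)%N).
  have dn m n : v (m + n)%N + L (m + n)%N * w <= v m + L m * w.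
    by elim: n => [|n ih]; rewrite ?addn0// addnS (le_trans _ ih)//; case: (mv (m + n)%N).
  have le m n : v m <= v n + L n * w.
    apply: (le_trans (up m n)); apply: le_trans _ (dn n m).
    by rewrite addnC lerDl mulr_ge0// ltW.
  exists (sup (range v)) => k; apply/andP; split.
    apply: ub_le_sup; last by exists k.
    by exists (v 0%N + L 0%N * w) => _ [n _ <-].
  apply: ge_sup; first by exists (v 0%N); exists 0%N.
  by move=> _ [n _ <-].
have [p Hp] : exists p, forall k, (u k).1 <= p <= (u k).1 + L k * (b - a).
  by apply: limit; [rewrite subr_ge0|move=> k; case: (mono k)].
have [q Hq] : exists q, forall k, (u k).2 <= q <= (u k).2 + L k * (d - c).
  by apply: limit; [rewrite subr_ge0|move=> k; case: (mono k)].
have [e e0 He] : exists2 e, 0 < e &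
     forall l x y, 0 < l -> l < e ->
       a <= x -> x <= p -> p <= x + l * (b - a) -> x + l * (b - a) <= b ->
       c <= y -> y <= q -> q <= y + l * (d - c) -> y + l * (d - c) <= d ->
       Q x (x + l * (b - a)) y (y + l * (d - c)).
  apply: loc.
    by have := Hp 0%N; rewrite /= L00 mul1r [a + _]addrC subrK.
  by have := Hq 0%N; rewrite /= L00 mul1r [c + _]addrC subrK.
have [k Lk] := exp_half_lt e0.
have [[h1 h2 h3 h4]] := badu k; apply.
by apply: He => //; [case/andP: (Hp k)|case/andP: (Hp k)|case/andP: (Hq k)|case/andP: (Hq k)].
Qed.

(** Cousin's lemma on a segment, the substitute for many compactness arguments below; the degenerate
    second side [[0, 0]] reduces it to [rect_induction]. *)
Lemma itv_induction (Q : R -> R -> Prop) (a b : R) : a <= b ->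
  (forall x y z, x <= y -> y <= z -> Q x y -> Q y z -> Q x z) ->
  (forall p, a <= p <= b -> exists2 e, 0 < e &
     forall x y, a <= x -> x <= p -> p <= y -> y <= b -> y - x < e -> Q x y) ->
  Q a b.
Proof.
move=> ab glue loc.
apply: (@rect_induction (fun x y _ _ => Q x y) a b 0 0) => //.
  by move=> x1 x2 _ _ x12 _ q1 q2 _ _; apply: glue q1 q2; lra.
move=> p q apb _; have [e e0 He] := loc p apb.
have ba0 : 0 <= b - a by rewrite subr_ge0.
exists (e / (b - a + 1)); first by rewrite divr_gt0//; lra.
move=> l x y l0; rewrite ltr_pdivlMr; last by lra.
move=> le ax xp px xb _ _ _ _; apply: He => //.
rewrite addrAC subrr add0r; apply: le_lt_trans le.
by rewrite ler_pM2l//; lra.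
Qed.

End Cousin.

(** * Limits and derivatives in the complex plane *)

Section Modulus.
Context {R : rcfType}.
Implicit Types (z x y : R[i]) (a b : R).

Lemma cReD x y : Re (x + y) = Re x + Re y. Proof. by move: x y => [? ?] [? ?]. Qed.
Lemma cImD x y : Im (x + y) = Im x + Im y. Proof. by move: x y => [? ?] [? ?]. Qed.
Lemma cReN x : Re (- x) = - Re x. Proof. by case: x. Qed.
Lemma cImN x : Im (- x) = - Im x. Proof. by case: x. Qed.
Lemma cReR a : Re a%:C = a. Proof. by []. Qed.
Lemma cReM x y : Re (x * y) = Re x * Re y - Im x * Im y.
Proof. by move: x y => [? ?] [? ?]. Qed.
Lemma cImM x y : Im (x * y) = Re x * Im y + Im x * Re y.
Proof. by move: x y => [? ?] [? ?]. Qed.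
Lemma cReJ x : Re (conjc x) = Re x. Proof. by case: x. Qed.
Lemma cImJ x : Im (conjc x) = - Im x. Proof. by case: x. Qed.
Lemma complex_eq x y : Re x = Re y -> Im x = Im y -> x = y.
Proof. by move: x y => [? ?] [? ?] /= -> ->. Qed.

Lemma normc_ge0 z : 0 <= normc z. Proof. by case: z => x y; exact: sqrtr_ge0. Qed.
Lemma normcD x y : normc (x + y) <= normc x + normc y. Proof. exact: le_normcD. Qed.
Lemma normcM x y : normc (x * y) = normc x * normc y.
Proof. exact: ComplexField.Normc.normcM. Qed.
Lemma normcV x : normc x^-1 = (normc x)^-1.
Proof. exact: ComplexField.Normc.normcV. Qed.
Lemma normcN x : normc (- x) = normc x. Proof. exact: complex.normcN. Qed.
Lemma normcBC x y : normc (x - y) = normc (y - x).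
Proof. by rewrite -normcN opprB. Qed.
Lemma normc0 : normc (0 : R[i]) = 0. Proof. exact: ComplexField.Normc.normc0. Qed.
Lemma normc1 : normc (1 : R[i]) = 1. Proof. exact: ComplexField.Normc.normc1. Qed.
Lemma normcX z n : normc (z ^+ n) = normc z ^+ n.
Proof. by elim: n => [|n ih]; rewrite ?expr0 ?normc1// !exprS normcM ih. Qed.
Lemma normcR a : normc a%:C = `|a|.
Proof. by rewrite /= expr0n addr0 sqrtr_sqr. Qed.
Lemma normci : normc ('i%C : R[i]) = 1.
Proof. by rewrite /= expr0n add0r expr1n sqrtr1. Qed.
Lemma normcJ z : normc (conjc z) = normc z.
Proof. by case: z => x y /=; rewrite sqrrN. Qed.
Lemma normc_eq0 z : (normc z == 0) = (z == 0).
Proof.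
apply/eqP/eqP => [/ComplexField.Normc.eq0_normc//|->]; exact: normc0.
Qed.
Lemma normc_gt0 z : (0 < normc z) = (z != 0).
Proof. by rewrite lt_def normc_ge0 andbT normc_eq0. Qed.
Lemma normc_sqr z : normc z ^+ 2 = Re z ^+ 2 + Im z ^+ 2.
Proof. by case: z => x y /=; rewrite sqr_sqrtr// addr_ge0 ?sqr_ge0. Qed.
Lemma normc_Re z : `|Re z| <= normc z.
Proof. by case: z => x y /=; rewrite -sqrtr_sqr ler_wsqrtr// lerDl sqr_ge0. Qed.
Lemma normc_Im z : `|Im z| <= normc z.
Proof. by case: z => x y /=; rewrite -sqrtr_sqr ler_wsqrtr// lerDr sqr_ge0. Qed.
Lemma normc_le_ReIm z : normc z <= `|Re z| + `|Im z|.
Proof.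
have := normcD (Re z)%:C ('i%C * (Im z)%:C).
by rewrite -complexE normcM !normcR normci mul1r.
Qed.
Lemma normcB_ge x y : normc x - normc y <= normc (x - y).
Proof. by rewrite lerBlDr -{1}[x](subrK y) normcD. Qed.
Lemma normcB x y : normc (x - y) <= normc x + normc y.
Proof. by rewrite -(normcN y) normcD. Qed.
Lemma normc_dist3 x y z : normc (x - z) <= normc (x - y) + normc (y - z).
Proof. by rewrite -[x - z](subrKA y) normcD. Qed.
Lemma conjcB x y : conjc (x - y) = conjc x - conjc y. Proof. exact: rmorphB. Qed.
Lemma conjcM x y : conjc (x * y) = conjc x * conjc y. Proof. exact: rmorphM. Qed.
Lemma conjcV x : conjc (x^-1) = (conjc x)^-1. Proof. exact: conjc_inv. Qed.
Lemma conjcX x n : conjc (x ^+ n) = conjc x ^+ n. Proof. exact: rmorphXn. Qed.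
Lemma conjcR a : (conjc a%:C) = a%:C. Proof. exact: conjc_real. Qed.
Lemma rcD a b : (a + b)%:C = a%:C + b%:C. Proof. exact: rmorphD. Qed.
Lemma rcN a : (- a)%:C = - a%:C. Proof. exact: rmorphN. Qed.
Lemma rcB a b : (a - b)%:C = a%:C - b%:C. Proof. exact: rmorphB. Qed.
Lemma rcM a b : (a * b)%:C = a%:C * b%:C. Proof. exact: rmorphM. Qed.
Lemma rcX a n : (a ^+ n)%:C = a%:C ^+ n. Proof. exact: rmorphXn. Qed.
Lemma mulzJ z : z * conjc z = (normc z ^+ 2)%:C.
Proof. by rewrite normc_sqr; case: z => x y; apply: complex_eq => /=; ring. Qed.
Lemma normr_normc z : `|z| = (normc z)%:C.
Proof. by rewrite normc_def; case: z. Qed.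
Lemma normc_sum (I : Type) (r : seq I) (P : pred I) (F : I -> R[i]) :
  normc (\sum_(i <- r | P i) F i) <= \sum_(i <- r | P i) normc (F i).
Proof.
elim/big_ind2 : _ => [|x a y b h1 h2|//]; first by rewrite normc0.
by apply: le_trans (normcD _ _) _; exact: lerD.
Qed.
Lemma normc_inv_conj z : normc z = 1 -> z^-1 = conjc z.
Proof.
move=> z1; have z0 : z != 0 by rewrite -normc_gt0 z1.
by apply: (mulfI z0); rewrite mulfV// mulzJ z1 expr1n.
Qed.

End Modulus.

Arguments ComplexField.Normc.normc : simpl never.
Arguments conjc : simpl never.

Section Limits.
Context {R : realType}.
Local Notation C := R[i].

(** As [R[i]] is normed over itself, its radii are complex numbers that happen to be positive, hence
    real. This lemma and the next ones trade them for real radii and [normc]. *)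
Lemma cvgcP {T : Type} (F : set_system T) {FF : Filter F} (f : T -> C) (l : C) :
  f @ F --> l <-> forall e : R, 0 < e -> \forall t \near F, normc (f t - l) < e.
Proof.
split=> [/cvgrPdist_lt h e e0|h].
  have e0' : (0 : C) < e%:C by rewrite ltcR.
  by apply: filterS (h _ e0') => t; rewrite normr_normc ltcR normcBC.
apply/cvgrPdist_lt => e; rewrite ltcE => /andP[/eqP e0 e1].
apply: filterS (h _ e1) => t; rewrite normr_normc normcBC.
by rewrite ltcE /= e0 eqxx.
Qed.

Lemma nearcP (z : C) (P : set C) : nbhs z P <->
  exists2 d : R, 0 < d & forall y, normc (y - z) < d -> P y.
Proof.
split=> [/nbhs_ballP[d /= d0 h]|[d d0 h]].
  move: d0; rewrite ltcE => /andP[/eqP d0 d1]; exists (Re d) => // y yz.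
  apply: h; rewrite /ball /= normr_normc normcBC.
  by rewrite ltcE /= d0 eqxx.
apply/nbhs_ballP; exists d%:C => /=; first by rewrite ltcR.
by move=> y; rewrite /ball /= normr_normc ltcR normcBC; exact: h.
Qed.

Lemma nearrP (s : R) (P : set R) : nbhs s P <->
  exists2 d : R, 0 < d & forall t, `|t - s| < d -> P t.
Proof.
split=> [/nbhs_ballP[d /= d0 h]|[d d0 h]].
  by exists d => // y yz; apply: h; rewrite /ball /= distrC.
by apply/nbhs_ballP; exists d => //= y; rewrite /ball /= distrC; exact: h.
Qed.

Lemma rcontP (f : R -> C) (s : R) : {for s, continuous f} <->
  forall e, 0 < e -> exists2 d, 0 < d & forall t, `|t - s| < d -> normc (f t - f s) < e.
Proof.
split=> [/cvgcP h e /h/nearrP//|h].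
by apply/cvgcP => e /h; exact: (@nearrP _ (fun t => normc (f t - f s) < e)).2.
Qed.

Lemma ccontP (A : set C) (f : C -> C) (z : C) :
  f @ within A (nbhs z) --> f z <->
  forall e, 0 < e -> exists2 d, 0 < d &
    forall t, A t -> normc (t - z) < d -> normc (f t - f z) < e.
Proof.
split=> [/cvgcP h e /h/nearcP[d d0 H]|h].
  by exists d => // t At tz; exact: H.
apply/cvgcP => e /h [d d0 H]; apply/nearcP; exists d => // t tz At; exact: H.
Qed.

Lemma cvg_conjc {T : Type} (F : set_system T) {FF : Filter F} (f : T -> C) (l : C) :
  f @ F --> l -> (fun t => conjc (f t)) @ F --> (conjc l).
Proof.
move=> /cvgcP h; apply/cvgcP => e /h; apply: filterS => t.
by rewrite -conjcB normcJ.
Qed.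

Lemma cvg_normc {T : Type} (F : set_system T) {FF : Filter F} (f : T -> C) (l : C) :
  f @ F --> l -> (fun t => (normc (f t))%:C) @ F --> (normc l)%:C.
Proof.
move=> /cvgcP h; apply/cvgcP => e /h; apply: filterS => t.
apply: le_lt_trans; rewrite -raddfB normcR ler_norml normcB_ge andbT.
by rewrite lerNl opprB normcBC normcB_ge.
Qed.

Lemma cvg_RC {T : Type} (F : set_system T) {FF : Filter F} (f : T -> R) (l : R) :
  f @ F --> l -> (fun t => (f t)%:C) @ F --> l%:C.
Proof.
move=> /cvgrPdist_lt h; apply/cvgcP => e /h; apply: filterS => t.
by rewrite -raddfB normcR distrC.
Qed.

Lemma cvg_Re {T : Type} (F : set_system T) {FF : Filter F} (f : T -> C) (l : C) :
  f @ F --> l -> (fun t => Re (f t)) @ F --> Re l.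
Proof.
move=> /cvgcP h; apply/cvgrPdist_lt => e /h; apply: filterS => t.
by rewrite distrC; apply: le_lt_trans; rewrite -cReN -cReD normc_Re.
Qed.

Lemma cvg_Im {T : Type} (F : set_system T) {FF : Filter F} (f : T -> C) (l : C) :
  f @ F --> l -> (fun t => Im (f t)) @ F --> Im l.
Proof.
move=> /cvgcP h; apply/cvgrPdist_lt => e /h; apply: filterS => t.
by rewrite distrC; apply: le_lt_trans; rewrite -cImN -cImD normc_Im.
Qed.

Lemma cvgc_unique {T : Type} (F : set_system T) {FF : ProperFilter F} (f : T -> C)
  (l l' : C) : f @ F --> l -> f @ F --> l' -> l = l'.
Proof.
move=> /cvgcP h /cvgcP h'; apply/eqP; rewrite -subr_eq0 -normc_eq0.
apply/eqP/le_anti; rewrite normc_ge0 andbT; apply/ler_addgt0Pr => e e0.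
have e2 : 0 < e / 2 by rewrite divr_gt0.
have [t [h1 h2]] := filter_ex (filterI (h _ e2) (h' _ e2)).
rewrite add0r; apply: le_trans (normc_dist3 _ (f t) _) _.
by rewrite normcBC; lra.
Qed.

End Limits.

Section Derivatives.
Context {R : realType}.
Local Notation C := R[i].
Implicit Types (P Q : R -> C) (F H : C -> C) (s : R) (z l : C).

(** First-order expansions without division: [h = 0] is harmless, the derivative is explicit data,
    and the calculus rules reduce to norm estimates. [rderiv] is along the real line, [cderiv] is
    complex differentiability. *)
Definition rderiv P s l := forall e : R, 0 < e -> exists2 d : R, 0 < d &
  forall h : R, `|h| < d -> normc (P (s + h) - P s - h%:C * l) <= e * `|h|.

Definition cderiv F z l := forall e : R, 0 < e -> exists2 d : R, 0 < d &
  forall h : C, normc h < d -> normc (F (z + h) - F z - h * l) <= e * normc h.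

Lemma rderiv_near P Q s l : (\forall t \near s, P t = Q t) ->
  rderiv P s l -> rderiv Q s l.
Proof.
move=> /nearrP[d0 d00 PQ] h e /h[d dp H]; exists (Num.min d d0).
  by rewrite lt_min dp.
move=> t; rewrite lt_min => /andP[td td0].
rewrite -(PQ s) ?subrr ?normr0// -(PQ (s + t)) ?[s + t - s]addrAC ?subrr ?add0r//.
exact: H.
Qed.

Lemma cderiv_near F H z l : (\forall t \near z, F t = H t) ->
  cderiv F z l -> cderiv H z l.
Proof.
move=> /nearcP[d0 d00 PQ] h e /h[d dp K]; exists (Num.min d d0).
  by rewrite lt_min dp.
move=> t; rewrite lt_min => /andP[td td0].
rewrite -(PQ z) ?subrr ?normc0// -(PQ (z + t)) ?[z + t - z]addrAC ?subrr ?add0r//.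
exact: K.
Qed.

Lemma rderivD P Q s l m : rderiv P s l -> rderiv Q s m ->
  rderiv (fun t => P t + Q t) s (l + m).
Proof.
move=> hP hQ e e0; have e2 : 0 < e / 2 by rewrite divr_gt0.
have [d1 d10 H1] := hP _ e2; have [d2 d20 H2] := hQ _ e2.
exists (Num.min d1 d2); first by rewrite lt_min d10.
move=> h; rewrite lt_min => /andP[/H1 k1 /H2 k2].
rewrite (_ : _ - _ = (P (s + h) - P s - h%:C * l) + (Q (s + h) - Q s - h%:C * m)).
  by apply: le_trans (normcD _ _) _; lra.
by ring.
Qed.

Lemma cderivD F H z l m : cderiv F z l -> cderiv H z m ->
  cderiv (fun t => F t + H t) z (l + m).
Proof.
move=> hP hQ e e0; have e2 : 0 < e / 2 by rewrite divr_gt0.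
have [d1 d10 H1] := hP _ e2; have [d2 d20 H2] := hQ _ e2.
exists (Num.min d1 d2); first by rewrite lt_min d10.
move=> h; rewrite lt_min => /andP[/H1 k1 /H2 k2].
rewrite (_ : _ - _ = (F (z + h) - F z - h * l) + (H (z + h) - H z - h * m)).
  by apply: le_trans (normcD _ _) _; lra.
by ring.
Qed.

Lemma rderiv_cst c s : rderiv (fun=> c) s 0.
Proof.
move=> e e0; exists 1 => // h _.
by rewrite subrr mulr0 subr0 normc0 mulr_ge0// ltW.
Qed.

Lemma cderiv_cst c z : cderiv (fun=> c) z 0.
Proof.
move=> e e0; exists 1 => // h _.
by rewrite subrr mulr0 subr0 normc0 mulr_ge0 ?normc_ge0// ltW.
Qed.

Lemma cderiv_id z : cderiv id z 1.
Proof.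
move=> e e0; exists 1 => // h _.
rewrite (_ : _ - _ = 0) ?normc0 ?mulr_ge0 ?normc_ge0 ?(ltW e0)//=.
by ring.
Qed.

Lemma rderivZ c P s l : rderiv P s l -> rderiv (fun t => c * P t) s (c * l).
Proof.
move=> hP e e0; have c1 : 0 < normc c + 1 by rewrite ltr_wpDl ?normc_ge0.
have [d d0 H] := hP _ (divr_gt0 e0 c1); exists d => // h /H k.
rewrite (_ : _ - _ = c * (P (s + h) - P s - h%:C * l)); last by ring.
rewrite normcM; apply: le_trans (_ : (normc c + 1) * _ <= _).
  by apply: ler_wpM2r; rewrite ?normc_ge0// lerDl.
by rewrite mulrC -ler_pdivlMr// mulrAC.
Qed.

Lemma cderivZ c F z l : cderiv F z l -> cderiv (fun t => c * F t) z (c * l).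
Proof.
move=> hP e e0; have c1 : 0 < normc c + 1 by rewrite ltr_wpDl ?normc_ge0.
have [d d0 H] := hP _ (divr_gt0 e0 c1); exists d => // h /H k.
rewrite (_ : _ - _ = c * (F (z + h) - F z - h * l)); last by ring.
rewrite normcM; apply: le_trans (_ : (normc c + 1) * _ <= _).
  by apply: ler_wpM2r; rewrite ?normc_ge0// lerDl.
by rewrite mulrC -ler_pdivlMr// mulrAC.
Qed.

Lemma rderivN P s l : rderiv P s l -> rderiv (fun t => - P t) s (- l).
Proof.
move=> h; have -> : (fun t => - P t) = (fun t => -1 * P t).
  by apply/funext => t; rewrite mulN1r.
by rewrite -[- l]mulN1r; exact: rderivZ.
Qed.

Lemma rderivB P Q s l m : rderiv P s l -> rderiv Q s m ->
  rderiv (fun t => P t - Q t) s (l - m).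
Proof. by move=> h k; apply: rderivD => //; exact: rderivN. Qed.

Lemma cderivN F z l : cderiv F z l -> cderiv (fun t => - F t) z (- l).
Proof.
move=> h; have -> : (fun t => - F t) = (fun t => -1 * F t).
  by apply/funext => t; rewrite mulN1r.
by rewrite -[- l]mulN1r; exact: cderivZ.
Qed.

Lemma cderivB F H z l m : cderiv F z l -> cderiv H z m ->
  cderiv (fun t => F t - H t) z (l - m).
Proof. by move=> h k; apply: cderivD => //; exact: cderivN. Qed.

Lemma rderivJ P s l : rderiv P s l -> rderiv (fun t => conjc (P t)) s (conjc l).
Proof.
move=> hP e /hP[d d0 H]; exists d => // h /H.
have -> : conjc (P (s + h)) - conjc (P s) - h%:C * conjc l = conjc (P (s + h) - P s - h%:C * l).
  by rewrite !conjcB conjcM conjcR.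
by rewrite normcJ.
Qed.

Lemma rderiv_affine P (a b : R) s l : rderiv P (a * s + b) l ->
  rderiv (fun t => P (a * t + b)) s (a%:C * l).
Proof.
move=> hP e e0; have a1 : 0 < `|a| + 1 by rewrite ltr_wpDl.
have [d d0 H] := hP _ (divr_gt0 e0 a1); exists (d / (`|a| + 1)).
  by rewrite divr_gt0.
move=> h; rewrite ltr_pdivlMr// => hd.
have ah : `|a * h| <= (`|a| + 1) * `|h|.
  by rewrite normrM ler_wpM2r// lerDl.
have := H (a * h); rewrite (_ : a * s + b + a * h = a * (s + h) + b); last by ring.
rewrite (_ : (a * h)%:C * l = h%:C * (a%:C * l)); last by ring.
move=> K; apply: le_trans (K _) _.
  by apply: le_lt_trans hd; rewrite [leRHS]mulrC.
by rewrite mulrAC ler_pdivrMr// -mulrA ler_pM2l// [leRHS]mulrC.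
Qed.

Lemma rderiv_cont P s l : rderiv P s l -> {for s, continuous P}.
Proof.
move=> hP; apply/rcontP => e e0; have [d d0 H] := hP _ ltr01.
have m0 : 0 < normc l + 1 by rewrite ltr_wpDl ?normc_ge0.
exists (Num.min d (e / (normc l + 1))); first by rewrite lt_min d0 divr_gt0.
move=> t; rewrite lt_min => /andP[/H]; rewrite [s + _]addrC subrK => k.
rewrite ltr_pdivlMr// => te; apply: le_lt_trans te.
rewrite -[P t - P s](subrK ((t - s)%:C * l)).
by apply: le_trans (normcD _ _) _; rewrite normcM normcR mulrDr; lra.
Qed.

Lemma cderiv_cont A F z l : cderiv F z l -> F @ within A (nbhs z) --> F z.
Proof.
move=> hP; apply/ccontP => e e0; have [d d0 H] := hP _ ltr01.
have m0 : 0 < normc l + 1 by rewrite ltr_wpDl ?normc_ge0.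
exists (Num.min d (e / (normc l + 1))); first by rewrite lt_min d0 divr_gt0.
move=> t _; rewrite lt_min => /andP[/H]; rewrite [z + _]addrC subrK => k.
rewrite ltr_pdivlMr// => te; apply: le_lt_trans te.
rewrite -[F t - F z](subrK ((t - z) * l)).
by apply: le_trans (normcD _ _) _; rewrite normcM mulrDr; lra.
Qed.

Lemma rderiv_comp F P s l m : cderiv F (P s) l -> rderiv P s m ->
  rderiv (fun t => F (P t)) s (l * m).
Proof.
move=> hF hP e e0.
have m1 : 0 < normc m + 1 by rewrite ltr_wpDl ?normc_ge0.
have l1 : 0 < normc l + 1 by rewrite ltr_wpDl ?normc_ge0.
have e2 : 0 < e / 2 by rewrite divr_gt0.
have [d1 d10 H1] := hF _ (divr_gt0 e2 m1).
have [d2 d20 H2] := hP _ (divr_gt0 e2 l1).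
have [d3 d30 H3] := hP _ ltr01.
have /rcontP/(_ _ d10)[d4 d40 H4] := rderiv_cont hP.
exists (Num.min (Num.min d2 d3) d4); first by rewrite !lt_min d20 d30.
move=> h; rewrite !lt_min -andbA => /and3P[/H2 k2 /H3 k3 hd4].
have := H4 (s + h); rewrite [s + h - s]addrAC subrr add0r => /(_ hd4) /H1.
rewrite [P s + _]addrC subrK => k1.
have k4 : normc (P (s + h) - P s) <= (normc m + 1) * `|h|.
  rewrite -[P (s + h) - P s](subrK (h%:C * m)).
  by apply: le_trans (normcD _ _) _; rewrite normcM normcR mulrDl [normc m * _]mulrC; lra.
rewrite (_ : _ - _ = (F (P (s + h)) - F (P s) - (P (s + h) - P s) * l) +
  l * (P (s + h) - P s - h%:C * m)); last by ring.
apply: le_trans (normcD _ _) _; rewrite normcM.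
have -> : e * `|h| = e / 2 * `|h| + e / 2 * `|h| by field.
apply: lerD.
  apply: (le_trans k1); rewrite mulrAC ler_pdivrMr// -[leRHS]mulrA.
  by rewrite ler_pM2l// [leRHS]mulrC.
apply: le_trans (_ : (normc l + 1) * _ <= _).
  by apply: ler_wpM2r; rewrite ?normc_ge0// lerDl.
by rewrite mulrC -ler_pdivlMr// mulrAC.
Qed.

Lemma cderivM F H z l m : cderiv F z l -> cderiv H z m ->
  cderiv (fun t => F t * H t) z (l * H z + F z * m).
Proof.
move=> hF hH e e0.
have a0 : 0 < normc (H z) + 1 by rewrite ltr_wpDl ?normc_ge0.
have b0 : 0 < normc (F z) + 1 by rewrite ltr_wpDl ?normc_ge0.
have l0 : 0 < normc l + 1 by rewrite ltr_wpDl ?normc_ge0.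
have e3 : 0 < e / 3 by rewrite divr_gt0.
have [d1 d10 H1] := hF _ (divr_gt0 e3 (ltr_pwDl ltr01 (ltW a0))).
have [d2 d20 H2] := hH _ (divr_gt0 e3 b0).
have [d3 d30 H3] := (ccontP setT _ _).1 (cderiv_cont setT hH) _ (divr_gt0 e3 l0).
have [d4 d40 H4] := (ccontP setT _ _).1 (cderiv_cont setT hH) _ ltr01.
exists (Num.min (Num.min d1 d2) (Num.min d3 d4)); first by rewrite !lt_min d10 d20 d30.
move=> h; rewrite !lt_min => /andP[/andP[/H1 k1 /H2 k2]] /andP[h3 h4].
have k3 := H3 (z + h) I; rewrite [z + h - z]addrAC subrr add0r in k3.
have k4 := H4 (z + h) I; rewrite [z + h - z]addrAC subrr add0r in k4.
move: (k3 h3) (k4 h4) => {}k3 {}k4.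
have k5 : normc (H (z + h)) <= 1 + (normc (H z) + 1).
  by rewrite -[H (z + h)](subrK (H z)); apply: le_trans (normcD _ _) _; lra.
rewrite (_ : _ - _ = (F (z + h) - F z - h * l) * H (z + h) +
  F z * (H (z + h) - H z - h * m) + h * l * (H (z + h) - H z)); last by ring.
apply: le_trans (normcD _ _) _; rewrite !normcM.
have -> : e * normc h = e / 3 * normc h + e / 3 * normc h + e / 3 * normc h by field.
apply: lerD; first (apply: le_trans (normcD _ _) _; rewrite !normcM; apply: lerD).
- apply: le_trans (_ : _ * (1 + (normc (H z) + 1)) <= _).
    by apply: ler_wpM2l => //; rewrite normc_ge0.
  rewrite -ler_pdivlMr; last by lra.
  by rewrite mulrAC.
- apply: le_trans (_ : (normc (F z) + 1) * _ <= _).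
    by apply: ler_wpM2r; rewrite ?normc_ge0// lerDl.
  by rewrite mulrC -ler_pdivlMr// mulrAC.
- rewrite -mulrA [leRHS]mulrC.
  apply: ler_wpM2l; first exact: normc_ge0.
  apply: le_trans (_ : (normc l + 1) * _ <= _).
    by apply: ler_wpM2r; rewrite ?normc_ge0// lerDl.
  by rewrite mulrC -ler_pdivlMr// ltW.
Qed.

Lemma cderivV F z l : F z != 0 -> cderiv F z l ->
  cderiv (fun t => (F t)^-1) z (- l / F z ^+ 2).
Proof.
move=> Fz0 hF e e0; set m := normc (F z).
have m0 : 0 < m by rewrite normc_gt0.
have m20 : 0 < m / 2 by rewrite divr_gt0.
have c1 : 0 < normc l + 1 by rewrite ltr_wpDl ?normc_ge0.
have q1 : 0 < e / 2 * m ^+ 2 by rewrite mulr_gt0 ?exprn_gt0// divr_gt0.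
have [d1 d10 H1] := hF _ q1.
have [d4 d40 H4] := hF _ ltr01.
have cF := (ccontP setT _ _).1 (cderiv_cont setT hF).
have q2 : 0 < e / 2 * (m / 2 * m ^+ 2) / (normc l + 1).
  by rewrite divr_gt0// mulr_gt0 ?divr_gt0// mulr_gt0 ?exprn_gt0.
have [d2 d20 H2] := cF _ q2.
have [d3 d30 H3] := cF _ m20.
exists (Num.min (Num.min d1 d4) (Num.min d2 d3)).
  by rewrite !lt_min d10 d20 d30 d40.
move=> h; rewrite !lt_min => /andP[/andP[/H1 k1 /H4 k4]] /andP[h2 h3].
have zhz : z + h - z = h by rewrite addrAC subrr add0r.
have k2 := H2 (z + h) I; rewrite zhz in k2.
have k3 := H3 (z + h) I; rewrite zhz in k3.
move: (k2 h2) (k3 h3) => {}k2 {}k3.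
have Fh : m / 2 <= normc (F (z + h)).
  by have := normcB_ge (F z) (F (z + h)); rewrite normcBC -/m; lra.
have Fh0 : F (z + h) != 0 by rewrite -normc_gt0; lra.
set D := F (z + h) - F z - h * l in k1 k4 *.
set E := F (z + h) - F z in k2 D k1 k4 *.
have EL : normc E <= (normc l + 1) * normc h.
  rewrite -[E](subrK (h * l)); apply: le_trans (normcD _ _) _.
  by rewrite normcM mulrDl [normc l * _]mulrC; lra.
have -> : (F (z + h))^-1 - (F z)^-1 - h * (- l / F z ^+ 2) =
   - D / F z ^+ 2 + E ^+ 2 / (F (z + h) * F z ^+ 2).
  by rewrite /D /E; field; rewrite Fz0 Fh0.
apply: le_trans (normcD _ _) _; rewrite !(normcM, normcX, normcV, normcN) -/m.
have -> : e * normc h = e / 2 * normc h + e / 2 * normc h by field.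
have m2 : 0 < m ^+ 2 by rewrite exprn_gt0.
apply: lerD; first by rewrite ler_pdivrMr// mulrAC.
have M0 : 0 < m / 2 * m ^+ 2 by rewrite mulr_gt0.
have M1 : m / 2 * m ^+ 2 <= normc (F (z + h)) * m ^+ 2 by rewrite ler_pM2r.
rewrite ler_pdivrMr; last by apply: lt_le_trans M1.
apply: le_trans (_ : e / 2 * normc h * (m / 2 * m ^+ 2) <= _); last first.
  by apply: ler_wpM2l => //; rewrite mulr_ge0 ?normc_ge0// divr_ge0// ltW.
rewrite expr2; apply: le_trans (ler_pM (normc_ge0 _) (normc_ge0 _) EL (ltW k2)) _.
rewrite le_eqVlt; apply/orP; left; apply/eqP; field.
by rewrite gt_eqF.
Qed.

End Derivatives.

(** * Path integrals *)

Section MeanValue.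
Context {R : realType}.
Local Notation C := R[i].
Implicit Types (P Q f : R -> C) (s a b : R).

(** Complex-valued paths have no mean value equality, so the increment is compared with that of a
    real majorant. The slack [e * (b - a)] is additive over subintervals, and on short intervals
    around a point the derivatives at that single point supply it; then [e] tends to 0. *)
Lemma mvt_dominated P P' (G G' : R -> R) a b : a <= b ->
  (forall s, a <= s <= b -> rderiv P s (P' s)) ->
  (forall s, a <= s <= b -> rderiv (fun t => (G t)%:C) s (G' s)%:C) ->
  (forall s, a <= s <= b -> normc (P' s) <= G' s) ->
  normc (P b - P a) <= G b - G a.
Proof.
move=> ab dP dG PG.
suff H e : 0 < e -> normc (P b - P a) <= G b - G a + e * (b - a).
  apply/ler_addgt0Pr => e e0.
  have ba : 0 < b - a + 1 by rewrite ltr_wpDl ?subr_ge0.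
  apply: le_trans (H (e / (b - a + 1)) _) _; first by rewrite divr_gt0.
  rewrite lerD2l mulrAC ler_pdivrMr// ler_pM2l//.
  by rewrite lerDl.
move=> e0; pose Q x y := a <= x -> y <= b ->
  normc (P y - P x) <= G y - G x + e * (y - x).
suff : Q a b by apply.
apply: itv_induction => //.
  move=> x y z xy yz Qxy Qyz ax zb.
  have h1 := Qxy ax (le_trans yz zb); have h2 := Qyz (le_trans ax xy) zb.
  have := normc_dist3 (P z) (P y) (P x).
  by nra.
move=> p pab.
have e4 : 0 < e / 4 by rewrite divr_gt0.
have [d1 d10 H1] := dP _ pab _ e4; have [d2 d20 H2] := dG _ pab _ e4.
exists (Num.min d1 d2); first by rewrite lt_min d10.
move=> x y _ xp py _ yxd _ _.
have [hx1 hx2 hy1 hy2] : [/\ `|x - p| < d1, `|x - p| < d2, `|y - p| < d1 & `|y - p| < d2].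
  move: yxd; rewrite lt_min => /andP[? ?].
  by rewrite ler0_norm ?subr_le0// (ger0_norm (_ : 0 <= y - p)) ?subr_ge0//; split; lra.
have := H1 _ hx1; have := H1 _ hy1; have := H2 _ hx2; have := H2 _ hy2.
cbv beta; rewrite ![p + _]addrC !subrK.
rewrite -!rcB -!rcM -!rcB !normcR.
rewrite (ler0_norm (_ : x - p <= 0)) ?subr_le0// (ger0_norm (_ : 0 <= y - p)) ?subr_ge0//.
rewrite ler_norml => /andP[g1 _]; rewrite ler_norml => /andP[_ g2] p1 p2.
have PGp := PG _ pab.
have -> : P y - P x = (P y - P p - (y - p)%:C * P' p) - (P x - P p - (x - p)%:C * P' p)
   + (y - x)%:C * P' p by rewrite !rcB; ring.
apply: le_trans (normcD _ _) _; rewrite normcM normcR ger0_norm; last by lra.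
have := normcB (P y - P p - (y - p)%:C * P' p) (P x - P p - (x - p)%:C * P' p).
have : (y - x) * normc (P' p) <= (y - x) * G' p by rewrite ler_wpM2l//; lra.
by nra.
Qed.

Lemma rderiv_linear (c : C) s : rderiv (fun t => t%:C * c) s c.
Proof.
move=> e e0; exists 1 => // h _.
rewrite (_ : _ - _ = 0) ?normc0 ?mulr_ge0 ?(ltW e0)//=.
by rewrite rcD; ring.
Qed.

Lemma rderiv_linearR (c : R) s : rderiv (fun t => (t * c)%:C) s c%:C.
Proof.
have -> : (fun t => (t * c)%:C) = (fun t => t%:C * c%:C).
  by apply/funext => t; rewrite rcM.
exact: rderiv_linear.
Qed.

Lemma mvt_bound P P' (M : R) a b : a <= b ->
  (forall s, a <= s <= b -> rderiv P s (P' s)) ->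
  (forall s, a <= s <= b -> normc (P' s) <= M) ->
  normc (P b - P a) <= M * (b - a).
Proof.
move=> ab dP PM; have -> : M * (b - a) = b * M - a * M by ring.
by apply: (mvt_dominated (G := fun t => t * M)) dP _ PM => // s _; exact: rderiv_linearR.
Qed.

Lemma rderiv0_eq P a b : (forall s, a <= s <= b -> rderiv P s 0) -> a <= b -> P a = P b.
Proof.
move=> dP ab; apply/esym/eqP; rewrite -subr_eq0 -normc_eq0; apply/eqP/le_anti.
rewrite normc_ge0 andbT.
apply: le_trans (mvt_bound (P' := fun=> 0) (M := 0) ab dP _) _; last by rewrite mul0r.
by move=> s _; rewrite normc0.
Qed.

Lemma primitive_eq P Q f a b : a <= b ->
  (forall s, a <= s <= b -> rderiv P s (f s)) ->
  (forall s, a <= s <= b -> rderiv Q s (f s)) -> P b - P a = Q b - Q a.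
Proof.
move=> ab dP dQ; have := @rderiv0_eq (fun t => P t - Q t) a b.
have d0 : forall s, a <= s <= b -> rderiv (fun t => P t - Q t) s 0.
  by move=> s sab; rewrite -(subrr (f s)); apply: rderivB; [exact: dP|exact: dQ].
move=> /(_ d0 ab) /= H.
by rewrite -[P b](subrK (Q b)) -H; ring.
Qed.

Lemma rderiv_realE (F : R -> R) s l :
  rderiv (fun t => (F t)%:C) s l%:C <-> is_derive s 1 F l.
Proof.
split=> [H|H].
  have E : h^-1 *: (F (h *: 1 + s) - F s) @[h --> 0^'] --> l.
    apply/cvgrPdist_le => e e0; have [d d0 K] := H _ e0.
    exists d => //= h /=; rewrite sub0r normrN => hd h0.
    have := K _ hd; cbv beta; rewrite -!rcB -rcM -rcB normcR.
    rewrite /GRing.scale /= mulr1 [h + s]addrC => k.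
    rewrite -[leRHS](mulfK (_ : `|h| != 0)) ?normr_eq0// ler_pdivlMr ?normr_gt0//.
    rewrite -normrM mulrBl [l * h]mulrC mulrAC mulVf// mul1r distrC.
    exact: k.
  apply: DeriveDef; first by apply/cvg_ex; exists l.
  exact: cvg_lim.
case: H => dF Fl e e0.
have : h^-1 *: (F (h *: 1 + s) - F s) @[h --> 0^'] --> l by rewrite -Fl; exact: dF.
move=> /cvgrPdist_le/(_ _ e0)[d /= d0 K]; exists d => // h hd; cbv beta.
rewrite -!rcB -rcM -rcB normcR.
have [->|h0] := eqVneq h 0; first by rewrite addr0 subrr mul0r subrr !normr0 mulr0.
have := K h; rewrite /= sub0r normrN => /(_ hd h0).
rewrite /GRing.scale /= mulr1 [h + s]addrC => k.
have -> : F (s + h) - F s - h * l = - ((l - h^-1 * (F (s + h) - F s)) * h).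
  by field.
by rewrite normrN normrM ler_wpM2r.
Qed.

(** The fundamental theorem of calculus is applied on each [[-M, M]]. The primitives normalised to
    vanish at 0 agree on overlaps, so using at [x] the one for [M = |x| + 1] patches them to the
    whole line. *)
Lemma real_primitive (f : R -> R) : continuous f ->
  exists P : R -> R, forall s, rderiv (fun t => (P t)%:C) s (f s)%:C.
Proof.
move=> cf.
have loc (M : R) : exists P : R -> R, P 0 = 0 /\
   (0 < M -> forall s, `|s| < M -> rderiv (fun t => (P t)%:C) s (f s)%:C).
  pose P x := (\int[lebesgue_measure]_(t in `[- M, x]) f t)%R.
  exists (fun x => P x - P 0); split; first by rewrite subrr.
  move=> M0 s; rewrite ltr_norml => /andP[Ms sM].
  have intf : lebesgue_measure.-integrable `[- M, M] (EFin \o f).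
    by apply: continuous_compact_integrable; [exact: segment_compact|exact: continuous_subspaceT].
  have [dP Pf] := @continuous_FTC1_closed R f (- M) s M sM intf Ms (cf s).
  have : is_derive s 1 P (f s) by apply: DeriveDef; rewrite -?derive1E.
  move=> /rderiv_realE dPs.
  have -> : (fun t => (P t - P 0)%:C) = (fun t => (P t)%:C - (P 0)%:C).
    by apply/funext => t; rewrite rcB.
  by rewrite -[(f s)%:C]subr0; apply: rderivB => //; exact: rderiv_cst.
have [p Hp] := choice loc.
have agree M N x : `|x| < M -> `|x| < N -> p M x = p N x.
  move=> xM xN; have M0 : 0 < M by apply: le_lt_trans xM.
  have N0 : 0 < N by apply: le_lt_trans xN.
  have [p0M dM] := Hp M; have [p0N dN] := Hp N.
  have lem a b : a <= b -> (forall s, a <= s <= b -> `|s| < M /\ `|s| < N) ->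
     p M b - p M a = p N b - p N a.
    move=> ab sab; apply: complexI; rewrite !rcB.
    apply: (primitive_eq (P := fun t => (p M t)%:C) (Q := fun t => (p N t)%:C)
       (f := fun t => (f t)%:C)) => // s /sab[sM sN]; [exact: dM|exact: dN].
  have [x0|x0] := leP 0 x.
    have := lem 0 x x0; rewrite p0M p0N !subr0; apply=> s /andP[s0 sx].
    by rewrite ger0_norm//; move: xM xN; rewrite ger0_norm//; split; lra.
  have := lem x 0 (ltW x0); rewrite p0M p0N !sub0r => h; apply: oppr_inj; apply: h.
  move=> s /andP[s0 sx].
  by rewrite ler0_norm//; move: xM xN; rewrite ltr0_norm//; split; lra.
exists (fun x => p (`|x| + 1) x) => s.
have s2 : `|s| < `|s| + 2 by rewrite ltrDl.
have [_ /(_ (le_lt_trans (normr_ge0 s) s2) s s2)] := Hp (`|s| + 2).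
apply: rderiv_near.
apply/nearrP; exists 1 => // t ts; congr (_%:C); apply: agree; last by rewrite ltrDl.
by have := ler_distD 0 t s; have := ler_normD (t - s) s; rewrite subrK; lra.
Qed.

Lemma primitive_exists f : continuous f -> exists P, forall s, rderiv P s (f s).
Proof.
move=> cf.
have [P1 H1] : exists P : R -> R, forall s, rderiv (fun t => (P t)%:C) s (Re (f s))%:C.
  by apply: real_primitive => s; exact: (cvg_Re (cf s)).
have [P2 H2] : exists P : R -> R, forall s, rderiv (fun t => (P t)%:C) s (Im (f s))%:C.
  by apply: real_primitive => s; exact: (cvg_Im (cf s)).
exists (fun t => (P1 t)%:C + 'i%C * (P2 t)%:C) => s.
by rewrite [f s]complexE; apply: rderivD => //; exact: rderivZ.
Qed.

End MeanValue.

Section Integral.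
Context {R : realType}.
Local Notation C := R[i].
Implicit Types (f g : R -> C) (a b c : R).

(** A chosen antiderivative on the whole line: rules for integrals become rules for derivatives plus
    uniqueness up to a constant, without measure theory. *)
Definition primitive f : R -> C :=
  xget (fun=> 0) [set P | forall s, rderiv P s (f s)].

(* Signed: Chasles' relation needs no ordering. Junk if f is not continuous. *)
Definition Int f a b : C := primitive f b - primitive f a.

Lemma primitiveP f : continuous f -> forall s, rderiv (primitive f) s (f s).
Proof.
move=> cf; rewrite /primitive; case: xgetP => [P _ //|].
by have [P HP] := primitive_exists cf => /(_ P).
Qed.

Lemma Int_primitive_le f P a b : a <= b -> continuous f ->
  (forall s, a <= s <= b -> rderiv P s (f s)) -> Int f a b = P b - P a.
Proof.
move=> ab cf dP; apply: (primitive_eq (f := f)) => // s _; exact: primitiveP.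
Qed.

Lemma Int_swap f a b : Int f b a = - Int f a b.
Proof. by rewrite /Int opprB. Qed.

Lemma Int_primitive f P a b : continuous f -> (forall s, rderiv P s (f s)) ->
  Int f a b = P b - P a.
Proof.
move=> cf dP; have [ab|/ltW ba] := leP a b; first exact: Int_primitive_le.
by rewrite Int_swap (@Int_primitive_le f P b a)// opprB.
Qed.

Lemma Int_chasles f a b c : Int f a b + Int f b c = Int f a c.
Proof. by rewrite /Int addrC subrKA. Qed.

Lemma Int_refl f a : Int f a a = 0.
Proof. by rewrite /Int subrr. Qed.

Lemma IntD f g a b : continuous f -> continuous g ->
  Int (fun t => f t + g t) a b = Int f a b + Int g a b.
Proof.
move=> cf cg; rewrite (@Int_primitive _ (fun t => primitive f t + primitive g t)).
- by rewrite /Int; ring.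
- by move=> s; apply: cvgD; [exact: cf|exact: cg].
- by move=> s; apply: rderivD; exact: primitiveP.
Qed.

Lemma IntZ (k : C) f a b : continuous f ->
  Int (fun t => k * f t) a b = k * Int f a b.
Proof.
move=> cf; rewrite (@Int_primitive _ (fun t => k * primitive f t)).
- by rewrite /Int; ring.
- by move=> s; apply: cvgM; [exact: cvg_cst|exact: cf].
- by move=> s; apply: rderivZ; exact: primitiveP.
Qed.

Lemma IntN f a b : continuous f -> Int (fun t => - f t) a b = - Int f a b.
Proof.
move=> cf; rewrite -mulN1r -IntZ//; congr (Int _ a b).
by apply/funext => t; rewrite mulN1r.
Qed.

Lemma IntB f g a b : continuous f -> continuous g ->
  Int (fun t => f t - g t) a b = Int f a b - Int g a b.
Proof.
move=> cf cg.
have cNg : continuous (fun t => - g t) by move=> s; apply: cvgN; exact: cg.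
exact: etrans (IntD a b cf cNg) (congr1 _ (IntN a b cg)).
Qed.

Lemma IntJ f a b : continuous f ->
  Int (fun t => conjc (f t)) a b = conjc (Int f a b).
Proof.
move=> cf; rewrite (@Int_primitive _ (fun t => conjc (primitive f t))).
- by rewrite /Int conjcB.
- by move=> s; apply: cvg_conjc; exact: cf.
- by move=> s; apply: rderivJ; exact: primitiveP.
Qed.

Lemma Int_cst (k : C) a b : Int (fun=> k) a b = (b - a)%:C * k.
Proof.
rewrite (@Int_primitive (fun=> k) (fun t => t%:C * k)).
- by rewrite rcB; ring.
- by move=> s; exact: cvg_cst.
- by move=> s; exact: rderiv_linear.
Qed.

Lemma Int_affine f (k c a b : R) : continuous f ->
  Int (fun t => k%:C * f (k * t + c)) a b = Int f (k * a + c) (k * b + c).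
Proof.
move=> cf.
have cf' : continuous (fun t => k%:C * f (k * t + c)).
  move=> s; apply: cvgM; first exact: cvg_cst.
  apply: (cvg_comp _ _ (_ : k * t + c @[t --> s] --> k * s + c)) (cf _).
  by apply: cvgD; [apply: cvgM; [exact: cvg_cst|exact: cvg_id]|exact: cvg_cst].
apply: (Int_primitive (P := fun t => primitive f (k * t + c)) a b cf') => s.
by apply: rderiv_affine; exact: primitiveP.
Qed.

Lemma Int_dominated f (h : R -> R) a b : a <= b -> continuous f -> continuous h ->
  (forall s, a <= s <= b -> normc (f s) <= h s) ->
  normc (Int f a b) <= Re (Int (fun t => (h t)%:C) a b).
Proof.
move=> ab cf ch fh; have [G dG] := real_primitive ch.
rewrite (@Int_primitive (fun t => (h t)%:C) (fun t => (G t)%:C)).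
- rewrite -rcB; apply: mvt_dominated fh => // s _; exact: primitiveP.
- by move=> s; apply: cvg_RC; exact: ch.
- exact: dG.
Qed.

Lemma Int_bound f (M : R) a b : a <= b -> continuous f ->
  (forall s, a <= s <= b -> normc (f s) <= M) ->
  normc (Int f a b) <= M * (b - a).
Proof.
by move=> ab cf fM; apply: mvt_bound fM => // s _; exact: primitiveP.
Qed.

Lemma Int_periodic f a b (p : R) : continuous f -> (forall s, f (s + p) = f s) ->
  Int f a (a + p) = Int f b (b + p).
Proof.
move=> cf fp.
suff -> : Int f b (b + p) = Int f b a + Int f a (a + p) - Int f (b + p) (a + p).
  suff -> : Int f (b + p) (a + p) = Int f b a by ring.
  have := @Int_affine f 1 p b a cf; rewrite !mul1r => <-.
  by congr (Int _ _ _); apply/funext => t; rewrite !mul1r fp.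
by rewrite /Int; ring.
Qed.

Lemma continuous_sum (I : Type) (r : seq I) (F : I -> R -> C) :
  (forall i, continuous (F i)) -> continuous (fun t => \sum_(i <- r) F i t).
Proof.
move=> cF; elim: r => [|i r ih].
  rewrite (_ : (fun t => _) = fun=> 0); first by move=> s; exact: cvg_cst.
  by apply/funext => t; rewrite big_nil.
rewrite (_ : (fun t => _) = fun t => F i t + \sum_(j <- r) F j t).
  by move=> s; apply: cvgD; [exact: cF|exact: ih].
by apply/funext => t; rewrite big_cons.
Qed.

Lemma Int_sum (I : Type) (r : seq I) (F : I -> R -> C) a b :
  (forall i, continuous (F i)) ->
  Int (fun t => \sum_(i <- r) F i t) a b = \sum_(i <- r) Int (F i) a b.
Proof.
move=> cF; elim: r => [|i r ih].
  rewrite big_nil (_ : (fun t => _) = fun=> 0) ?Int_cst ?mulr0//.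
  by apply/funext => t; rewrite big_nil.
rewrite big_cons -ih -IntD//; last exact: continuous_sum.
by congr (Int _ a b); apply/funext => t; rewrite big_cons.
Qed.

End Integral.

(** * Goursat's theorem on rectangles and local primitives *)

Section Goursat.
Context {R : realType}.
Local Notation C := R[i].
Implicit Types (F P : C -> C) (a b c d x y : R) (z : C).

Lemma complexXY x y : x +i* y = x%:C + 'i%C * y%:C :> C.
Proof. by rewrite [LHS]complexE. Qed.

Lemma rderiv_horizontal y x : rderiv (fun t => t +i* y : C) x 1.
Proof.
have -> : (fun t => t +i* y : C) = (fun t => t%:C * 1 + 'i%C * y%:C).
  by apply/funext => t; rewrite complexXY mulr1.
by rewrite -[X in rderiv _ _ X]addr0; apply: rderivD; [exact: rderiv_linear|exact: rderiv_cst].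
Qed.

Lemma rderiv_vertical x y : rderiv (fun t => x +i* t : C) y 'i%C.
Proof.
have -> : (fun t => x +i* t : C) = (fun t => x%:C + t%:C * 'i%C).
  by apply/funext => t; rewrite complexXY mulrC.
by rewrite -[X in rderiv _ _ X]add0r; apply: rderivD; [exact: rderiv_cst|exact: rderiv_linear].
Qed.

Lemma continuous_horizontal F y : continuous F -> continuous (fun t => F (t +i* y)).
Proof.
by move=> cF t; apply: (cvg_comp _ _ (rderiv_cont (rderiv_horizontal y t))) (cF _).
Qed.

Lemma continuous_vertical F x : continuous F -> continuous (fun t => F (x +i* t)).
Proof.
by move=> cF t; apply: (cvg_comp _ _ (rderiv_cont (rderiv_vertical x t))) (cF _).
Qed.

Arguments continuous_horizontal {F} y _.
Arguments continuous_vertical {F} x _.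

Definition hseg F y a b := Int (fun t => F (t +i* y)) a b.
Definition vseg F x c d := 'i%C * Int (fun t => F (x +i* t)) c d.

Definition rect_boundary F a b c d :=
  hseg F c a b + vseg F b c d - hseg F d a b - vseg F a c d.

Lemma rect_boundary_splitx F a b c d m :
  rect_boundary F a m c d + rect_boundary F m b c d = rect_boundary F a b c d.
Proof.
by rewrite /rect_boundary /hseg -(Int_chasles _ a m b) -(Int_chasles (fun t => F (t +i* d)) a m b); ring.
Qed.

Lemma rect_boundary_splity F a b c d m :
  rect_boundary F a b c m + rect_boundary F a b m d = rect_boundary F a b c d.
Proof.
by rewrite /rect_boundary /vseg -(Int_chasles _ c m d) -(Int_chasles (fun t => F (a +i* t)) c m d); ring.
Qed.

Lemma rect_boundary_swapx F a b c d :
  rect_boundary F b a c d = - rect_boundary F a b c d.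
Proof. by rewrite /rect_boundary /hseg !(Int_swap _ a b); ring. Qed.

Lemma rect_boundary_swapy F a b c d :
  rect_boundary F a b d c = - rect_boundary F a b c d.
Proof. by rewrite /rect_boundary /vseg !(Int_swap _ c d); ring. Qed.

Lemma rect_boundaryD F H a b c d : continuous F -> continuous H ->
  rect_boundary (fun z => F z + H z) a b c d =
  rect_boundary F a b c d + rect_boundary H a b c d.
Proof.
move=> cF cH; have h y := IntD a b (continuous_horizontal y cF) (continuous_horizontal y cH).
have v x := IntD c d (continuous_vertical x cF) (continuous_vertical x cH).
by rewrite /rect_boundary /hseg /vseg !h !v; ring.
Qed.

Lemma rect_boundary_primitive F P a b c d : continuous F ->
  (forall z, cderiv P z (F z)) -> rect_boundary F a b c d = 0.
Proof.
move=> cF dP.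
have h y : hseg F y a b = P (b +i* y) - P (a +i* y).
  apply: (Int_primitive (P := fun t => P (t +i* y)) a b (continuous_horizontal y cF)) => s.
  by rewrite -[F _]mulr1; apply: rderiv_comp; [exact: dP|exact: rderiv_horizontal].
have v x : vseg F x c d = P (x +i* d) - P (x +i* c).
  rewrite /vseg -IntZ; last exact: continuous_vertical.
  apply: (Int_primitive (P := fun t => P (x +i* t)) c d) => s.
    by apply: cvgM; [exact: cvg_cst|exact: continuous_vertical].
  by rewrite mulrC; apply: rderiv_comp; [exact: dP|exact: rderiv_vertical].
by rewrite /rect_boundary !h !v; ring.
Qed.

Lemma ccontinuousP F z : {for z, continuous F} <->
  forall e : R, 0 < e -> exists2 d, 0 < d & forall t, normc (t - z) < d -> normc (F t - F z) < e.
Proof.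
split=> [/(cvgcP (FF := nbhs_filter z)) h e /h/nearcP//|h].
by apply/(cvgcP (FF := nbhs_filter z)) => e /h H; apply/nearcP.
Qed.

Lemma ccontinuousD F H : continuous F -> continuous H ->
  continuous (fun z => F z + H z).
Proof. by move=> cF cH z; exact: (cvgD (cF z) (cH z)). Qed.

Lemma cderiv_continuous F z l : cderiv F z l -> {for z, continuous F}.
Proof.
move=> dF; apply/ccontinuousP => e e0.
have [d d0 H] := (ccontP setT _ _).1 (cderiv_cont setT dF) _ e0.
by exists d => // y; exact: H.
Qed.

Lemma cderiv_affine_primitive (p q : C) z :
  cderiv (fun t => p * t + q / 2 * (t * t)) z (p + q * z).
Proof.
have -> : p + q * z = p * 1 + q / 2 * (1 * z + z * 1) by field.
apply: cderivD; first by apply: cderivZ; exact: cderiv_id.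
by apply: cderivZ; apply: cderivM; exact: cderiv_id.
Qed.

Lemma continuous_affine (p q : C) : continuous (fun t : C => p + q * t).
Proof.
move=> z; apply: (@cderiv_continuous _ _ (0 + q * 1)).
by apply: cderivD; [exact: cderiv_cst|apply: cderivZ; exact: cderiv_id].
Qed.

Lemma rect_boundary_bound F a b c d (M : R) : a <= b -> c <= d -> continuous F ->
  (forall x y, a <= x <= b -> c <= y <= d -> normc (F (x +i* y)) <= M) ->
  normc (rect_boundary F a b c d) <= M * (2 * ((b - a) + (d - c))).
Proof.
move=> ab cd cF FM.
have h y : c <= y <= d -> normc (hseg F y a b) <= M * (b - a).
  by move=> ycd; apply: (Int_bound ab (continuous_horizontal y cF)) => s sab; exact: FM.
have v x : a <= x <= b -> normc (vseg F x c d) <= M * (d - c).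
  move=> xab; rewrite normcM normci mul1r.
  by apply: (Int_bound cd (continuous_vertical x cF)) => s sab; exact: FM.
have h1 := h c; have h2 := h d; have v1 := v a; have v2 := v b.
rewrite lexx cd in h1; rewrite lexx cd in h2; rewrite lexx ab in v1; rewrite lexx ab in v2.
have {}h1 := h1 isT; have {}h2 := h2 isT; have {}v1 := v1 isT; have {}v2 := v2 isT.
rewrite /rect_boundary; apply: le_trans (normcB _ _) _.
apply: le_trans (lerD (normcB _ _) (lexx _)) _.
apply: le_trans (lerD (lerD (normcD _ _) (lexx _)) (lexx _)) _.
by lra.
Qed.

(* The number of corners (with multiplicity) that [x0] contributes: additive
   under subdivision, and at least 1 as soon as x0 lies in [a, b]. *)
Definition corner (x0 a b : R) : R := (a <= x0 < b)%R%:R + (a < x0 <= b)%R%:R.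

Lemma corner_split x0 a m b : a <= m -> m <= b ->
  corner x0 a m + corner x0 m b = corner x0 a b.
Proof.
move=> am mb; rewrite /corner.
have e1 : ((a <= x0 < b)%R%:R : R) = (a <= x0 < m)%R%:R + (m <= x0 < b)%R%:R.
  have [xm|mx] := ltP x0 m; first by rewrite andbT andFb addr0 (lt_le_trans xm mb) andbT.
  by rewrite andbF andTb add0r (le_trans am mx).
have e2 : ((a < x0 <= b)%R%:R : R) = (a < x0 <= m)%R%:R + (m < x0 <= b)%R%:R.
  have [mx|xm] := ltP m x0; last by rewrite andbT andFb addr0 (le_trans xm mb) andbT.
  by rewrite andbF andTb add0r (le_lt_trans am mx).
by rewrite e1 e2; ring.
Qed.

Lemma corner_ge0 x0 a b : 0 <= corner x0 a b.
Proof. by rewrite /corner addr_ge0. Qed.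

Lemma corner_ge1 x0 a b : a < b -> a <= x0 <= b -> 1 <= corner x0 a b.
Proof.
move=> ab /andP[ax xb]; rewrite /corner ax xb /= andbT.
have [|bx] := ltP x0 b; first by rewrite lerDl.
by rewrite (lt_le_trans ab bx) add0r.
Qed.

(** One exceptional point [z0], where only continuity is known, is allowed so that difference
    quotients can be integrated later. Bisection bounds the boundary integral by [e * mass] with
    [mass] additive: the area term pays for points of differentiability, the corner counts pay for
    [z0]. *)
Lemma goursat_rect F z0 a b c d : a <= b -> c <= d -> continuous F ->
  (forall x y, a <= x <= b -> c <= y <= d -> x +i* y != z0 ->
     exists l, cderiv F (x +i* y) l) ->
  rect_boundary F a b c d = 0.
Proof.
move=> ab cd cF dF.
have [abE|nab] := eqVneq a b.
  by rewrite /rect_boundary /hseg abE !Int_refl; ring.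
have [cdE|ncd] := eqVneq c d.
  by rewrite /rect_boundary /vseg cdE !Int_refl; ring.
have w0 : 0 < b - a by rewrite subr_gt0 lt_neqAle nab.
have h0 : 0 < d - c by rewrite subr_gt0 lt_neqAle ncd.
(* Diameter (bounded by the sum of the sides) times perimeter, divided by area: the same number for
   all rectangles similar to the initial one. *)
pose K := 2 * ((b - a) + (d - c)) ^+ 2 / ((b - a) * (d - c)).
have K0 : 0 < K.
  by apply: divr_gt0; rewrite mulr_gt0// exprn_gt0// addr_gt0.
pose mass a' b' c' d' := K * ((b' - a') * (d' - c')) +
  corner (Re z0) a' b' * corner (Im z0) c' d'.
suff H e : 0 < e -> normc (rect_boundary F a b c d) <= e * mass a b c d.
  apply/eqP; rewrite -normc_eq0; apply/eqP/le_anti; rewrite normc_ge0 andbT.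
  apply/ler_addgt0Pr => e e0; rewrite add0r.
  have m0 : 0 < mass a b c d.
    apply: ltr_pwDl; first exact: mulr_gt0 K0 (mulr_gt0 w0 h0).
    exact: mulr_ge0 (corner_ge0 _ _ _) (corner_ge0 _ _ _).
  by have := H (e / mass a b c d) (divr_gt0 e0 m0); rewrite divfK ?gt_eqF.
move=> e0.
pose Q a' b' c' d' : Prop :=
  normc (rect_boundary F a' b' c' d') <= e * mass a' b' c' d'.
suff : Q a b c d by [].
apply: rect_induction => //; rewrite /Q {Q}.
  move=> x1 x2 y1 y2 x12 y12; set xm := (x1 + x2) / 2; set ym := (y1 + y2) / 2.
  move=> q1 q2 q3 q4.
  have xm1 : x1 <= xm by rewrite /xm; lra. have xm2 : xm <= x2 by rewrite /xm; lra.
  have ym1 : y1 <= ym by rewrite /ym; lra. have ym2 : ym <= y2 by rewrite /ym; lra.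
  rewrite -(rect_boundary_splitx _ _ _ _ _ xm) -!(rect_boundary_splity _ _ _ y1 y2 ym).
  have -> : mass x1 x2 y1 y2 = (mass x1 xm y1 ym + mass x1 xm ym y2) +
      (mass xm x2 y1 ym + mass xm x2 ym y2).
    rewrite /mass -(corner_split _ xm1 xm2) -(corner_split _ ym1 ym2).
    by ring.
  clearbody mass; rewrite !(mulrDr e).
  apply: le_trans (normcD _ _) _; apply: lerD.
    by apply: le_trans (normcD _ _) _; apply: lerD.
  by apply: le_trans (normcD _ _) _; apply: lerD.
move=> p q pab qcd; pose zp : C := p +i* q.
have inrect l x y u v : 0 < l -> x <= p -> p <= x + l * (b - a) ->
    y <= q -> q <= y + l * (d - c) ->
    x <= u <= x + l * (b - a) -> y <= v <= y + l * (d - c) ->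
    normc (u +i* v - zp) <= l * ((b - a) + (d - c)).
  move=> l0 xp px yq qy /andP[xu ux] /andP[yv vy].
  apply: le_trans (normc_le_ReIm _) _; rewrite cReD cImD cReN cImN /= mulrDr.
  by apply: lerD; rewrite ler_norml; apply/andP; split; clear -l0 xp px yq qy xu ux yv vy; lra.
(* At [z0] local boundedness of [F] suffices: the perimeter is made so small that the integral is at
   most [e], while the product of corner counts is at least 1. *)
have [zpE|zpN] := eqVneq zp z0.
  have [r r0 Hr] : exists2 r, 0 < r & forall z, normc (z - zp) < r -> normc (F z) <= normc (F zp) + 1.
    have /ccontinuousP/(_ _ ltr01)[r r0 Hr] := cF zp; exists r => // z /Hr h.
    by rewrite -[F z](subrK (F zp)) addrC; apply: le_trans (normcD _ _) _; rewrite lerD2l ltW.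
  set M := normc (F zp) + 1 in Hr.
  have M0 : 0 < M by rewrite ltr_wpDl ?normc_ge0.
  have s0 : 0 < (b - a) + (d - c) by rewrite addr_gt0.
  exists (Num.min (r / ((b - a) + (d - c))) (e / (M * (2 * ((b - a) + (d - c)))))).
    by rewrite lt_min !divr_gt0// mulr_gt0// mulr_gt0.
  move=> l x y l0; rewrite lt_min => /andP[].
  rewrite ltr_pdivlMr// ltr_pdivlMr; last by rewrite mulr_gt0// mulr_gt0.
  move=> lr le ax xp px xb cy yq qy yd.
  have lw : 0 < l * (b - a) by rewrite mulr_gt0.
  have lh : 0 < l * (d - c) by rewrite mulr_gt0.
  apply: le_trans (rect_boundary_bound (M := M) _ _ cF _) _; rewrite ?lerDl ?(ltW lw) ?(ltW lh)//.
    move=> u v ux vy; apply: Hr; apply: le_lt_trans lr; exact: inrect ux vy.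
  apply: le_trans (_ : e <= _).
    by apply: ltW; apply: le_lt_trans le; rewrite le_eqVlt; apply/orP; left; apply/eqP; ring.
  rewrite -[leLHS]mulr1 ler_pM2l// /mass.
  have c1 : 1 <= corner (Re z0) x (x + l * (b - a)).
    by apply: corner_ge1; rewrite ?ltrDl// -zpE /= xp.
  have c2 : 1 <= corner (Im z0) y (y + l * (d - c)).
    by apply: corner_ge1; rewrite ?ltrDl// -zpE /= yq.
  have : 0 <= K * ((x + l * (b - a) - x) * (y + l * (d - c) - y)).
    by apply: (mulr_ge0 (ltW K0)); rewrite ![_ + _ - _]addrAC !subrr !add0r mulr_ge0 ?ltW.
  by nra.
have [l dl] := dF p q pab qcd zpN.
have [r r0 Hr] := dl _ e0.
have s0 : 0 < (b - a) + (d - c) by rewrite addr_gt0.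
exists (r / ((b - a) + (d - c))); first by rewrite divr_gt0.
move=> k x y k0; rewrite ltr_pdivlMr// => kr ax xp px xb cy yq qy yd.
have lw : 0 < k * (b - a) by rewrite mulr_gt0.
have lh : 0 < k * (d - c) by rewrite mulr_gt0.
(* Subtracting the tangent map, which has a primitive, leaves the boundary integral unchanged and
   the integrand at most [e] times the diameter. *)
pose A z := (- F zp + l * zp) + (- l) * z.
have FA : rect_boundary F x (x + k * (b - a)) y (y + k * (d - c)) =
    rect_boundary (fun z => F z + A z) x (x + k * (b - a)) y (y + k * (d - c)).
  rewrite (rect_boundaryD _ _ _ _ cF (@continuous_affine _ _)).
  by rewrite (rect_boundary_primitive _ _ _ _ (@continuous_affine _ _) (cderiv_affine_primitive _ _)) addr0.
rewrite FA; apply: le_trans (rect_boundary_bound (M := e * (k * (b - a + (d - c)))) _ _ _ _) _.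
- by lra.
- by lra.
- exact: ccontinuousD cF (@continuous_affine _ _).
- move=> u v ux vy; have uv := inrect k x y u v k0 xp px yq qy ux vy.
  have := Hr (u +i* v - zp) (le_lt_trans uv kr).
  rewrite -/zp [zp + _]addrC subrK => h.
  rewrite (_ : _ + _ = F (u +i* v) - F zp - (u +i* v - zp) * l); last by rewrite /A; ring.
  by apply: (le_trans h); rewrite ler_pM2l.
rewrite -mulrA ler_pM2l// /mass.
apply: le_trans (_ : K * ((x + k * (b - a) - x) * (y + k * (d - c) - y)) <= _); last first.
  by rewrite lerDl mulr_ge0 ?corner_ge0.
rewrite le_eqVlt; apply/orP; left; apply/eqP; rewrite /K; field.
by rewrite !gt_eqF.
Qed.

(** Retraction of the line onto [[-k, k]]. [Int] needs integrands continuous everywhere, so a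
    function given near a point is extended by clamping the coordinates. *)
Definition clamp (k t : R) : R := Num.min (Num.max t (- k)) k.

Lemma clamp_lip k s t : `|clamp k s - clamp k t| <= `|s - t|.
Proof.
rewrite /clamp ler_norml; have := ler_norm (s - t); have := ler_norm (t - s).
rewrite (distrC t s) => h1 h2.
have n0 := normr_ge0 (s - t).
rewrite /Num.min /Num.max.
case: (ltP s (- k)) => ?; case: (ltP t (- k)) => ?; case: ltP => ?; case: ltP => ?; apply/andP; split; lra.
Qed.

Lemma clamp_id k t : `|t| <= k -> clamp k t = t.
Proof.
by rewrite ler_norml => /andP[h1 h2]; rewrite /clamp max_l// min_l.
Qed.

Lemma clamp_norm k t : 0 <= k -> `|clamp k t| <= k.
Proof.
move=> k0; rewrite /clamp ler_norml ge_min lexx orbT andbT le_min le_max lexx orbT /=.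
by lra.
Qed.

Lemma Int_bound_signed (f : R -> C) (M : R) a b : continuous f ->
  (forall s, `|s - a| <= `|b - a| -> normc (f s) <= M) ->
  normc (Int f a b) <= M * `|b - a|.
Proof.
move=> cf fM; have [ab|/ltW ba] := leP a b.
  rewrite (ger0_norm (_ : 0 <= b - a)) ?subr_ge0//.
  apply: Int_bound => // s /andP[as_ sb]; apply: fM.
  by rewrite !ger0_norm ?subr_ge0// lerB.
rewrite Int_swap normcN distrC (ger0_norm (_ : 0 <= a - b)) ?subr_ge0//.
apply: Int_bound => // s /andP[bs sa]; apply: fM.
by rewrite !ler0_norm ?subr_le0// !opprB lerB.
Qed.

(** The candidate integrates from [z1] horizontally, then vertically. Goursat's theorem lets its
    increment be computed along a horizontal and a vertical segment starting at [z], where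
    continuity of [F] gives the derivative, also at [z0] itself. *)
Lemma local_primitive F z1 z0 (r : R) : 0 < r ->
  (forall z, normc (z - z1) < r -> {for z, continuous F}) ->
  (forall z, normc (z - z1) < r -> z != z0 -> exists l, cderiv F z l) ->
  exists P, forall z, normc (z - z1) < r / 4 -> cderiv P z (F z).
Proof.
(* The square of half-side [r / 3] lies in the disc of radius [r], as [k + k < r], and contains the
   disc of radius [r / 4]. *)
move=> r0 cF dF; pose k := r / 3.
have k0 : 0 < k by rewrite divr_gt0.
pose x1 := Re z1; pose y1 := Im z1.
pose cl z : C := (x1 + clamp k (Re z - x1)) +i* (y1 + clamp k (Im z - y1)).
have cl_in z : normc (cl z - z1) < r.
  apply: le_lt_trans (normc_le_ReIm _) _.
  rewrite cReD cImD cReN cImN /= -/x1 -/y1 [x1 + _]addrC [y1 + _]addrC !addrK.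
  by have := clamp_norm (Re z - x1) (ltW k0); have := clamp_norm (Im z - y1) (ltW k0); rewrite /k; lra.
have cl_id z : `|Re z - x1| <= k -> `|Im z - y1| <= k -> cl z = z.
  move=> h1 h2; apply: complex_eq => /=; rewrite clamp_id//; lra.
have cl_lip z w : normc (cl z - cl w) <= 2 * normc (z - w).
  apply: le_trans (normc_le_ReIm _) _; rewrite cReD cImD cReN cImN /=.
  have a1 := clamp_lip k (Re z - x1) (Re w - x1).
  have a2 := clamp_lip k (Im z - y1) (Im w - y1).
  have := normc_Re (z - w); have := normc_Im (z - w); rewrite cReD cImD cReN cImN => b1 b2.
  rewrite (_ : _ - x1 - _ = Re z - Re w) in a1; last by ring.
  rewrite (_ : _ - y1 - _ = Im z - Im w) in a2; last by ring.
  rewrite (_ : _ - _ = clamp k (Re z - x1) - clamp k (Re w - x1)); last by ring.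
  rewrite (_ : y1 + _ - _ = clamp k (Im z - y1) - clamp k (Im w - y1)); last by ring.
  by lra.
pose G z := F (cl z).
have cG : continuous G.
  move=> z; apply/ccontinuousP => e e0.
  have /ccontinuousP/(_ _ e0)[s s0 Hs] := cF _ (cl_in z).
  exists (s / 2); first by rewrite divr_gt0.
  by move=> w wz; apply: Hs; apply: le_lt_trans (cl_lip _ _) _; lra.
have sq_near z : `|Re z - x1| < k -> `|Im z - y1| < k -> \forall w \near z, F w = G w.
  move=> h1 h2; apply/nearcP.
  exists (Num.min (k - `|Re z - x1|) (k - `|Im z - y1|)); first by rewrite lt_min !subr_gt0 h1.
  move=> w; rewrite lt_min => /andP[w1 w2]; rewrite /G cl_id//.
    have := ler_distD (Re z) (Re w) x1; have := normc_Re (w - z); rewrite cReD cReN; lra.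
  have := ler_distD (Im z) (Im w) y1; have := normc_Im (w - z); rewrite cImD cImN; lra.
have rect0 a b c d : `|a - x1| < k -> `|b - x1| < k -> `|c - y1| < k -> `|d - y1| < k ->
    rect_boundary G a b c d = 0.
  wlog ab : a b / a <= b.
    move=> W ak bk; have [ab|/ltW ba] := leP a b; first exact: W.
    by move=> ck dk; rewrite rect_boundary_swapx W ?oppr0.
  wlog cd : c d / c <= d.
    move=> W ak bk ck dk; have [cd|/ltW dc] := leP c d; first exact: W.
    by rewrite rect_boundary_swapy W ?oppr0.
  move=> ak bk ck dk; apply: (@goursat_rect G z0) => // x y /andP[ax xb] /andP[cy yd] xy0.
  have xk : `|x - x1| < k by move: ak bk; rewrite !ltr_norml; lra.
  have yk : `|y - y1| < k by move: ck dk; rewrite !ltr_norml; lra.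
  have inr : normc (x +i* y - z1) < r.
    apply: le_lt_trans (normc_le_ReIm _) _; rewrite cReD cImD cReN cImN /= -/x1 -/y1.
    by move: xk yk; rewrite /k; lra.
  have [l dl] := dF _ inr xy0.
  by exists l; apply: cderiv_near dl; exact: sq_near.
pose P z := hseg G y1 x1 (Re z) + vseg G (Re z) y1 (Im z).
exists P => z zr.
have zx : `|Re z - x1| < k.
  by have := normc_Re (z - z1); rewrite cReD cReN -/x1 /k; lra.
have zy : `|Im z - y1| < k.
  by have := normc_Im (z - z1); rewrite cImD cImN -/y1 /k; lra.
have Gz : F z = G z by have /nearcP[d d0 ->] := sq_near z zx zy; rewrite // subrr normc0.
move=> e e0; have e2 : 0 < e / 2 by rewrite divr_gt0.
have /ccontinuousP/(_ _ e2)[d d0 Hd] := cG z.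
exists (Num.min (d / 2) (Num.min (k - `|Re z - x1|) (k - `|Im z - y1|))).
  by rewrite !lt_min !subr_gt0 divr_gt0// zx.
move=> h; rewrite !lt_min => /and3P[hd hx hy].
set h1 := Re h; set h2 := Im h; set x := Re z; set y := Im z.
have h1n : `|h1| <= normc h by exact: normc_Re.
have h2n : `|h2| <= normc h by exact: normc_Im.
have xk : `|x + h1 - x1| < k.
  have := ler_distD x (x + h1) x1; rewrite [x + h1 - x]addrAC subrr add0r.
  by rewrite -/x in hx; lra.
have := rect0 x (x + h1) y1 y zx xk; rewrite subrr normr0 => /(_ k0 zy) r1.
have PD : P (z + h) - P z = hseg G y x (x + h1) + vseg G (x + h1) y (y + h2).
  rewrite /P cReD cImD -/x -/y -/h1 -/h2.
  rewrite /hseg -(Int_chasles (fun t => G (t +i* y1)) x1 x (x + h1)).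
  rewrite /vseg -(Int_chasles (fun t => G ((x + h1) +i* t)) y1 y (y + h2)).
  move: r1; rewrite /rect_boundary /hseg /vseg => r1.
  by rewrite -[RHS]addr0 -r1; ring.
have hE : h * F z = h1%:C * G z + 'i%C * (h2%:C * G z).
  by rewrite Gz {1}[h]complexE; ring.
have -> : P (z + h) - P z - h * F z =
   Int (fun t => G (t +i* y) - G z) x (x + h1) +
   'i%C * Int (fun t => G ((x + h1) +i* t) - G z) y (y + h2).
  have cc : continuous (fun _ : R => G z) by move=> s; exact: cvg_cst.
  have b1 := IntB x (x + h1) (continuous_horizontal y cG) cc.
  have b2 := IntB y (y + h2) (continuous_vertical (x + h1) cG) cc.
  rewrite PD hE (etrans b1 (congr1 _ (congr1 _ (Int_cst _ _ _)))).
  rewrite (etrans b2 (congr1 _ (congr1 _ (Int_cst _ _ _)))).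
  rewrite /hseg /vseg [x + h1 - x]addrAC [y + h2 - y]addrAC !subrr !add0r.
  by ring.
have Gd u v : `|u - x| <= `|h1| -> `|v - y| <= `|h2| -> normc (G (u +i* v) - G z) <= e / 2.
  move=> u1 v1; apply: ltW; apply: Hd; apply: le_lt_trans (normc_le_ReIm _) _.
  by rewrite cReD cImD cReN cImN /= -/x -/y; lra.
apply: le_trans (normcD _ _) _; rewrite normcM normci mul1r.
have -> : e * normc h = e / 2 * normc h + e / 2 * normc h by field.
apply: lerD.
  apply: le_trans (_ : e / 2 * `|x + h1 - x| <= _); last first.
    by rewrite [x + h1 - x]addrAC subrr add0r ler_pM2l.
  apply: Int_bound_signed.
    by move=> s; apply: cvgB; [exact: (continuous_horizontal y cG)|exact: cvg_cst].
  move=> s; rewrite [x + h1 - x]addrAC subrr add0r => sx; apply: Gd => //.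
  by rewrite subrr normr0.
apply: le_trans (_ : e / 2 * `|y + h2 - y| <= _); last first.
  by rewrite [y + h2 - y]addrAC subrr add0r ler_pM2l.
apply: Int_bound_signed.
  by move=> s; apply: cvgB; [exact: (continuous_vertical (x + h1) cG)|exact: cvg_cst].
move=> s; rewrite [y + h2 - y]addrAC subrr add0r => sy; apply: Gd => //.
by rewrite [x + h1 - x]addrAC subrr add0r.
Qed.

End Goursat.

(** * Primitives carried along a homotopy *)

Section PrimitiveAlong.
Context {R : realType}.
Local Notation C := R[i].
Implicit Types (F P : C -> C) (a b c d : R) (z : C).

Definition primitive_on F P z (r : R) :=
  forall y, normc (y - z) < r -> cderiv P y (F y).

Lemma primitive_on_le F P z (r r' : R) : r' <= r -> primitive_on F P z r ->
  primitive_on F P z r'.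
Proof. by move=> rr' h y yz; apply: h; exact: lt_le_trans rr'. Qed.

Lemma ball_segment z0 z z' (r t : R) : 0 <= t <= 1 ->
  normc (z - z0) < r -> normc (z' - z0) < r -> normc (z + t%:C * (z' - z) - z0) < r.
Proof.
move=> /andP[t0 t1] zr zr'.
have -> : z + t%:C * (z' - z) - z0 = (1 - t)%:C * (z - z0) + t%:C * (z' - z0).
  by rewrite rcB; ring.
apply: le_lt_trans (normcD _ _) _; rewrite !normcM !normcR !ger0_norm ?subr_ge0//.
have [->|tn0] := eqVneq t 0; first by rewrite mul0r addr0 subr0 mul1r.
have tp : 0 < t by rewrite lt_neqAle eq_sym tn0.
have h1 : t * normc (z' - z0) < t * r by rewrite ltr_pM2l.
have h2 : (1 - t) * normc (z - z0) <= (1 - t) * r.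
  by rewrite ler_wpM2l ?subr_ge0// ltW.
by lra.
Qed.

Lemma primitive_on_lip F P z0 (r M : R) z z' : primitive_on F P z0 r ->
  (forall y, normc (y - z0) < r -> normc (F y) <= M) ->
  normc (z - z0) < r -> normc (z' - z0) < r ->
  normc (P z' - P z) <= M * normc (z' - z).
Proof.
move=> dP FM zr zr'.
have dQ s : 0 <= s <= 1 -> rderiv (fun t : R => P (z + t%:C * (z' - z))) s
    (F (z + s%:C * (z' - z)) * (z' - z)).
  move=> s01; apply: rderiv_comp; first by apply: dP; exact: ball_segment.
  rewrite -[X in rderiv _ _ X]add0r; apply: rderivD; first exact: rderiv_cst.
  exact: rderiv_linear.
have := mvt_bound (P := fun t : R => P (z + t%:C * (z' - z)))
  (M := M * normc (z' - z)) ler01 dQ.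
rewrite subr0 mulr1 mul0r addr0 mul1r [z + _]addrC subrK; apply.
move=> s s01; rewrite normcM; apply: ler_wpM2r; first exact: normc_ge0.
by apply: FM; exact: ball_segment.
Qed.

Lemma primitive_on_eq F P Q z0 (r : R) z : primitive_on F P z0 r ->
  primitive_on F Q z0 r -> normc (z - z0) < r -> P z - Q z = P z0 - Q z0.
Proof.
move=> dP dQ zr; apply/eqP; rewrite -subr_eq0 -normc_eq0; apply/eqP/le_anti.
rewrite normc_ge0 andbT; have r0 : 0 < r := le_lt_trans (normc_ge0 _) zr.
apply: le_trans (primitive_on_lip (F := fun=> 0) (P := fun y => P y - Q y) (z0 := z0)
   (r := r) (M := 0) _ _ _ zr) _; last by rewrite mul0r.
- by move=> y yr; rewrite -(subrr (F y)); apply: cderivB; [exact: dP|exact: dQ].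
- by move=> y _; rewrite normc0.
- by rewrite subrr normc0.
Qed.

Definition continuous2 (Phi : R -> R -> C) := forall s t e, 0 < e ->
  exists2 d, 0 < d & forall s' t', `|s' - s| < d -> `|t' - t| < d ->
    normc (Phi s' t' - Phi s t) < e.

(** [h] lifts the possibly multivalued primitive of [F] to the parameter rectangle: locally it is a
    genuine primitive composed with [Phi]. Nothing is differentiated in [Phi], so intermediate loops
    need not be rectifiable. *)
Definition primitive_along F (Phi h : R -> R -> C) a b c d :=
  forall s t, a <= s <= b -> c <= t <= d -> exists r e P,
    [/\ 0 < r, 0 < e, primitive_on F P (Phi s t) r &
      forall s' t', a <= s' <= b -> c <= t' <= d -> `|s' - s| < e -> `|t' - t| < e ->
        normc (Phi s' t' - Phi s t) < r /\ h s' t' = P (Phi s' t')].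

Lemma primitive_along_swap F Phi h a b c d :
  primitive_along F Phi h a b c d ->
  primitive_along F (fun t s => Phi s t) (fun t s => h s t) c d a b.
Proof.
move=> H t s tcd sab; have [r [e [P [r0 e0 dP hP]]]] := H s t sab tcd.
by exists r, e, P; split => // t' s' *; exact: hP.
Qed.

Lemma continuous2_swap Phi : continuous2 Phi -> continuous2 (fun t s => Phi s t).
Proof.
move=> H t s e e0; have [d d0 Hd] := H s t e e0.
by exists d => // t' s' *; exact: Hd.
Qed.

(** On the common side [s = m] the two lifts differ locally by a constant, hence by a single
    constant [k], which is added to the first lift. *)
Lemma primitive_along_glue F Phi h1 h2 a m b c d : continuous2 Phi ->
  a <= m -> m <= b -> c <= d ->
  primitive_along F Phi h1 a m c d -> primitive_along F Phi h2 m b c d ->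
  exists h, primitive_along F Phi h a b c d.
Proof.
move=> cPhi am mb cd H1 H2.
have am' : a <= m <= m by rewrite am lexx.
have mb' : m <= m <= b by rewrite mb lexx.
have cst t : c <= t <= d -> h2 m t - h1 m t = h2 m c - h1 m c.
  move=> /andP[ct td].
  pose Q x y : Prop := c <= x -> y <= d -> h2 m y - h1 m y = h2 m x - h1 m x.
  suff : Q c t by apply.
  apply: itv_induction => //.
    move=> x y z xy yz q1 q2 cx zd.
    by rewrite (q2 (le_trans cx xy) zd) (q1 cx (le_trans yz zd)).
  move=> p /andP[cp pt]; have pcd : c <= p <= d by rewrite cp (le_trans pt).
  have [r1 [e1 [P1 [r10 e10 dP1 hP1]]]] := H1 m p am' pcd.
  have [r2 [e2 [P2 [r20 e20 dP2 hP2]]]] := H2 m p mb' pcd.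
  exists (Num.min e1 e2); first by rewrite lt_min e10.
  move=> x y _ xp py _; rewrite lt_min => /andP[xy1 xy2] cx yd.
  have E u : c <= u <= d -> `|u - p| < e1 -> `|u - p| < e2 ->
      h2 m u - h1 m u = P2 (Phi m p) - P1 (Phi m p).
    move=> ucd u1 u2; have m0 : `|m - m| < e1 by rewrite subrr normr0.
    have m0' : `|m - m| < e2 by rewrite subrr normr0.
    have [k1 ->] := hP1 m u am' ucd m0 u1; have [k2 ->] := hP2 m u mb' ucd m0' u2.
    apply: (primitive_on_eq (F := F) (r := Num.min r1 r2)).
    - by apply: primitive_on_le dP2; rewrite ge_min lexx orbT.
    - by apply: primitive_on_le dP1; rewrite ge_min lexx.
    - by rewrite lt_min k1.
  rewrite (E x); last 3 first.
  - by rewrite cx (le_trans xp)//; case/andP: pcd.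
  - by rewrite ler0_norm ?subr_le0//; lra.
  - by rewrite ler0_norm ?subr_le0//; lra.
  apply: E.
  - by rewrite yd andbT (le_trans cx)// (le_trans xp).
  - by rewrite ger0_norm ?subr_ge0//; lra.
  - by rewrite ger0_norm ?subr_ge0//; lra.
set k := h2 m c - h1 m c in cst.
exists (fun s t => if s <= m then h1 s t + k else h2 s t) => s t /andP[as_ sb] tcd.
have dk P z r : primitive_on F P z r -> primitive_on F (fun y => P y + k) z r.
  by move=> dP y yr; rewrite -[F y]addr0; apply: cderivD; [exact: dP|exact: cderiv_cst].
have [sm|ms|->] := ltgtP s m.
- have sam : a <= s <= m by rewrite as_ ltW.
  have [r [e [P [r0 e0 dP hP]]]] := H1 s t sam tcd.
  exists r, (Num.min e (m - s)), (fun y => P y + k); split => //.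
  + by rewrite lt_min e0 subr_gt0.
  + exact: dk.
  + move=> s' t' /andP[as' sb'] tcd'; rewrite !lt_min => /andP[se ss] /andP[te _].
    have s'm : s' <= m by move: (ler_norm (s' - s)) => ?; lra.
    have s'am : a <= s' <= m by rewrite as' s'm.
    by have [? ->] := hP s' t' s'am tcd' se te; rewrite s'm.
- have smb : m <= s <= b by rewrite sb ltW.
  have [r [e [P [r0 e0 dP hP]]]] := H2 s t smb tcd.
  exists r, (Num.min e (s - m)), P; split => //.
  + by rewrite lt_min e0 subr_gt0.
  + move=> s' t' /andP[as' sb'] tcd'; rewrite !lt_min => /andP[se ss] /andP[te _].
    have s'm : m < s' by move: (ler_norm (s - s')); rewrite distrC => ?; lra.
    have s'mb : m <= s' <= b by rewrite sb' ltW.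
    by have [? ->] := hP s' t' s'mb tcd' se te; rewrite leNgt s'm.
have [r1 [e1 [P1 [r10 e10 dP1 hP1]]]] := H1 m t am' tcd.
have [r2 [e2 [P2 [r20 e20 dP2 hP2]]]] := H2 m t mb' tcd.
have r12 : 0 < Num.min r1 r2 by rewrite lt_min r10.
have dP1' : primitive_on F P1 (Phi m t) (Num.min r1 r2).
  by apply: primitive_on_le dP1; rewrite ge_min lexx.
have dP2' : primitive_on F P2 (Phi m t) (Num.min r1 r2).
  by apply: primitive_on_le dP2; rewrite ge_min lexx orbT.
have [e3 e30 H3] := cPhi m t _ r12.
exists (Num.min r1 r2), (Num.min e3 (Num.min e1 e2)), (fun y => P1 y + k); split => //.
- by rewrite !lt_min e30 e10.
- exact: dk.
- move=> s' t' /andP[as' sb'] tcd'; rewrite !lt_min => /and3P[s3 s1 s2] /and3P[t3 t1 t2].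
  have near := H3 s' t' s3 t3; split; first by rewrite -lt_min.
  have [s'm|ms'] := leP s' m.
    have s'am : a <= s' <= m by rewrite as'.
    by have [_ ->] := hP1 s' t' s'am tcd' s1 t1.
  have s'mb : m <= s' <= b by rewrite sb' ltW.
  have [_ ->] := hP2 s' t' s'mb tcd' s2 t2.
  have := primitive_on_eq dP2' dP1' near.
  have m01 : `|m - m| < e1 by rewrite subrr normr0.
  have m02 : `|m - m| < e2 by rewrite subrr normr0.
  have tt1 : `|t - t| < e1 by rewrite subrr normr0.
  have tt2 : `|t - t| < e2 by rewrite subrr normr0.
  have [_ <-] := hP2 m t mb' tcd m02 tt2; have [_ <-] := hP1 m t am' tcd m01 tt1.
  by rewrite cst// => /eqP; rewrite subr_eq addrC => /eqP.
Qed.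

Lemma primitive_along_exists F Phi a b c d : a <= b -> c <= d -> continuous2 Phi ->
  (forall s t, a <= s <= b -> c <= t <= d ->
     exists2 r, 0 < r & exists P, primitive_on F P (Phi s t) r) ->
  exists h, primitive_along F Phi h a b c d.
Proof.
move=> ab cd cPhi loc.
pose Q a' b' c' d' : Prop := exists h, primitive_along F Phi h a' b' c' d'.
suff : Q a b c d by [].
apply: rect_induction => //.
  move=> x1 x2 y1 y2 x12 y12; set xm := (x1 + x2) / 2; set ym := (y1 + y2) / 2.
  have xm1 : x1 <= xm by rewrite /xm; lra. have xm2 : xm <= x2 by rewrite /xm; lra.
  have ym1 : y1 <= ym by rewrite /ym; lra. have ym2 : ym <= y2 by rewrite /ym; lra.
  move=> [h1 H1] [h2 H2] [h3 H3] [h4 H4].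
  have [h12 /primitive_along_swap H12] := primitive_along_glue cPhi xm1 xm2 ym1 H1 H2.
  have [h34 /primitive_along_swap H34] := primitive_along_glue cPhi xm1 xm2 ym2 H3 H4.
  have [h /primitive_along_swap H] :=
    primitive_along_glue (continuous2_swap cPhi) ym1 ym2 x12 H12 H34.
  by exists (fun s t => h t s).
move=> p q pab qcd; have [r r0 [P dP]] := loc p q pab qcd.
have [e e0 He] := cPhi p q r r0.
have w0 : 0 < (b - a) + (d - c) + 1 by lra.
exists (e / ((b - a) + (d - c) + 1)); first by rewrite divr_gt0.
move=> l x y l0; rewrite ltr_pdivlMr// => le ax xp px xb cy yq qy yd.
exists (fun s t => P (Phi s t)) => s t /andP[xs sx] /andP[yt ty].
have lba : 0 <= l * (b - a) by rewrite mulr_ge0 ?subr_ge0// ltW.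
have ldc : 0 <= l * (d - c) by rewrite mulr_ge0 ?subr_ge0// ltW.
have st : normc (Phi s t - Phi p q) < r.
  by apply: He; rewrite ltr_norml; apply/andP; split; clear -l0 le ax xp px xb cy yq qy yd xs sx yt ty lba ldc; lra.
have r'0 : 0 < r - normc (Phi s t - Phi p q) by rewrite subr_gt0.
have [e' e'0 He'] := cPhi s t _ r'0.
exists (r - normc (Phi s t - Phi p q)), e', P; split => //.
  move=> z zr; apply: dP; apply: le_lt_trans (normc_dist3 _ (Phi s t) _) _.
  by move: zr; lra.
by move=> s' t' _ _ s'e t'e; split => //; exact: He'.
Qed.

Lemma primitive_along_rderiv F Phi h a b c d s t (v : C) :
  primitive_along F Phi h a b c d -> a < s -> s < b -> c <= t <= d ->
  rderiv (fun s => Phi s t) s v -> rderiv (fun s => h s t) s (F (Phi s t) * v).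
Proof.
move=> H as_ sb tcd dPhi.
have sab : a <= s <= b by rewrite !ltW.
have [r [e [P [r0 e0 dP hP]]]] := H s t sab tcd.
have : rderiv (fun s => P (Phi s t)) s (F (Phi s t) * v).
  apply: (rderiv_comp (P := fun s => Phi s t)) dPhi; apply: dP.
  by rewrite subrr normc0.
apply: rderiv_near; apply/nearrP.
exists (Num.min e (Num.min (s - a) (b - s))); first by rewrite !lt_min e0 !subr_gt0 as_.
move=> u; rewrite !lt_min => /and3P[ue ua ub].
have uab : a <= u <= b.
  by move: ua ub; rewrite !ltr_norml; lra.
have tt : `|t - t| < e by rewrite subrr normr0.
by have [_ ->] := hP u t uab tcd ue tt.
Qed.

(** Homotopy invariance for closed loops: two primitives near the common point [Phi x t = Phi y t]
    differ by a constant, so the increment of [h] across the loop is locally constant in [t]. *)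
Lemma primitive_along_monodromy F Phi h a b c d x y :
  primitive_along F Phi h a b c d -> a <= x <= b -> a <= y <= b -> c <= d ->
  (forall t, Phi x t = Phi y t) -> h y d - h x d = h y c - h x c.
Proof.
move=> H xab yab cd Phixy.
pose Q u v : Prop := c <= u -> v <= d -> h y v - h x v = h y u - h x u.
suff : Q c d by apply.
apply: itv_induction => //.
  move=> u v w uv vw q1 q2 cu wd.
  by rewrite (q2 (le_trans cu uv) wd) (q1 cu (le_trans vw wd)).
move=> p pcd.
have [r1 [e1 [P1 [r10 e10 dP1 hP1]]]] := H x p xab pcd.
have [r2 [e2 [P2 [r20 e20 dP2 hP2]]]] := H y p yab pcd.
exists (Num.min e1 e2); first by rewrite lt_min e10.
move=> u v _ up pv _; rewrite lt_min => /andP[uv1 uv2] cu vd.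
have E w : c <= w <= d -> `|w - p| < e1 -> `|w - p| < e2 ->
    h y w - h x w = P2 (Phi x p) - P1 (Phi x p).
  move=> wcd w1 w2; have x0 : `|x - x| < e1 by rewrite subrr normr0.
  have y0 : `|y - y| < e2 by rewrite subrr normr0.
  have [k1 ->] := hP1 x w xab wcd x0 w1; have [k2 ->] := hP2 y w yab wcd y0 w2.
  rewrite -!Phixy in k2 dP2 *.
  apply: (primitive_on_eq (F := F) (r := Num.min r1 r2)).
  - by apply: primitive_on_le dP2; rewrite ge_min lexx orbT.
  - by apply: primitive_on_le dP1; rewrite ge_min lexx.
  - by rewrite lt_min k1.
rewrite (E u); last 3 first.
- by rewrite cu (le_trans up)//; case/andP: pcd.
- by rewrite ler0_norm ?subr_le0//; lra.
- by rewrite ler0_norm ?subr_le0//; lra.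
apply: E.
- by rewrite vd andbT (le_trans cu)// (le_trans up).
- by rewrite ger0_norm ?subr_ge0//; lra.
- by rewrite ger0_norm ?subr_ge0//; lra.
Qed.

(** Inside a disc carrying a primitive, [h] follows that primitive up to a constant; the increment
    is at most [M] times the diameter [2 r], whatever the length of the arc. *)
Lemma primitive_along_increment F Phi h a b c d x y t z0 (r M : R) P0 :
  continuous2 Phi -> primitive_along F Phi h a b c d -> a <= x -> x <= y -> y <= b -> c <= t <= d ->
  primitive_on F P0 z0 r -> (forall z, normc (z - z0) < r -> normc (F z) <= M) ->
  (forall s, x <= s <= y -> normc (Phi s t - z0) < r) ->
  normc (h y t - h x t) <= 2 * r * M.
Proof.
move=> cPhi H ax xy yb tcd dP0 FM Phir.
have -> : h y t - h x t = P0 (Phi y t) - P0 (Phi x t).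
  pose Q u v : Prop := x <= u -> v <= y ->
    h v t - h u t = P0 (Phi v t) - P0 (Phi u t).
  suff : Q x y by apply.
  apply: itv_induction => //.
    move=> u v w uv vw q1 q2 xu wy.
    rewrite -(subrKA (h v t)) (q2 (le_trans xu uv) wy) (q1 xu (le_trans vw wy)).
    by ring.
  move=> p /andP[xp py].
  have pab : a <= p <= b by rewrite (le_trans ax)// (le_trans py).
  have pxy : x <= p <= y by rewrite xp.
  have [r1 [e1 [P1 [r10 e10 dP1 hP1]]]] := H p t pab tcd.
  have r'0 : 0 < r - normc (Phi p t - z0) by rewrite subr_gt0 Phir.
  set r' := r - _ in r'0.
  have dP0' : primitive_on F P0 (Phi p t) (Num.min r1 r').
    move=> z; rewrite lt_min => /andP[_ zr]; apply: dP0.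
    by apply: le_lt_trans (normc_dist3 _ (Phi p t) _) _; move: zr; rewrite /r'; lra.
  have dP1' : primitive_on F P1 (Phi p t) (Num.min r1 r').
    by apply: primitive_on_le dP1; rewrite ge_min lexx.
  have rr0 : 0 < Num.min r1 r' by rewrite lt_min r10.
  have [e2 e20 H2] := cPhi p t _ rr0.
  exists (Num.min e1 e2); first by rewrite lt_min e10.
  move=> u v _ up pv _; rewrite lt_min => /andP[uv1 uv2] xu vy.
  have tt1 : `|t - t| < e1 by rewrite subrr normr0.
  have tt2 : `|t - t| < e2 by rewrite subrr normr0.
  have E w : a <= w <= b -> `|w - p| < e1 -> `|w - p| < e2 ->
      h w t - P0 (Phi w t) = P1 (Phi p t) - P0 (Phi p t).
    move=> wab w1 w2; have [_ ->] := hP1 w t wab tcd w1 tt1.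
    exact: (primitive_on_eq dP1' dP0' (H2 w t w2 tt2)).
  have Eu : h u t - P0 (Phi u t) = P1 (Phi p t) - P0 (Phi p t).
    apply: E; first by rewrite (le_trans ax)// (le_trans up)//; case/andP: pab.
    - by rewrite ler0_norm ?subr_le0//; lra.
    - by rewrite ler0_norm ?subr_le0//; lra.
  have Ev : h v t - P0 (Phi v t) = P1 (Phi p t) - P0 (Phi p t).
    apply: E; first by rewrite (le_trans vy)// andbT (le_trans ax)// (le_trans xu)// (le_trans up).
    - by rewrite ger0_norm ?subr_ge0//; lra.
    - by rewrite ger0_norm ?subr_ge0//; lra.
  rewrite -[h v t](subrK (P0 (Phi v t))) -[h u t](subrK (P0 (Phi u t))) Eu Ev.
  by ring.
have yr : normc (Phi y t - z0) < r by apply: Phir; rewrite xy lexx.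
have xr : normc (Phi x t - z0) < r by apply: Phir; rewrite xy lexx.
apply: le_trans (primitive_on_lip dP0 FM xr yr) _.
have M0 : 0 <= M := le_trans (normc_ge0 _) (FM _ xr).
rewrite mulrC; apply: ler_wpM2r => //.
by have := normc_dist3 (Phi y t) z0 (Phi x t); rewrite (normcBC z0); lra.
Qed.

End PrimitiveAlong.

Section HomotopyCauchy.
Context {R : realType}.
Local Notation C := R[i].

(* If the loops [Phi ^~ t] contract "at infinity", in the sense that at some
   time t they split into arcs contributing arbitrarily little, then the
   integral over the initial loop vanishes. *)
Lemma homotopy_cauchy (F : C -> C) (Phi : R -> R -> C) (v : R -> C) :
  continuous2 Phi -> (forall t, Phi 0 t = Phi 1 t) ->
  (forall s t, 0 <= t -> exists2 r, 0 < r & exists P, primitive_on F P (Phi s t) r) ->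
  (forall s, rderiv (Phi ^~ 0) s (v s)) ->
  continuous (fun s => F (Phi s 0) * v s) ->
  (forall e, 0 < e -> exists (t : R) (n : nat), 0 <= t /\
     forall j : nat, (j <= n)%N -> exists z0 r M P,
      [/\ primitive_on F P z0 r, forall z, normc (z - z0) < r -> normc (F z) <= M,
         forall s, j%:R / n.+1%:R <= s <= j.+1%:R / n.+1%:R -> normc (Phi s t - z0) < r &
         2 * r * M * n.+1%:R <= e]) ->
  Int (fun s => F (Phi s 0) * v s) 0 1 = 0.
Proof.
move=> cPhi Phi01 loc dPhi cF small.
apply/eqP; rewrite -normc_eq0; apply/eqP/le_anti; rewrite normc_ge0 andbT.
apply/ler_addgt0Pr => e e0; rewrite add0r.
have [t [n [t0 arcs]]] := small e e0.
(* The range is widened to [[-1, 2]] so that every [s] in [[0, 1]] is interior, as differentiating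
   [h] in [s] requires. *)
have [h H] : exists h, primitive_along F Phi h (-1) 2 0 t.
  apply: primitive_along_exists => //; first by lra.
  by move=> s u _ /andP[u0 _]; exact: loc.
have t00 : 0 <= (0 : R) <= t by rewrite lexx.
have t0t : 0 <= t <= t by rewrite t0 lexx.
have b0 : -1 <= (0 : R) <= 2 by lra.
have b1 : -1 <= (1 : R) <= 2 by lra.
have -> : Int (fun s => F (Phi s 0) * v s) 0 1 = h 1 0 - h 0 0.
  apply: (Int_primitive_le (P := h ^~ 0) ler01 cF) => s /andP[s0 s1].
  by apply: (primitive_along_rderiv H _ _ t00 (dPhi s)); lra.
rewrite -(primitive_along_monodromy H b0 b1 t0 Phi01).
pose u (j : nat) := h (j%:R / n.+1%:R) t.
have -> : h 1 t - h 0 t = \sum_(0 <= j < n.+1) (u j.+1 - u j).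
  by rewrite telescope_sumr// /u mul0r divff ?pnatr_eq0.
apply: le_trans (normc_sum _ _ _) _.
have n0 : (0 : R) < n.+1%:R by rewrite ltr0n.
apply: le_trans (_ : \sum_(0 <= j < n.+1) (e / n.+1%:R) <= _); last first.
  by rewrite sumr_const_nat subn0 -[leLHS]mulr_natr divfK ?gt_eqF.
apply: ler_sum_nat => j /andP[_ jn].
have [z0 [r [M [P [dP FM arc le]]]]] := arcs j jn.
apply: le_trans (_ : 2 * r * M <= _); last by rewrite ler_pdivlMr.
have j0 : (0 : R) <= j%:R / n.+1%:R by rewrite divr_ge0.
have jj : j%:R / n.+1%:R <= j.+1%:R / n.+1%:R :> R.
  by rewrite ler_pM2r ?invr_gt0// ler_nat.
have j1 : j.+1%:R / n.+1%:R <= 1 :> R by rewrite ler_pdivrMr// mul1r ler_nat.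
apply: (primitive_along_increment cPhi H _ jj _ t0t dP FM arc).
  by apply: le_trans j0; lra.
by apply: (le_trans j1); lra.
Qed.

End HomotopyCauchy.

(** * The exterior domain on the sphere, the exterior map and its inverse *)

Section SphereTopology.
Context {R : realType}.
Local Notation C := R[i].
Implicit Types (G : set C) (phi : C -> C) (z w : C).

Lemma normc_continuous : continuous (fun z : C => normc z).
Proof.
move=> z; apply/(cvgrPdist_lt (FF := nbhs_filter z)) => e e0; apply/nearcP; exists e => // y.
apply: le_lt_trans; rewrite ler_norml normcBC normcB_ge andbT.
by rewrite lerNl opprB normcBC normcB_ge.
Qed.

Lemma compact_normc_bound (K : set C) : compact K ->
  exists M : R, forall z, K z -> normc z <= M.
Proof.
move=> cK; have : compact [set normc z | z in K].
  by apply: continuous_compact cK; apply: continuous_subspaceT; exact: normc_continuous.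
move=> /compact_bounded/pinfty_ex_gt0[M M0 HM]; exists M => z Kz.
by apply: le_trans (ler_norm _) _; apply: HM; exists z.
Qed.

Lemma closed_normc_compact (K : set C) (M : R) : closed K ->
  (forall z, K z -> normc z <= M) -> compact K.
Proof.
move=> clK KM.
pose f (p : R * R) : C := p.1 +i* p.2.
have cf : continuous f.
  move=> p; have -> : f = fun p => (p.1)%:C + 'i%C * (p.2)%:C.
    by apply/funext => q; rewrite /f complexXY.
  apply: cvgD; first by apply: cvg_RC; exact: cvg_fst.
  by apply: cvgM; [exact: cvg_cst|apply: cvg_RC; exact: cvg_snd].
have cB : compact [set f p | p in `[- M, M] `*` `[- M, M]].
  apply: continuous_compact; first exact: continuous_subspaceT.
  by apply: compact_setX; exact: segment_compact.
apply: (subclosed_compact clK cB) => z Kz; exists (Re z, Im z).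
  have := KM _ Kz => zM; split; rewrite /= in_itv /= -ler_norml.
    exact: le_trans (normc_Re z) zM.
  exact: le_trans (normc_Im z) zM.
by apply: complex_eq.
Qed.

Lemma nbhs_noneP (U : set (riemann_sphere R)) : nbhs (None : riemann_sphere R) U ->
  exists M : R, forall z, M < normc z -> U (Some z).
Proof.
move=> [K [cK clK] KU]; have [M HM] := compact_normc_bound cK.
exists M => z Mz; apply: KU; left; exists z => // Kz.
by move: (HM z Kz); rewrite leNgt Mz.
Qed.

Lemma nbhs_none_outside (M : R) :
  nbhs (None : riemann_sphere R) [set x | if x is Some z then M < normc z else True].
Proof.
have clK : closed [set z : C | normc z <= M].
  have := preimage_closed (f := fun z : C => normc z) (D := [set x | x <= M]).
  by apply; [move=> z _; exact: normc_continuous|exact: closed_le].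
exists [set z | normc z <= M]; last first.
  by case=> [z|] // [[y yM [<-]]|//] /=; rewrite ltNge; apply/negP; exact: yM.
split => //; by apply: (closed_normc_compact (M := M) clK) => z.
Qed.

Lemma nbhs_someP z (U : set (riemann_sphere R)) : nbhs (Some z : riemann_sphere R) U <->
  exists2 d : R, 0 < d & forall y, normc (y - z) < d -> U (Some y).
Proof. exact: (nearcP z (fun y => U (Some y))). Qed.

Lemma continuous_some_path (ga : R -> C) (A : set R) : continuous ga ->
  {within A, continuous (fun t => Some (ga t) : riemann_sphere R)}.
Proof.
move=> cga; apply: continuous_subspaceT => t.
by apply: (cvg_comp _ _ (cga t)) => U /=.
Qed.

Lemma exterior_domain_connected G (B : set (riemann_sphere R)) x y :
  connected B -> B `<=` ~` on_sphere G -> B x -> B y ->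
  exterior_domain G x -> exterior_domain G y.
Proof.
move=> cB BG Bx By Gx; apply: connected_component_trans Gx _.
by have := connected_component_max Bx BG cB => /(_ y By).
Qed.

Lemma exterior_domain_path G (ga : R -> C) : continuous ga ->
  (forall t, 0 <= t <= 1 -> ~ G (ga t)) ->
  exterior_domain G (Some (ga 0)) -> exterior_domain G (Some (ga 1)).
Proof.
move=> cga gaG.
apply: (@exterior_domain_connected G [set (Some (ga t) : riemann_sphere R) | t in `[0, 1]]).
- apply: connected_continuous_connected; first exact: segment_connected.
  exact: continuous_some_path.
- move=> _ [t t01 <-] [z Gz [zE]]; apply: (gaG t); last by rewrite -zE.
  by move: t01; rewrite /= in_itv.
- by exists 0 => //; rewrite /= in_itv /= lexx ler01.
- by exists 1 => //; rewrite /= in_itv /= lexx ler01.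
Qed.

(** The ray from [z] to infinity keeps modulus at least [|z|], so its closure avoids [G]; that
    closure is connected and contains the point at infinity. *)
Lemma exterior_domain_large G (M : R) : 0 <= M -> (forall z, G z -> normc z <= M) ->
  forall z, M < normc z -> exterior_domain G (Some z).
Proof.
move=> M0 GM z Mz.
have z0 : 0 < normc z := le_lt_trans M0 Mz.
pose A : set (riemann_sphere R) := [set Some ((1 + `|t|)%:C * z) | t in [set: R]].
have cA : connected A.
  apply: connected_continuous_connected.
    have -> : [set: R] = [set` `]-oo, +oo[] by rewrite set_itvNyy.
    by apply/connected_intervalP; exact: interval_is_interval.
  apply: continuous_some_path => t.
  apply: cvgM; last exact: cvg_cst.
  apply: cvg_RC; apply: cvgD; first exact: cvg_cst.
  exact: norm_continuous.
have normA (t : R) : normc z <= normc ((1 + `|t|)%:C * z).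
  rewrite normcM normcR ger0_norm ?addr_ge0//.
  by apply: ler_peMl; [exact: ltW|rewrite lerDl].
have clA : closure A `<=` ~` on_sphere G.
  move=> x clx [y Gy yx]; rewrite -yx in clx.
  have /GM yM := Gy.
  have d0 : 0 < normc z - normc y by rewrite subr_gt0 (le_lt_trans yM).
  have : nbhs (Some y : riemann_sphere R) [set Some u | u in [set u | normc (u - y) < normc z - normc y]].
    by apply/nbhs_someP; exists (normc z - normc y) => // u uy; exists u.
  move=> /clx [_ [[t _ <-] [u /= uy [uE]]]].
  have := normcB_ge u y; have := normA t; rewrite -uE; lra.
apply: (exterior_domain_connected (connected_closure cA) clA (x := None)).
- move=> U /nbhs_noneP[N HN].
  have [t Nt] : exists t : R, N < (1 + `|t|) * normc z.
    exists (`|N| / normc z).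
    have -> : `| `|N| / normc z| = `|N| / normc z by apply: ger0_norm; rewrite divr_ge0// ltW.
    by rewrite mulrDl divfK ?gt_eqF// mul1r; have := ler_norm N; lra.
  exists (Some ((1 + `|t|)%:C * z)); split; first by exists t.
  by apply: HN; rewrite normcM normcR ger0_norm ?addr_ge0.
- by apply: subset_closure; exists 0 => //; rewrite normr0 addr0 mul1r.
- by apply: connected_component_refl => -[].
Qed.

Lemma exterior_domain_open G z : closed G -> exterior_domain G (Some z) ->
  exists2 r : R, 0 < r & forall y, normc (y - z) < r -> exterior_domain G (Some y).
Proof.
move=> clG Dz.
have nGz : ~ G z by move=> Gz; have := connected_component_sub Dz; apply; exists z.
have /nearcP[r r0 Hr] : nbhs z (~` G) by apply: open_nbhs_nbhs; split => //; exact: closed_openC.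
exists r => // y yz.
pose ga (t : R) : C := z + t%:C * (y - z).
have <- : ga 1 = y by rewrite /ga mul1r addrC subrK.
apply: exterior_domain_path.
- move=> t; apply: (rderiv_cont (l := y - z)).
  rewrite -[X in rderiv _ _ X]add0r; apply: rderivD; first exact: rderiv_cst.
  exact: rderiv_linear.
- move=> t t01; apply: Hr; rewrite /ga; apply: ball_segment => //.
  by rewrite subrr normc0.
- by rewrite /ga mul0r addr0.
Qed.

Lemma cinfty_filter : Filter (@cinfty R).
Proof.
apply: filter_from_filter; first by exists 0.
by move=> M N _ _; exists (Num.max M N) => // z; rewrite /= gt_max => /andP[].
Qed.

Lemma cvg_cinftyP phi (l : C) : phi @ (@cinfty R) --> l <->
  forall e : R, 0 < e -> exists M : R, forall z, M < normc z -> normc (phi z - l) < e.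
Proof.
split=> [/(cvgcP (FF := cinfty_filter)) h e /h[M _ HM]|h]; first by exists M.
by apply/(cvgcP (FF := cinfty_filter)) => e /h[M HM]; exists M.
Qed.

Definition exterior G : set C := [set z | exterior_domain G (Some z)].

(** The homeomorphism and its inverse [psi] read on finite points, so that later arguments take
    place in the plane; [psi_infty] is what continuity of the inverse at infinity becomes. *)
Record exterior_pair G phi (psi : C -> C) : Prop := ExteriorPair {
  phi_D : forall z, exterior G z -> 1 < normc (phi z);
  phi_G : forall z, G z -> normc (phi z) = 1;
  psi_D : forall w, 1 < normc w -> exterior G (psi w);
  psi_G : forall w, normc w = 1 -> G (psi w);
  phiK : forall z, (exterior G `|` G) z -> psi (phi z) = z;
  psiK : forall w, 1 <= normc w -> phi (psi w) = w;
  phi_cont : forall z, (exterior G `|` G) z -> phi @ within (exterior G `|` G) (nbhs z) --> phi z;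
  psi_cont : forall w, 1 <= normc w ->
    psi @ within [set v | 1 <= normc v] (nbhs w) --> psi w;
  psi_infty : forall M : R, exists N : R, forall w, 1 <= normc w -> N < normc w -> M < normc (psi w)
}.

Lemma canonical_exterior_pair G phi : canonical_exterior_map G phi ->
  exists psi, exterior_pair G phi psi.
Proof.
move=> [bij _ _ [bij2 cphi [g [cg gK]]]].
pose Dm := exterior G.
pose psi w : C := if g (Some w) is Some z then z else 0.
have [f1 i1 s1] := bij; have [f2 i2 s2] := bij2.
have DG z : Dm z -> G z -> False.
  by move=> Dz Gz; have := connected_component_sub Dz; apply; exists z.
have inA z : Dm z \/ G z -> (exterior_domain G `|` on_sphere G) (Some z).
  by case=> [Dz|Gz]; [left|right; exists z].
have Ain z : (exterior_domain G `|` on_sphere G) (Some z) -> Dm z \/ G z.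
  by case=> [Dz|[y Gy [<-]]]; [left|right].
have phiK' z : Dm z \/ G z -> psi (phi z) = z.
  by move=> /inA Az; rewrite /psi; have /= -> := gK (Some z) Az.
have phiD z : Dm z -> 1 < normc (phi z) by move=> Dz; exact: (f1 (Some z) Dz).
(* Otherwise the value [phi z] is also attained in the domain, and injectivity on the closed domain
   would make [z] a point of the domain. *)
have phiG z : G z -> normc (phi z) = 1.
  move=> Gz; have /= := f2 (Some z) (inA z (or_intror Gz)).
  rewrite le_eqVlt => /orP[/eqP//|phi1].
  have [x Dx xE] := s1 (Some (phi z)) phi1.
  case: x Dx xE => [y|] Dy //= [yE].
  have yz : y = z by rewrite -(phiK' y (or_introl Dy)) yE phiK'//; right.
  by case: (DG z _ Gz); rewrite -yz.
have psi_spec w : 1 <= normc w -> exists z, [/\ Dm z \/ G z, phi z = w & psi w = z].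
  move=> w1; have [x Ax xE] := s2 (Some w) w1.
  case: x Ax xE => [z|] Az //= [zE]; exists z; split => //; first exact: Ain.
  by rewrite -zE phiK'//; exact: Ain.
exists psi; split => //.
- move=> w w1; have [z [Az zw ->]] := psi_spec w (ltW w1).
  by case: Az => // /phiG; rewrite zw => w1'; rewrite w1' ltxx in w1.
- move=> w w1; have [|z [Az zw ->]] := psi_spec w; first by rewrite w1.
  by case: Az => // /phiD; rewrite zw w1 ltxx.
- by move=> w w1; have [z [Az zw ->]] := psi_spec w w1.
- move=> z Az; apply/ccontP => e e0.
  have /(_ (Some z) (inA z Az)) := (subspace_continuousP _ _).1 cphi.
  have U : nbhs (Some (phi z) : riemann_sphere R)
      [set Some u | u in [set u | normc (u - phi z) < e]].
    by apply/nbhs_someP; exists e => // u ue; exists u.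
  move=> /(_ _ U) /nbhs_someP[d d0 Hd]; exists d => // t At tz.
  by have [u ue [<-]] := Hd t tz (inA t At).
- move=> w w1; apply/ccontP => e e0.
  have /(_ (Some w) w1) := (subspace_continuousP _ _).1 cg.
  have [z [Az zw psiz]] := psi_spec w w1.
  have gw : g (Some w) = Some z by rewrite -zw; exact: (gK (Some z) (inA z Az)).
  have U : nbhs (Some z : riemann_sphere R) [set Some u | u in [set u | normc (u - z) < e]].
    by apply/nbhs_someP; exists e => // u ue; exists u.
  rewrite -[X in _ --> X]/(g (Some w)) gw => /(_ _ U) /nbhs_someP[d d0 Hd]; exists d => // t t1 tz.
  have [u ue uE] := Hd t tz t1; rewrite psiz /psi.
  by have <- : Some u = g (Some t) by exact: uE.
- move=> M; have /(_ None I) := (subspace_continuousP _ _).1 cg.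
  have gN : g None = None.
    by apply: (gK None); left; apply: connected_component_refl => -[].
  rewrite -[X in _ --> X]/(g None) gN => /(_ _ (nbhs_none_outside M)) /nbhs_noneP[N HN]; exists N => w w1 Nw; have := HN w Nw w1.
  have [z [Az zw psiz]] := psi_spec w w1.
  have gw : g (Some w) = Some z by rewrite -zw; exact: (gK (Some z) (inA z Az)).
  have E : from_subspace closed_exterior_disk g (Some w) = Some z by exact: gw.
  by rewrite /preimage /mkset E psiz.
Qed.

End SphereTopology.

Section Uniqueness.
Context {R : realType}.

Lemma rderiv_unique (P : R -> R[i]) s l m : rderiv P s l -> rderiv P s m -> l = m.
Proof.
move=> h k; apply/eqP; rewrite -subr_eq0 -normc_eq0; apply/eqP/le_anti.
rewrite normc_ge0 andbT; apply/ler_addgt0Pr => e e0; rewrite add0r.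
have e2 : 0 < e / 2 by rewrite divr_gt0.
have [d1 d10 H1] := h _ e2; have [d2 d20 H2] := k _ e2.
pose t := Num.min d1 d2 / 2.
have t0 : 0 < t by rewrite divr_gt0// lt_min d10.
have tn : `|t| = t by rewrite gtr0_norm.
have t1 : `|t| < d1.
  by rewrite tn /t; have : Num.min d1 d2 <= d1 by [rewrite ge_min lexx]; move: t0; rewrite /t; lra.
have t2 : `|t| < d2.
  by rewrite tn /t; have : Num.min d1 d2 <= d2 by [rewrite ge_min lexx orbT]; move: t0; rewrite /t; lra.
have := H1 _ t1; have := H2 _ t2; rewrite tn => k2 k1.
rewrite -(ler_pM2l t0) -{1}tn -normcR -normcM.
rewrite (_ : t%:C * _ = (P (s + t) - P s - t%:C * m) - (P (s + t) - P s - t%:C * l)); last by ring.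
by apply: le_trans (normcB _ _) _; lra.
Qed.

End Uniqueness.

(** * Uniform estimates for periodic functions and for the curve *)

Section Uniformity.
Context {R : realType}.

(** Local constants [e] that may be decreased combine into one for the whole segment, since two
    adjacent pieces share the smaller one. *)
Lemma itv_uniform (P : R -> R -> Prop) (a b : R) : a <= b ->
  (forall e e' s, e' <= e -> P e s -> P e' s) ->
  (forall p, a <= p <= b -> exists2 e, 0 < e & exists2 d, 0 < d &
     forall s, `|s - p| < d -> a <= s <= b -> P e s) ->
  exists2 e, 0 < e & forall s, a <= s <= b -> P e s.
Proof.
move=> ab mono loc.
pose Q x y : Prop := a <= x -> y <= b ->
  exists2 e, 0 < e & forall s, x <= s <= y -> P e s.
suff : Q a b by apply.
apply: itv_induction => //.
  move=> x y z xy yz q1 q2 ax zb.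
  have [e1 e10 H1] := q1 ax (le_trans yz zb).
  have [e2 e20 H2] := q2 (le_trans ax xy) zb.
  exists (Num.min e1 e2); first by rewrite lt_min e10.
  move=> s /andP[xs sz]; have [sy|ys] := leP s y.
    by apply: (mono e1); [rewrite ge_min lexx|apply: H1; rewrite xs].
  by apply: (mono e2); [rewrite ge_min lexx orbT|apply: H2; rewrite sz ltW].
move=> p pab; have [e e0 [d d0 H]] := loc p pab.
exists d => // x y _ xp py _ yxd ax yb; exists e => // s /andP[xs sy].
by apply: H; [rewrite ltr_norml; lra|rewrite (le_trans ax)// (le_trans sy)].
Qed.

Lemma rect_uniform (P : R -> R -> R -> Prop) (a b c d : R) : a <= b -> c <= d ->
  (forall e e' s t, e' <= e -> P e s t -> P e' s t) ->
  (forall p q, a <= p <= b -> c <= q <= d -> exists2 e, 0 < e & exists2 r, 0 < r &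
     forall s t, `|s - p| < r -> `|t - q| < r -> P e s t) ->
  exists2 e, 0 < e & forall s t, a <= s <= b -> c <= t <= d -> P e s t.
Proof.
move=> ab cd mono loc.
suff [e e0 He] : exists2 e, 0 < e & forall s, a <= s <= b -> forall t, c <= t <= d -> P e s t.
  by exists e => // s t sab tcd; exact: He.
apply: itv_uniform => //; first by move=> e e' s le H t tcd; exact: mono le (H t tcd).
move=> p pab.
have [e e0 He] : exists2 e, 0 < e & forall t, c <= t <= d ->
    forall s, `|s - p| < e -> P e s t.
  apply: itv_uniform => //.
    move=> e e' s le H t tp; apply: mono (le) (H t _); exact: lt_le_trans le.
  move=> q qcd; have [e e0 [r r0 H]] := loc p q pab qcd.
  exists (Num.min e r); first by rewrite lt_min e0.
  exists r => // t tq _ s; rewrite lt_min => /andP[_ sp].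
  by apply: mono (H s t sp tq); rewrite ge_min lexx.
by exists e => //; exists e => // s sp _ t tcd; exact: He.
Qed.

End Uniformity.

Section Periodic.
Context {R : realType}.
Local Notation C := R[i].
Implicit Types f : R -> C.

Lemma periodic_int (T : Type) (f : R -> T) (m : int) s : (forall s, f (s + 1) = f s) -> f (s + m%:~R) = f s.
Proof.
move=> fp; have pn (n : nat) t : f (t + n%:R) = f t.
  by elim: n => [|n ih]; rewrite ?addr0// -addn1 natrD addrA fp.
case: m => n; first exact: pn.
by rewrite NegzE -[s in RHS](subrK n.+1%:R) pn mulrNz.
Qed.

Lemma period_reduce (s : R) : exists m : int, 0 <= s - m%:~R < 1.
Proof.
exists (Num.floor s).
by rewrite subr_ge0 floor_le ltrBlDl; have := floorD1_gt s; rewrite intrD.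
Qed.

Lemma periodic_uniform_continuity f : continuous f -> (forall s, f (s + 1) = f s) ->
  forall e, 0 < e -> exists2 d, 0 < d &
    forall s s', `|s' - s| < d -> normc (f s' - f s) <= e.
Proof.
move=> cf fp e e0.
have [d d0 Hd] : exists2 d, 0 < d & forall s, 0 <= s <= 1 ->
    forall s', `|s' - s| < d -> normc (f s' - f s) <= e.
  apply: itv_uniform; first exact: ler01.
    by move=> d d' s le H s' ss'; apply: H; exact: lt_le_trans le.
  move=> p _; have e2 : 0 < e / 2 by rewrite divr_gt0.
  have /rcontP/(_ _ e2)[d d0 Hd] := cf p.
  have d2 : 0 < d / 2 by rewrite divr_gt0.
  exists (d / 2) => //; exists (d / 2) => // s sp _ s' s's.
  have h1 := Hd s; have h2 := Hd s'.
  have : normc (f s - f p) < e / 2 by apply: h1; lra.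
  have : normc (f s' - f p) < e / 2.
    by apply: h2; have := ler_distD s s' p; lra.
  by have := normc_dist3 (f s') (f p) (f s); rewrite (normcBC (f p)); lra.
exists d => // s s' ss'; have [m /andP[m0 m1]] := period_reduce s.
have := Hd (s - m%:~R); rewrite m0 ltW// => /(_ isT (s' - m%:~R)).
rewrite opprB addrA subrK => /(_ ss').
have E u : f (u - m%:~R) = f u by rewrite -mulrNz periodic_int.
by rewrite !E.
Qed.

Lemma periodic_bounded f : continuous f -> (forall s, f (s + 1) = f s) ->
  exists2 M : R, 0 < M & forall s, normc (f s) <= M.
Proof.
move=> cf fp.
have [e e0 He] : exists2 e, 0 < e & forall s, 0 <= s <= 1 -> e * normc (f s) <= 1.
  apply: itv_uniform; first exact: ler01.
    by move=> e e' s le; apply: le_trans; rewrite ler_wpM2r ?normc_ge0.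
  move=> p _; have /rcontP/(_ _ ltr01)[d d0 Hd] := cf p.
  have m0 : 0 < normc (f p) + 1 by rewrite ltr_wpDl ?normc_ge0.
  exists (normc (f p) + 1)^-1; first by rewrite invr_gt0.
  exists d => // s /Hd sp _; rewrite ler_pdivrMl// mulr1.
  by have := normcB_ge (f s) (f p); lra.
exists e^-1; first by rewrite invr_gt0.
move=> s; have [m /andP[m0 m1]] := period_reduce s.
have -> : f s = f (s - m%:~R) by rewrite -mulrNz periodic_int.
by rewrite -[leRHS]mulr1 ler_pdivlMl//; apply: He; rewrite m0 ltW.
Qed.

Lemma periodic_bounded_below f : continuous f -> (forall s, f (s + 1) = f s) ->
  (forall s, f s != 0) -> exists2 m : R, 0 < m & forall s, m <= normc (f s).
Proof.
move=> cf fp f0.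
have [||M M0 HM] := @periodic_bounded (fun s => (f s)^-1).
- by move=> s; apply: cvgV; [exact: f0|exact: cf].
- by move=> s; rewrite fp.
exists M^-1; first by rewrite invr_gt0.
by move=> s; rewrite -[normc (f s)]invrK lef_pV2 ?posrE ?invr_gt0 ?normc_gt0// -normcV.
Qed.

End Periodic.

Record smooth_loop (R : realType) (g g' : R -> R[i]) : Prop := SmoothLoop {
  loop_periodic : forall s, g (s + 1) = g s;
  loop_injective : {in `[0, 1[ &, injective g};
  loop_rderiv : forall s, rderiv g s (g' s);
  loop_cont : continuous g';
  loop_neq0 : forall s, g' s != 0
}.

Section Curve.
Context {R : realType}.
Local Notation C := R[i].
Variables g g' : R -> C.
Hypothesis L : smooth_loop g g'.

Let gp := loop_periodic L.
Let ginj := loop_injective L.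
Let dg := loop_rderiv L.
Let cg' := loop_cont L.
Let g'0 := loop_neq0 L.

Lemma curve_deriv_periodic s : g' (s + 1) = g' s.
Proof.
apply: (@rderiv_unique _ g s); last exact: dg.
have -> : g = (fun t => g (1 * t + 1)) by apply/funext => t; rewrite mul1r gp.
have := @rderiv_affine R g 1 1 s (g' (s + 1)); rewrite !mul1r; apply.
exact: dg.
Qed.

Lemma curve_continuous : continuous g.
Proof. by move=> s; exact: rderiv_cont (dg s). Qed.

Lemma curve_inj s t : 0 < `|t| < 1 -> g (s + t) != g s.
Proof.
move=> /andP[t0 t1]; apply/eqP => gst.
have [m /andP[m0 m1]] := period_reduce s.
have [n /andP[n0 n1]] := period_reduce (s + t).
have E u k : g (u - k%:~R) = g u by rewrite -mulrNz periodic_int.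
have /ginj : g (s + t - n%:~R) = g (s - m%:~R) by rewrite !E.
rewrite !in_itv /= m0 m1 n0 n1 => /(_ isT isT) /eqP.
move=> /eqP st; have tE : t = (n - m)%:~R by rewrite intrB; lra.
move: t0 t1; rewrite tE -intr_norm ltr0z -[1]/(1%:~R) ltr_int gtz0_ge1.
by move=> h1 h2; have := le_lt_trans h1 h2; rewrite ltxx.
Qed.

Local Notation omega := (modulus_of_continuity g').

Lemma modulus_has_ubound (t : R) :
  has_ubound [set normc (g' s.1 - g' s.2) | s in [set s : R * R | `|s.1 - s.2| <= t]].
Proof.
have [M M0 HM] := periodic_bounded cg' curve_deriv_periodic.
exists (M + M) => _ [[s1 s2] _ <-] /=.
by apply: le_trans (normcB _ _) _; apply: lerD.
Qed.

Lemma modulus_ge (t s1 s2 : R) : `|s1 - s2| <= t -> normc (g' s1 - g' s2) <= omega t.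
Proof.
move=> st; apply: ub_le_sup; first exact: modulus_has_ubound.
by exists (s1, s2).
Qed.

Lemma modulus_ge0 (t : R) : 0 <= t -> 0 <= omega t.
Proof. by move=> t0; apply: le_trans (@modulus_ge t 0 0 _); rewrite ?normc_ge0// subrr normr0. Qed.

Lemma modulus_mono (t u : R) : 0 <= t -> t <= u -> omega t <= omega u.
Proof.
move=> t0 tu; apply: sup_le; last by split; [exists 0, (0, 0) => //=; rewrite ?subrr ?normc0 ?normr0 ?(le_trans t0)|exact: modulus_has_ubound].
- move=> _ [[s1 s2] /= st <-]; exists (normc (g' s1 - g' s2)); split => //.
  by exists (s1, s2) => //=; exact: le_trans tu.
- by exists 0, (0, 0) => //=; rewrite ?subrr ?normc0 ?normr0.
Qed.

(** Mean value inequality for [g (s + u) - u g'(s)], whose derivative is at most [omega |t|] for [u]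
    between 0 and [t]. *)
Lemma curve_taylor s t : normc (g (s + t) - g s - t%:C * g' s) <= omega `|t| * `|t|.
Proof.
pose P u := g (1 * u + s) - u%:C * g' s.
have dP u : rderiv P u (g' (u + s) - g' s).
  apply: rderivB; last exact: rderiv_linear.
  rewrite -{2}[u]mul1r -[g' _]mul1r; apply: (@rderiv_affine R g 1 s); exact: dg.
have -> : g (s + t) - g s - t%:C * g' s = P t - P 0.
  by rewrite /P mul1r mulr0 add0r mul0r subr0 [t + s]addrC; ring.
have [t0|/ltW t0] := leP 0 t.
  rewrite ger0_norm// -{3}[t]subr0; apply: (mvt_bound t0 (fun u _ => dP u)) => u /andP[u0 ut].
  by apply: modulus_ge; rewrite addrK ger0_norm.
rewrite ler0_norm// normcBC -{2}[- t]add0r.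
apply: (mvt_bound t0 (fun u _ => dP u)) => u /andP[ut u0].
by apply: modulus_ge; rewrite addrK ler0_norm// lerN2.
Qed.

(** By periodicity [|t| <= 1/2] covers all pairs of curve points; injectivity and compactness keep
    those with [|t| >= d] apart. Negative [t] is the positive case read from the other point. *)
Lemma curve_separation (d : R) : 0 < d -> d <= 2^-1 ->
  exists2 m, 0 < m & forall s t, d <= `|t| <= 2^-1 -> m <= normc (g (s + t) - g s).
Proof.
move=> d0 d2.
have [m m0 Hm] : exists2 m, 0 < m & forall s t, 0 <= s <= 1 -> d <= t <= 2^-1 ->
    m <= normc (g (s + t) - g s).
  apply: rect_uniform => //.
    by move=> e e' s t le; exact: le_trans.
  move=> p q _ /andP[dq q2].
  have qn : 0 < `|q| < 1 by rewrite gtr0_norm; lra.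
  have := curve_inj p qn; rewrite -subr_eq0 -normc_gt0; set n := normc _ => n0.
  have n4 : 0 < n / 4 by rewrite divr_gt0.
  have cg : continuous g := curve_continuous.
  have /rcontP/(_ _ n4)[r1 r10 H1] := cg (p + q).
  have /rcontP/(_ _ n4)[r2 r20 H2] := cg p.
  exists (n / 2); first by rewrite divr_gt0.
  exists (Num.min r2 (r1 / 2)); first by rewrite lt_min r20 divr_gt0.
  have rr : Num.min r2 (r1 / 2) <= r1 / 2 by rewrite ge_min lexx orbT.
  move=> s t; rewrite lt_min => /andP[/H2 k2 s1] tq.
  have : normc (g (s + t) - g (p + q)) < n / 4.
    apply: H1; rewrite (_ : _ - _ = (s - p) + (t - q)); last by ring.
    by apply: le_lt_trans (ler_normD _ _) _; lra.
  have := normc_dist3 (g (p + q)) (g (s + t)) (g p).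
  have := normc_dist3 (g (s + t)) (g s) (g p).
  by rewrite -/n (normcBC (g (p + q)) (g (s + t))) => h1 h2 h3; lra.
have Hm' s t : d <= t <= 2^-1 -> m <= normc (g (s + t) - g s).
  move=> td; have [k /andP[k0 k1]] := period_reduce s.
  have E u : g (u - k%:~R) = g u by rewrite -mulrNz periodic_int.
  have := Hm (s - k%:~R) t; rewrite k0 ltW// => /(_ isT td).
  by rewrite addrAC !E.
exists m => // s t; have [t0|t0] := leP 0 t; first by rewrite ger0_norm//; exact: Hm'.
rewrite ltr0_norm// => td; have := Hm' (s + t) (- t) td.
by rewrite addrK normcBC.
Qed.

(* The normal direction is only prescribed up to an error eta, so that a C^1
   field of approximate normals can be used to push the curve off itself. *)
Lemma curve_tubular : exists c e0 eta : R, [/\ 0 < c, 0 < e0, 0 < eta &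
  forall s t e nu, `|t| <= 2^-1 -> `|e| <= e0 -> normc (nu - 'i%C * g' s) <= eta ->
    c * (`|t| + `|e|) <= normc (g (s + t) - g s - e%:C * nu)].
Proof.
have [m m0 Hm] := periodic_bounded_below cg' curve_deriv_periodic g'0.
have [M M0 HM] := periodic_bounded cg' curve_deriv_periodic.
have m8 : 0 < m / 8 by rewrite divr_gt0.
have [d d0 Hd] := periodic_uniform_continuity cg' curve_deriv_periodic m8.
have d'0 : 0 < Num.min (d / 2) 2^-1 by rewrite lt_min divr_gt0//= invr_gt0.
set d' := Num.min _ _ in d'0.
have d'2 : d' <= 2^-1 by rewrite ge_min lexx orbT.
have d'd : d' <= d / 2 by rewrite ge_min lexx.
have [r r0 Hr] := curve_separation d'0 d'2.
pose K := M + m / 8.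
have K0 : 0 < K by rewrite addr_gt0.
(* [K] bounds the admissible normals, so a height of at most [e0] moves a point by at most [r / 2],
   half the separation of far points; [e0 <= 1/2] also gives [|t| + |e| <= 1]. *)
pose e0 := Num.min 2^-1 (r / (2 * K)).
have e00 : 0 < e0 by rewrite lt_min invr_gt0 ltr0n/= divr_gt0// mulr_gt0.
pose c := Num.min (m / 8) (r / 2).
have c0 : 0 < c by rewrite lt_min m8 divr_gt0.
exists c, e0, (m / 8); split => // s t e nu t2 ee0 nun.
have [td|dt] := ltP `|t| d'.
  have omt : omega `|t| <= m / 8.
    apply: ge_sup; first by exists 0, (0, 0) => //=; rewrite subrr ?normc0 ?normr0.
    by move=> _ [[s1 s2] /= st <-]; apply: Hd; lra.
  have T := curve_taylor s t.
  have T' : omega `|t| * `|t| <= m / 8 * `|t| by rewrite ler_wpM2r.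
  (* For small [t] the linear part dominates: it has slope [m / 2], while the Taylor remainder and
     the deviation of [nu] cost at most [m / 8] each. *)
  have N : m / 2 * (`|t| + `|e|) <= normc ((t%:C - e%:C * 'i%C) * g' s).
    rewrite normcM.
    have a1 : (`|t| + `|e|) / 2 <= normc (t%:C - e%:C * 'i%C).
      have := normc_Re (t%:C - e%:C * 'i%C); have := normc_Im (t%:C - e%:C * 'i%C).
      have -> : Re (t%:C - e%:C * 'i%C) = t by rewrite cReD cReN cReM /=; ring.
      have -> : Im (t%:C - e%:C * 'i%C) = - e by rewrite cImD cImN cImM /=; ring.
      by rewrite normrN; lra.
    apply: le_trans (_ : (`|t| + `|e|) / 2 * m <= _); first by rewrite le_eqVlt; apply/orP; left; apply/eqP; ring.
    by apply: ler_pM => //; rewrite ?ltW// divr_ge0// addr_ge0.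
  have -> : g (s + t) - g s - e%:C * nu = (t%:C - e%:C * 'i%C) * g' s -
     (e%:C * (nu - 'i%C * g' s) - (g (s + t) - g s - t%:C * g' s)) by ring.
  apply: le_trans (normcB_ge _ _).
  have := normcB (e%:C * (nu - 'i%C * g' s)) (g (s + t) - g s - t%:C * g' s).
  rewrite [normc (e%:C * _)]normcM normcR.
  have e1 : `|e| * normc (nu - 'i%C * g' s) <= `|e| * (m / 8) by rewrite ler_wpM2l.
  have c1 : c * (`|t| + `|e|) <= m / 8 * (`|t| + `|e|).
    by rewrite ler_wpM2r ?addr_ge0// ge_min lexx.
  have := normr_ge0 t; have := normr_ge0 e; nra.
have nuK : normc nu <= K.
  rewrite -[nu](subrK ('i%C * g' s)); apply: le_trans (normcD _ _) _.
  by rewrite normcM normci mul1r addrC /K lerD.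
have ek : `|e| * normc nu <= r / 2.
  apply: le_trans (_ : r / (2 * K) * K <= _).
    by apply: ler_pM => //; [exact: normc_ge0|apply: (le_trans ee0); rewrite ge_min lexx orbT].
  by rewrite le_eqVlt; apply/orP; left; apply/eqP; field; rewrite gt_eqF.
have e2 : `|e| <= 2^-1 by apply: (le_trans ee0); rewrite ge_min lexx.
apply: le_trans (normcB_ge _ _).
have := Hr s t; rewrite dt t2 normcM normcR => /(_ isT) rr.
have c1 : c * (`|t| + `|e|) <= r / 2 * (`|t| + `|e|).
  by rewrite ler_wpM2r ?addr_ge0// ge_min lexx orbT.
nra.
Qed.

End Curve.

Section Translation.
Context {R : realType}.
Local Notation C := R[i].

Lemma curve_derivative_rderiv (g g' : R -> C) : curve_derivative g g' ->
  forall s, rderiv g s (g' s).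
Proof.
move=> dg s e e0; have /cvgcP/(_ _ e0)[d /= d0 Hd] := dg s.
exists d => // h hd; have [->|h0] := eqVneq h 0.
  by rewrite addr0 subrr mul0r subrr normc0 normr0 mulr0.
have := Hd h; rewrite /= sub0r normrN => /(_ hd h0) /ltW k.
have hc0 : h%:C != 0 by rewrite -normc_gt0 normcR normr_gt0.
have -> : g (s + h) - g s - h%:C * g' s = ((g (s + h) - g s) / h%:C - g' s) * h%:C.
  by field.
by rewrite normcM normcR ler_wpM2r.
Qed.

Lemma derivable_cderiv (f : C -> C) z : derivable f z 1 -> exists l, cderiv f z l.
Proof.
move=> /cvg_ex[l Hl]; exists l => e e0.
have /cvgcP/(_ _ e0)[d /= d0 Hd] := Hl.
move: d0; rewrite ltcE => /andP[/eqP d0 d1]; exists (Re d) => // h hd.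
have [->|h0] := eqVneq h 0.
  by rewrite addr0 subrr mul0r subrr normc0 mulr0.
have hd' : `|0 - h| < d by rewrite sub0r normrN normr_normc ltcE /= d0 eqxx.
have /ltW := Hd h hd' h0; rewrite /GRing.scale /= mulr1 [h + z]addrC => k.
have -> : f (z + h) - f z - h * l = (h^-1 * (f (z + h) - f z) - l) * h by field.
by rewrite normcM ler_wpM2r// normc_ge0.
Qed.

Lemma dini_smooth_loop (G : set C) (g g' : R -> C) :
  periodic_parametrization G g -> curve_derivative g g' -> continuous g' ->
  (forall s, g' s != 0) -> smooth_loop g g'.
Proof.
by move=> [_ gp ginj _] dg cg' g'0; split => //; exact: curve_derivative_rderiv.
Qed.

Lemma mul_close (A B : C) (e : R) : 0 < e -> exists2 d, 0 < d &
  forall X Y, normc (X - A) < d -> normc (Y - B) < d -> normc (X * Y - A * B) <= e.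
Proof.
move=> e0; pose K := normc A + normc B + 1.
have K0 : 0 < K by rewrite ltr_wpDl ?addr_ge0 ?normc_ge0.
exists (Num.min 1 (e / K)); first by rewrite lt_min ltr01 divr_gt0.
move=> X Y; rewrite !lt_min => /andP[_ XA] /andP[Y1 YB].
have -> : X * Y - A * B = (X - A) * Y + A * (Y - B) by ring.
have Yn : normc Y <= normc B + 1.
  by have := normcB_ge Y B; lra.
apply: le_trans (normcD _ _) _; rewrite !normcM.
apply: le_trans (_ : e / K * K <= _); last by rewrite divfK ?gt_eqF.
have h1 : normc (X - A) * normc Y <= e / K * (normc B + 1).
  by apply: ler_pM; rewrite ?normc_ge0// ltW.
have h2 : normc A * normc (Y - B) <= normc A * (e / K).
  by apply: ler_wpM2l; [exact: normc_ge0|exact: ltW].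
apply: le_trans (lerD h1 h2) _.
rewrite [normc A * _]mulrC -mulrDr ler_pM2l ?divr_gt0//.
by rewrite /K; lra.
Qed.

End Translation.

(** * Nearest points on the curve and the side on which the exterior lies *)

Section LoopTopology.
Context {R : realType}.
Local Notation C := R[i].
Variables g g' : R -> C.
Hypothesis L : smooth_loop g g'.

Lemma loop_compact : compact (range g).
Proof.
have -> : range g = [set g s | s in `[0, 1]].
  rewrite eqEsubset; split => _ [s _ <-]; last by exists s.
  have [m /andP[m0 m1]] := period_reduce s.
  exists (s - m%:~R); first by rewrite /= in_itv /= m0 ltW.
  by rewrite -mulrNz periodic_int//; exact: loop_periodic L.
apply: continuous_compact; last exact: segment_compact.
apply: continuous_subspaceT; exact: (curve_continuous L).
Qed.

Lemma loop_closed : closed (range g).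
Proof. by apply: compact_closed loop_compact; exact: norm_hausdorff. Qed.

Lemma loop_bounded : exists M : R, 0 < M /\ forall s, normc (g s) <= M.
Proof.
have [M M0 HM] := periodic_bounded (curve_continuous L : continuous g) (loop_periodic L).
by exists M.
Qed.

Lemma loop_nearest (z : C) : exists s0, forall s, normc (g s0 - z) <= normc (g s - z).
Proof.
have cg : continuous g := curve_continuous L.
have cf : continuous (fun s => normc (g s - z)).
  move=> s; apply: (cvg_comp _ _ (_ : g t - z @[t --> s] --> g s - z)) (@normc_continuous R _).
  by apply: cvgB; [exact: cg|exact: cvg_cst].
have [|s0 _ Hs] := @EVT_min R (fun s => normc (g s - z)) 0 1 ler01.
  exact: continuous_subspaceT.
exists s0 => s; have [m /andP[m0 m1]] := period_reduce s.
have -> : g s = g (s - m%:~R).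
  by rewrite -mulrNz periodic_int//; exact: loop_periodic L.
by apply: Hs; rewrite in_itv /= m0 ltW.
Qed.

(** At a nearest point the derivative of the squared distance vanishes: [Re (conj v * g'(s0)) = 0],
    which says that [v] is a real multiple of [i g'(s0)]. *)
Lemma loop_nearest_normal (z : C) (s0 : R) :
  (forall s, normc (g s0 - z) <= normc (g s - z)) ->
  exists l : R, z = g s0 + l%:C * ('i%C * g' s0).
Proof.
move=> Hs; set v := g s0 - z in Hs; set a := g' s0.
have a0 : a != 0 := loop_neq0 L s0.
pose A := Re (conjc v * a).
have A0 : A = 0.
  apply/eqP; apply: contrapT => /negP A0.
  have v0 : 0 < normc v.
    rewrite normc_gt0; apply/eqP => v0; move: A0.
    by rewrite /A v0 (_ : conjc 0 = 0) ?mul0r ?eqxx//; apply: complex_eq; rewrite /= ?oppr0.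
  have An : 0 < `|A| by rewrite normr_gt0.
  have e0 : 0 < `|A| / (4 * normc v) by rewrite divr_gt0// mulr_gt0.
  set e := `|A| / _ in e0.
  have [d d0 Hd] := loop_rderiv L s0 e0.
  have a2 : 0 < normc a ^+ 2 by rewrite exprn_gt0// normc_gt0.
  (* A step of length [k] against the sign of [A] changes the squared distance by [-2 k |A|] to
     first order. The bounds on [k] make the expansion valid, allow squaring [|v| - e k], and keep
     the quadratic term below [k |A| / 2]; the expansion error costs another [k |A| / 2], so the
     distance would decrease. *)
  pose k := Num.min (d / 2) (Num.min (normc v / e) (`|A| / (2 * normc a ^+ 2))).
  have k0 : 0 < k by rewrite !lt_min !divr_gt0//= mulr_gt0.
  have kd : k < d.
    have : k <= d / 2 by rewrite ge_min lexx.
    by move: d0; lra.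
  have ke : e * k <= normc v.
    have : k <= normc v / e by rewrite /k !ge_min lexx orbT.
    by rewrite ler_pdivlMr// mulrC.
  have kA : k * (2 * normc a ^+ 2) <= `|A|.
    have : k <= `|A| / (2 * normc a ^+ 2) by rewrite /k !ge_min lexx !orbT.
    by rewrite ler_pdivlMr// mulr_gt0.
  pose t := if 0 <= A then - k else k.
  have tn : `|t| = k by rewrite /t; case: ifP; rewrite ?normrN gtr0_norm.
  have tA : t * A = - (`|A| * k).
    rewrite /t; case: (leP 0 A) => A1; first by rewrite ger0_norm//; ring.
    by rewrite ltr0_norm//; ring.
  have := Hd t; rewrite tn => /(_ kd); set r := _ - _ - _ => rk.
  have := Hs (s0 + t); rewrite (_ : g (s0 + t) - z = (v + t%:C * a) + r); last first.
    by rewrite /r /v /a; ring.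
  move=> h1; have h2 := normcD (v + t%:C * a) r.
  have h3 : normc v - e * k <= normc (v + t%:C * a) by lra.
  have h4 : (normc v - e * k) ^+ 2 <= normc (v + t%:C * a) ^+ 2.
    by rewrite ler_sqr ?nnegrE ?normc_ge0// subr_ge0.
  have h5 : normc (v + t%:C * a) ^+ 2 = normc v ^+ 2 + 2 * (t * A) + t ^+ 2 * normc a ^+ 2.
    rewrite !normc_sqr cReD cImD !cReM !cImM /A cReM cReJ cImJ /=; ring.
  have h6 : t ^+ 2 = k ^+ 2 by rewrite -tn real_normK ?num_real.
  have h7 : e * normc v = `|A| / 4 by rewrite /e; field; rewrite gt_eqF.
  have h8 : k * (k * (2 * normc a ^+ 2)) <= k * `|A| by rewrite ler_pM2l.
  rewrite h5 tA h6 in h4.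
  have h9 : 0 < k * `|A| by rewrite mulr_gt0.
  have h10 : e * k * normc v = k * (`|A| / 4) by rewrite -h7; ring.
  have h11 : 0 <= (e * k) ^+ 2 by rewrite sqr_ge0.
  by nra.
have a2 : normc a ^+ 2 != 0 by rewrite expf_neq0// normc_eq0.
exists (- Im (v * conjc a) / normc a ^+ 2).
rewrite -[z](subrK (g s0)) -[z - g s0]opprB -/v addrC; congr (_ + _).
have vE : v * conjc a = 'i%C * (Im (v * conjc a))%:C.
  rewrite [LHS]complexE (_ : Re _ = 0) ?add0r//.
  by rewrite -A0 /A !cReM !cReJ !cImJ; ring.
have aJ : conjc a != 0 by rewrite -normc_eq0 normcJ normc_eq0.
apply: (mulIf aJ); set y := Im (v * conjc a) in vE *; set n := normc a ^+ 2 in a2 *.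
rewrite mulNr vE (_ : _ * conjc a = 'i%C * ((- y / n)%:C * (a * conjc a))); last by ring.
by rewrite mulzJ -rcM divfK// rcN mulrN.
Qed.

End LoopTopology.

(** Standing hypotheses of the analytic part; [b] is the limit of [phi z / z], instantiated at the
    end by the inverse capacity. *)
Record exterior_setting (R : realType) (g g' : R -> R[i]) (phi psi : R[i] -> R[i])
    (b : R[i]) : Prop := ExteriorSetting {
  set_loop : smooth_loop g g';
  set_pair : exterior_pair (range g) phi psi;
  set_holo : forall z, exterior (range g) z -> exists l, cderiv phi z l;
  set_b : b != 0;
  set_infty : forall e : R, 0 < e -> exists M : R, forall z, M < normc z ->
    normc (phi z / z - b) < e
}.

Section ExteriorCauchy.
Context {R : realType}.
Local Notation C := R[i].
Variables (g g' : R -> C) (phi psi : C -> C) (b : C).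
Hypothesis S : exterior_setting g g' phi psi b.
Let L := set_loop S.
Let E := set_pair S.
Local Notation G := (range g).
Local Notation D := (exterior (range g)).

Let cg : continuous g := curve_continuous L.
Let cg' : continuous g' := loop_cont L.
Let gp := loop_periodic L.

Lemma exterior_open z : D z -> exists2 r : R, 0 < r & forall y, normc (y - z) < r -> D y.
Proof. exact: exterior_domain_open (loop_closed L). Qed.

Lemma exterior_large : exists2 M : R, 0 < M & forall z, M < normc z -> D z.
Proof.
have [M [M0 HM]] := loop_bounded L.
exists M => // z; apply: exterior_domain_large; first exact: ltW.
by move=> _ [s _ <-].
Qed.

Lemma psi_asymptotic (e : R) : 0 < e -> exists2 N : R, 1 <= N & forall w, N < normc w ->
  normc (psi w - w / b) <= e * normc w.
Proof.
move=> e0; have nb : 0 < normc b by rewrite normc_gt0 (set_b S).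
(* Two roles: [d <= |b| / 2] first yields [|psi w| <= 2 |w| / |b|], and this bound turns the second
   entry into the error [e |w|]. *)
pose d := Num.min (normc b / 2) (e * normc b ^+ 2 / 2).
have d0 : 0 < d by rewrite lt_min !divr_gt0// mulr_gt0// exprn_gt0.
have [M HM] := set_infty S d0.
have [N HN] := psi_infty E (Num.max M 0).
exists (Num.max N 1); first by rewrite le_max lexx orbT.
move=> w; rewrite gt_max => /andP[Nw w1].
have := HN w (ltW w1) Nw; rewrite gt_max => /andP[Mp p0].
have pn0 : psi w != 0 by rewrite -normc_gt0.
have := HM _ Mp; rewrite (psiK E (ltW w1)) => H.
have b0 := set_b S.
have h1 : normc (w - b * psi w) <= d * normc (psi w).
  have -> : w - b * psi w = (w / psi w - b) * psi w by field.
  by rewrite normcM; apply: ler_wpM2r (ltW H); exact: normc_ge0.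
have db : d <= normc b / 2 by rewrite ge_min lexx.
have h2 : normc (psi w) <= 2 / normc b * normc w.
  have := normcB_ge (b * psi w) w; rewrite normcBC normcM.
  have h3 : d * normc (psi w) <= normc b / 2 * normc (psi w) by rewrite ler_pM2r.
  rewrite mulrAC ler_pdivlMr//; nra.
have -> : psi w - w / b = - (w - b * psi w) / b by field.
rewrite normcM normcN normcV ler_pdivrMr//.
apply: (le_trans h1); apply: le_trans (_ : d * (2 / normc b * normc w) <= _).
  by rewrite ler_pM2l.
apply: le_trans (_ : e * normc b ^+ 2 / 2 * (2 / normc b * normc w) <= _).
  apply: ler_wpM2r; last by rewrite ge_min lexx orbT.
  by rewrite mulr_ge0 ?normc_ge0// divr_ge0// ltW.
by rewrite le_eqVlt; apply/orP; left; apply/eqP; field; rewrite gt_eqF.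
Qed.

(** Every parameter [u] is congruent to some [s + t] with [|t| <= 1/2], so the tubular estimate
    gives a positive distance to each point of the loop. *)
Lemma not_on_loop (c e0 eta : R) : 0 < c ->
  (forall s t e nu, `|t| <= 2^-1 -> `|e| <= e0 -> normc (nu - 'i%C * g' s) <= eta ->
    c * (`|t| + `|e|) <= normc (g (s + t) - g s - e%:C * nu)) ->
  forall s e nu, e != 0 -> `|e| <= e0 -> normc (nu - 'i%C * g' s) <= eta ->
    ~ G (g s + e%:C * nu).
Proof.
move=> c0 H s e nu en0 ee0 nun [u _ uE].
have [m /andP[m0 m1]] := period_reduce (u - s + 2^-1).
pose t := u - s - m%:~R.
have t2 : `|t| <= 2^-1 by rewrite ler_norml /t; lra.
have := H s t e nu t2 ee0 nun.
have -> : g (s + t) = g u.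
  have -> : s + t = u + (- m)%:~R by rewrite /t mulrNz; ring.
  by rewrite periodic_int.
have -> : g u - g s - e%:C * nu = 0 by rewrite uE; ring.
rewrite normc0 leNgt => /negP; apply; rewrite mulr_gt0// ltr_wpDl//.
by rewrite normr_gt0.
Qed.

(* Points close to the loop lie on a normal through their nearest point; since
   some exterior points are close to the loop, at least one side of the loop is
   exterior. Neither the Jordan curve theorem nor an orientation is needed. *)
Lemma exterior_side : exists sigma c e0 eta : R,
  [/\ [/\ `|sigma| = 1, 0 < c, 0 < e0 & 0 < eta],
   forall s t e nu, `|t| <= 2^-1 -> `|e| <= e0 -> normc (nu - 'i%C * g' s) <= eta ->
    c * (`|t| + `|e|) <= normc (g (s + t) - g s - e%:C * nu) &
   forall s e nu, 0 < e -> e <= e0 -> normc (nu - 'i%C * g' s) <= eta ->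
    D (g s + (sigma * e)%:C * nu)].
Proof.
have [c [e0 [eta [c0 e00 eta0 H]]]] := curve_tubular L.
have notG := not_on_loop c0 H.
have [m m0 Hm] := periodic_bounded_below cg' (curve_deriv_periodic L) (loop_neq0 L).
have G0 : G (g 0) by exists 0.
have u1 : normc (phi (g 0)) = 1 := phi_G E G0.
have em0 : 0 < e0 * m by rewrite mulr_gt0.
(* An exterior point close to the loop: the image under [psi] of a point just outside the unit
   circle, close to [phi (g 0)]. *)
have [z1 Dz1 z1g] : exists2 z1, D z1 & normc (z1 - g 0) < e0 * m.
  have p1 : 1 <= normc (phi (g 0)) by rewrite u1.
  have /ccontP/(_ _ em0)[d d0 Hd] := psi_cont E p1.
  have d2 : 0 < d / 2 by rewrite divr_gt0.
  have n1 : normc ((1 + d / 2)%:C * phi (g 0)) = 1 + d / 2.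
    by rewrite normcM u1 mulr1 normcR gtr0_norm// addr_gt0.
  exists (psi ((1 + d / 2)%:C * phi (g 0))); first by apply: (psi_D E); rewrite n1; lra.
  have {2}<- : psi (phi (g 0)) = g 0 by apply: (phiK E); right.
  apply: Hd; first by rewrite /mkset n1; lra.
  have -> : (1 + d / 2)%:C * phi (g 0) - phi (g 0) = (d / 2)%:C * phi (g 0).
    by rewrite rcD; ring.
  by rewrite normcM u1 mulr1 normcR gtr0_norm//; lra.
have nGz1 : ~ G z1.
  by move=> Gz; have := connected_component_sub Dz1; apply; exists z1.
have [s1 Hs1] := loop_nearest L z1.
have [l z1E] := loop_nearest_normal L Hs1.
have l0 : l != 0.
  by apply/eqP => l0; apply: nGz1; exists s1 => //; rewrite z1E l0 mul0r addr0.
have le0 : `|l| <= e0.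
  have : `|l| * m < e0 * m.
    apply: le_lt_trans z1g; apply: le_trans (_ : normc (g s1 - z1) <= _); last first.
      by rewrite (normcBC z1) Hs1.
    have -> : g s1 - z1 = - (l%:C * ('i%C * g' s1)) by rewrite z1E; ring.
    by rewrite normcN !normcM normcR normci mul1r ler_wpM2l.
  by rewrite ltr_pM2r// => /ltW.
exists (Num.sg l), c, e0, eta; split => //.
  by split => //; rewrite normr_sg l0.
move=> s e nu e1 ee0 nun.
have D1 : D (g s + (Num.sg l * e)%:C * ('i%C * g' s)).
  (* From the exterior point at height [l] over [s1] to height [sg l * e] over [s]: base point and
     height vary linearly and the height keeps the sign of [l], so the path never meets the loop. *)
  pose sp (t : R) : R := s1 + t * (s - s1).
  pose ep (t : R) : R := l + t * (Num.sg l * e - l).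
  pose ga (t : R) : C := g (sp t) + (ep t)%:C * ('i%C * g' (sp t)).
  have -> : g s + (Num.sg l * e)%:C * ('i%C * g' s) = ga 1.
    by rewrite /ga /sp /ep !mul1r ![_ + (_ - _)]addrC !subrK.
  apply: (@exterior_domain_path R G ga).
  - have csp : continuous sp.
      by move=> t; apply: cvgD; [exact: cvg_cst|apply: cvgM; [exact: cvg_id|exact: cvg_cst]].
    have cep : continuous ep.
      by move=> t; apply: cvgD; [exact: cvg_cst|apply: cvgM; [exact: cvg_id|exact: cvg_cst]].
    have c1 : continuous (fun t => g (sp t)).
      by move=> t; exact: (@continuous_comp _ _ _ sp g t (csp t) (@cg (sp t))).
    have c2 : continuous (fun t => g' (sp t)).
      by move=> t; exact: (@continuous_comp _ _ _ sp g' t (csp t) (@cg' (sp t))).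
    move=> t; apply: cvgD; first exact: c1.
    apply: cvgM; first by apply: cvg_RC; exact: cep.
    by apply: cvgM; [exact: cvg_cst|exact: c2].
  - move=> t /andP[t0 t1].
    have epE : ep t = Num.sg l * ((1 - t) * `|l| + t * e).
      by rewrite /ep {1 3}[l]numEsg; ring.
    have ep0 : 0 < (1 - t) * `|l| + t * e.
      have ln : 0 < `|l| by rewrite normr_gt0.
      have := mulr_ge0 (_ : 0 <= 1 - t) (ltW ln); rewrite subr_ge0 => /(_ t1) h1.
      have [->|tn0] := eqVneq t 0; first by rewrite subr0 mul1r mul0r addr0.
      by rewrite ltr_wpDl// mulr_gt0// lt_neqAle eq_sym tn0.
    apply: notG.
    + by rewrite epE mulf_neq0 ?sgr_eq0// gt_eqF.
    + rewrite epE normrM normr_sg l0 mul1r gtr0_norm//.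
      by nra.
    + by rewrite subrr normc0 ltW.
  - by rewrite /ga /sp /ep !mul0r !addr0 -z1E.
(* At fixed height the exact normal is now tilted into [nu], staying among the admissible
   directions. *)
pose ga (t : R) : C := g s + (Num.sg l * e)%:C * ('i%C * g' s + t%:C * (nu - 'i%C * g' s)).
have -> : g s + (Num.sg l * e)%:C * nu = ga 1.
  by rewrite /ga mul1r; ring.
apply: (@exterior_domain_path R G ga).
- move=> t; apply: cvgD; first exact: cvg_cst.
  apply: cvgM; first exact: cvg_cst.
  apply: cvgD; first exact: cvg_cst.
  by apply: cvgM; [apply: cvg_RC; exact: cvg_id|exact: cvg_cst].
- move=> t /andP[t0 t1]; apply: notG.
  + by rewrite mulf_neq0 ?sgr_eq0// gt_eqF.
  + by rewrite normrM normr_sg l0 mul1r gtr0_norm.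
  + rewrite addrAC subrr add0r normcM normcR ger0_norm//.
    by apply: le_trans nun; rewrite -[leRHS]mul1r ler_wpM2r// normc_ge0.
- have -> : ga 0 = g s + (Num.sg l * e)%:C * ('i%C * g' s) by rewrite /ga; ring.
  exact: D1.
Qed.

End ExteriorCauchy.

(** * Cauchy's theorem up to the boundary *)

Section GammaCauchy.
Context {R : realType}.
Local Notation C := R[i].
Variables (g g' : R -> C) (phi psi : C -> C) (b : C).
Hypothesis S : exterior_setting g g' phi psi b.
Let L := set_loop S.
Let E := set_pair S.
Local Notation D := (exterior (range g)).
Local Notation DG := (exterior (range g) `|` range g).

Lemma modulus_small (e : R) : 0 < e -> exists2 d, 0 < d &
  forall t, 0 <= t -> t < d -> modulus_of_continuity g' t <= e.
Proof.
move=> e0.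
have [d d0 Hd] := periodic_uniform_continuity (loop_cont L : continuous g') (curve_deriv_periodic L) e0.
exists d => // t t0 td; apply: ge_sup.
  by exists 0, (0, 0) => //=; rewrite subrr ?normc0 ?normr0.
by move=> _ [[s1 s2] /= st <-]; apply: Hd; exact: le_lt_trans td.
Qed.

Definition cont_ext (F : C -> C) := forall z, DG z -> F @ within DG (nbhs z) --> F z.

Lemma cont_ext_path (F : C -> C) (ga : R -> C) : cont_ext F -> continuous ga ->
  (forall s, DG (ga s)) -> continuous (fun s => F (ga s)).
Proof.
move=> cF cga gaD s; apply/rcontP => e e0.
have /ccontP/(_ _ e0)[d d0 Hd] := cF _ (gaD s).
have /rcontP/(_ _ d0)[d' d'0 Hd'] := cga s.
by exists d' => // t /Hd' ts; apply: Hd => //; exact: gaD.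
Qed.

Lemma cont_ext_interior (F : C -> C) z : cont_ext F -> D z -> {for z, continuous F}.
Proof.
move=> cF Dz; apply/ccontinuousP => e e0.
have /ccontP/(_ _ e0)[d d0 Hd] := cF _ (or_introl Dz).
have [r r0 Hr] := exterior_open S Dz.
exists (Num.min d r); first by rewrite lt_min d0.
by move=> t; rewrite lt_min => /andP[td tr]; apply: Hd => //; left; exact: Hr.
Qed.

Variables (F : C -> C) (z0 : C).
Hypothesis cF : cont_ext F.
Hypothesis dF : forall z, D z -> z != z0 -> exists l, cderiv F z l.
Hypothesis iF : forall e : R, 0 < e ->
  exists M : R, forall z, M < normc z -> normc (F z) <= e / normc z.

Lemma ball_primitive z (r : R) : 0 < r -> (forall y, normc (y - z) < 4 * r -> D y) ->
  exists P, primitive_on F P z r.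
Proof.
move=> r0 H; have r4 : 0 < 4 * r by rewrite mulr_gt0.
have [||P HP] := @local_primitive R F z z0 (4 * r) r4.
- by move=> y /H Dy; exact: cont_ext_interior.
- by move=> y /H Dy y0; exact: dF.
exists P => y yr; apply: HP.
by rewrite mulrC mulKf ?pnatr_eq0.
Qed.

(** The loop is pushed to infinity by [psi ((1 + |t|) phi)]. At a large time [T] it lies near
    [(1 + T) phi / b] and splits into a number of arcs independent of [T], each in a disc of radius
    comparable with its distance to 0; as [z F(z)] tends to 0, every arc contributes little. *)
Lemma cauchy_inner_loop (ga ga' : R -> C) : (forall s, D (ga s)) ->
  (forall s, rderiv ga s (ga' s)) -> continuous ga' -> (forall s, ga (s + 1) = ga s) ->
  Int (fun s => F (ga s) * ga' s) 0 1 = 0.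
Proof.
move=> gaD dga cga' gap.
have cga : continuous ga by move=> s; exact: rderiv_cont (dga s).
pose f s := phi (ga s).
have gaDG s : DG (ga s) by left.
have cphi : cont_ext phi := @phi_cont _ _ _ _ E.
have cf : continuous f := cont_ext_path cphi cga gaDG.
have cFga : continuous (fun s => F (ga s)) := cont_ext_path cF cga gaDG.
have fp s : f (s + 1) = f s by rewrite /f gap.
have f1 s : 1 < normc (f s) by exact: (phi_D E).
(* The absolute value keeps the map continuous, with values in the domain, for all real [t]. *)
pose Phi (s t : R) := psi ((1 + `|t|)%:C * f s).
have w1 (s t : R) : 1 < normc ((1 + `|t|)%:C * f s).
  rewrite normcM normcR ger0_norm ?addr_ge0//.
  have := f1 s; have := normr_ge0 t; nra.
have Phi0 s : Phi s 0 = ga s.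
  by rewrite /Phi normr0 addr0 mul1r; apply: (phiK E); left.
have cPhi : continuous2 Phi.
  move=> s t e e0; have /ccontP/(_ _ e0)[d d0 Hd] := psi_cont E (ltW (w1 s t)).
  have d2 : 0 < d / 2 by rewrite divr_gt0.
  have [r r0 Hr] := mul_close (1 + `|t|)%:C (f s) d2.
  have /rcontP/(_ _ r0)[r' r'0 Hr'] := cf s.
  exists (Num.min r r'); first by rewrite lt_min r0.
  move=> s' t'; rewrite !lt_min => /andP[_ ss'] /andP[tt' _].
  apply: Hd; first exact: ltW.
  apply: le_lt_trans (Hr _ _ _ (Hr' _ ss')) _; last by move: d0; lra.
  rewrite -rcB normcR; apply: le_lt_trans tt'.
  by rewrite opprD addrACA subrr add0r ler_dist_dist.
have FE : (fun s => F (ga s) * ga' s) = (fun s => F (Phi s 0) * ga' s).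
  by apply/funext => s; rewrite Phi0.
rewrite FE; apply: (homotopy_cauchy cPhi).
- by move=> t; rewrite /Phi -(fp 0) add0r.
- move=> s t _; have [r r0 Hr] := exterior_open S (psi_D E (w1 s t)).
  have r4 : 0 < r / 4 by rewrite divr_gt0.
  exists (r / 4) => //; apply: ball_primitive => // y yr; apply: Hr; move: yr.
  by rewrite mulrC divfK ?pnatr_eq0.
- by move=> s; apply: rderiv_near (dga s); apply/nearrP; exists 1 => // t _; rewrite Phi0.
- by rewrite -FE => s; apply: cvgM; [exact: cFga|exact: cga'].
move=> e e0.
have [W W0 HW] := periodic_bounded cf fp.
have nb : 0 < normc b by rewrite normc_gt0 (set_b S).
(* Oscillation of [f] allowed on one arc: scaled by [(1 + T) / |b|] it is a quarter of the disc
   radius [r = (1 + T) / (8 |b|)]. The error in the asymptotics of [psi] takes another quarter. *)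
have q0 : (0 : R) < 32^-1 by rewrite invr_gt0.
have [d d0 Hd] := periodic_uniform_continuity cf fp q0.
have [n nd] : exists n : nat, n.+1%:R^-1 < d.
  exists (Num.truncn d^-1); rewrite invf_plt ?posrE ?ltr0n//; exact: truncnS_gt.
have n0 : (0 : R) < n.+1%:R by rewrite ltr0n.
have eta0 : 0 < (32 * normc b * W)^-1 by rewrite invr_gt0 !mulr_gt0.
have [N N1 HN] := psi_asymptotic S eta0.
have [M HM] := iF (divr_gt0 e0 n0).
have [M2 M20 HM2] := exterior_large S.
pose T := N + 2 * normc b * (`|M| + M2 + normc z0 + 1).
have K0 : 0 < `|M| + M2 + normc z0 + 1.
  by have := normr_ge0 M; have := normc_ge0 z0; lra.
have bK : 0 < 2 * normc b * (`|M| + M2 + normc z0 + 1) by rewrite !mulr_gt0.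
have T0 : 0 <= T by rewrite /T; lra.
have T1 : 0 < 1 + T by lra.
pose rho := (1 + T) / (2 * normc b).
have rho_gt : `|M| + M2 + normc z0 + 1 < rho.
  by rewrite ltr_pdivlMr ?mulr_gt0// mulrC /T; lra.
have rho0 : 0 < rho by apply: lt_trans rho_gt.
exists T, n; split => // j jn.
pose sj : R := j%:R / n.+1%:R.
(* A primitive on the disc of radius [r] requires the disc of radius [4 r = rho] to lie in the
   domain; since [|zc| >= 2 rho], that disc stays outside radius [rho], where the decay of [F] is
   available too. *)
pose zc := (1 + T)%:C * f sj / b.
pose r := (1 + T) / (8 * normc b).
have r0 : 0 < r by rewrite divr_gt0// mulr_gt0.
have r4 : 4 * r = rho by rewrite /r /rho; field; rewrite gt_eqF.
have zcn : 2 * rho <= normc zc.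
  rewrite /zc !normcM normcV normcR gtr0_norm// /rho.
  rewrite (_ : 2 * _ = (1 + T) / normc b); last by field; rewrite gt_eqF.
  by rewrite ler_pM2r ?invr_gt0// ler_peMr ?ltW.
have big y : normc (y - zc) < 4 * r -> rho < normc y.
  by rewrite r4; have := normcB_ge zc y; rewrite (normcBC zc); lra.
have [P HP] : exists P, primitive_on F P zc r.
  apply: ball_primitive => // y /big yr; apply: HM2.
  by have := normr_ge0 M; have := normc_ge0 z0; lra.
exists zc, r, (e / n.+1%:R / rho), P; split => //.
- move=> y yr; have yb : rho < normc y by apply: big; lra.
  have My : M < normc y.
    by have := ler_norm M; have := normc_ge0 z0; lra.
  apply: le_trans (HM y My) _.
  rewrite ler_pM2l ?divr_gt0// lef_pV2 ?posrE// ?(lt_trans rho0)//.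
  exact: ltW.
- move=> s /andP[s1 s2].
  have ss : `|s - sj| < d.
    rewrite ger0_norm ?subr_ge0//; apply: le_lt_trans nd.
    have sE : j.+1%:R / n.+1%:R = sj + n.+1%:R^-1 :> R.
      by rewrite /sj -natr1 mulrDl mul1r.
    by rewrite lerBlDl -sE.
  have fs := Hd _ _ ss.
  have vn : normc ((1 + T)%:C * f s) = (1 + T) * normc (f s).
    by rewrite normcM normcR gtr0_norm.
  have vN : N < normc ((1 + T)%:C * f s).
    by rewrite vn /T; have := f1 s; nra.
  have h1 := HN _ vN; rewrite vn in h1.
  have -> : Phi s T = psi ((1 + T)%:C * f s) by rewrite /Phi ger0_norm.
  apply: le_lt_trans (normc_dist3 _ ((1 + T)%:C * f s / b) _) _.
  have h2 : (32 * normc b * W)^-1 * ((1 + T) * normc (f s)) <= (1 + T) / (32 * normc b).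
    have -> : (32 * normc b * W)^-1 * ((1 + T) * normc (f s)) =
        (1 + T) / (32 * normc b) * (normc (f s) / W) by field; rewrite !gt_eqF.
    apply: ler_piMr; first by rewrite divr_ge0 ?mulr_ge0 ?normc_ge0// ltW.
    by rewrite ler_pdivrMr// mul1r.
  have h3 : normc ((1 + T)%:C * f s / b - zc) <= (1 + T) / (32 * normc b).
    have -> : (1 + T)%:C * f s / b - zc = (1 + T)%:C * (f s - f sj) / b by rewrite /zc; ring.
    rewrite !normcM normcV normcR gtr0_norm// invfM mulrA ler_pM2r ?invr_gt0//.
    by rewrite ler_pM2l.
  have h4 : (1 + T) / (32 * normc b) = r / 4 by rewrite /r; field; rewrite gt_eqF.
  by rewrite h4 in h2 h3; lra.
- rewrite (_ : _ * n.+1%:R = e / 2); last by rewrite -r4; field; rewrite !gt_eqF.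
  by lra.
Qed.

(** [i g'] is merely continuous, so [g + e i g'] need not be differentiable. The normal is replaced
    by [i] times a difference quotient of [g] of step [h], a C^1 field within [eta] of [i g']; the
    displaced loops lie in the domain, and their integrals, all 0, tend to the one over [g]. *)
Theorem gamma_cauchy : Int (fun s => F (g s) * g' s) 0 1 = 0.
Proof.
have [sigma [c [e0 [eta [[sg c0 e00 eta0] _ HD]]]]] := exterior_side S.
have [h0 h00 Hh0] := modulus_small eta0.
pose h : R := h0 / 2.
have hp : 0 < h by rewrite divr_gt0.
have hc0 : h%:C != 0 :> C by rewrite -normc_gt0 normcR normr_gt0 gt_eqF.
have cg : continuous g := curve_continuous L.
have cg' : continuous g' := loop_cont L.
have gp := loop_periodic L.
have gp' := curve_deriv_periodic L.
pose nu (s : R) : C := 'i%C / h%:C * (g (1 * s + h) - g s).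
pose nu' (s : R) : C := 'i%C / h%:C * (g' (1 * s + h) - g' s).
have shift (f : R -> C) : continuous f -> continuous (fun s : R => f (1 * s + h)).
  move=> cf s; apply: (@continuous_comp _ _ _ (fun s : R => 1 * s + h) f s) (cf _).
  by apply: cvgD; [apply: cvgM; [exact: cvg_cst|exact: cvg_id]|exact: cvg_cst].
have cdiff (f : R -> C) : continuous f ->
    continuous (fun s : R => 'i%C / h%:C * (f (1 * s + h) - f s)).
  move=> cf s; apply: cvgM; first exact: cvg_cst.
  by apply: cvgB; [exact: (shift f cf)|exact: cf].
have cnu : continuous nu := cdiff g cg.
have cnu' : continuous nu' := cdiff g' cg'.
have dnu s : rderiv nu s (nu' s).
  apply: rderivZ; apply: rderivB; last exact: loop_rderiv L s.
  by rewrite -[g' _]mul1r; apply: (@rderiv_affine R g 1 h); exact: loop_rderiv L _.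
have nup s : nu (s + 1) = nu s.
  by rewrite /nu gp (_ : 1 * (s + 1) + h = (1 * s + h) + 1) ?gp//; ring.
have nup' s : nu' (s + 1) = nu' s.
  by rewrite /nu' gp' (_ : 1 * (s + 1) + h = (1 * s + h) + 1) ?gp'//; ring.
have nun s : normc (nu s - 'i%C * g' s) <= eta.
  have -> : nu s - 'i%C * g' s = 'i%C / h%:C * (g (s + h) - g s - h%:C * g' s).
    by rewrite /nu mul1r; field.
  rewrite !normcM normci mul1r normcV normcR gtr0_norm// mulrC ler_pdivrMr//.
  apply: le_trans (curve_taylor L s h) _; rewrite gtr0_norm// ler_pM2r//.
  by apply: Hh0; [exact: ltW|rewrite /h; lra].
have [K K0 HK] := periodic_bounded cnu nup.
have [K' K'0 HK'] := periodic_bounded cnu' nup'.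
pose ga (e s : R) : C := g s + (sigma * e)%:C * nu s.
pose ga' (e s : R) : C := g' s + (sigma * e)%:C * nu' s.
have zero e : 0 < e -> e <= e0 -> Int (fun s => F (ga e s) * ga' e s) 0 1 = 0.
  move=> ep ee0; apply: cauchy_inner_loop.
  - by move=> s; apply: HD.
  - by move=> s; apply: rderivD; [exact: loop_rderiv L s|apply: rderivZ; exact: dnu].
  - move=> s; apply: cvgD; first exact: cg'.
    by apply: cvgM; [exact: cvg_cst|exact: cnu'].
  - by move=> s; rewrite /ga gp nup.
have GDG s : DG (g s) by right; exists s.
have cFg : continuous (fun s => F (g s) * g' s).
  by move=> s; apply: cvgM; [exact: (cont_ext_path cF cg GDG)|exact: cg'].
apply/eqP; rewrite -normc_eq0; apply/eqP/le_anti; rewrite normc_ge0 andbT.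
apply/ler_addgt0Pr => q q0; rewrite add0r.
have [e ep He] : exists2 e, 0 < e & forall s, 0 <= s <= 1 ->
    forall e', 0 < e' -> e' <= e -> e' <= e0 ->
    normc (F (g s) * g' s - F (ga e' s) * ga' e' s) <= q.
  apply: itv_uniform; first exact: ler01.
    by move=> e e' s le H u u0 ue uee; apply: H => //; exact: le_trans le.
  move=> p _; have q2 : 0 < q / 2 by rewrite divr_gt0.
  have [r r0 Hr] := mul_close (F (g p)) (g' p) q2.
  have r2 : 0 < r / 2 by rewrite divr_gt0.
  have /ccontP/(_ _ r0)[d d0 Hd] := cF (GDG p).
  have d2 : 0 < d / 2 by rewrite divr_gt0.
  have /rcontP/(_ _ d2)[d1 d10 Hd1] := cg p.
  have /rcontP/(_ _ r2)[d3 d30 Hd3] := cg' p.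
  exists (Num.min (d / 2 / K) (r / 2 / K')); first by rewrite lt_min !divr_gt0.
  exists (Num.min d1 d3); first by rewrite lt_min d10.
  move=> s; rewrite lt_min => /andP[/Hd1 k1 /Hd3 k3] _ e ep.
  rewrite le_min => /andP[]; rewrite !ler_pdivlMr// => eK eK' ee0.
  have sen (x : C) (B : R) : normc x <= B -> normc ((sigma * e)%:C * x) <= e * B.
    by move=> xB; rewrite normcM normcR normrM sg mul1r gtr0_norm// ler_pM2l.
  have a1 : normc (F (g s) - F (g p)) < r.
    by apply: Hd; [exact: GDG|move: k1; lra].
  have a2 : normc (g' s - g' p) < r by move: k3; lra.
  have a3 : normc (F (ga e s) - F (g p)) < r.
    apply: Hd; first by left; exact: HD.
    rewrite (_ : ga e s - g p = (g s - g p) + (sigma * e)%:C * nu s); last by rewrite /ga; ring.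
    apply: le_lt_trans (normcD _ _) _.
    by have := sen _ _ (HK s); lra.
  have a4 : normc (ga' e s - g' p) < r.
    rewrite (_ : ga' e s - g' p = (g' s - g' p) + (sigma * e)%:C * nu' s); last by rewrite /ga'; ring.
    apply: le_lt_trans (normcD _ _) _.
    by have := sen _ _ (HK' s); lra.
  have := Hr _ _ a1 a2; have := Hr _ _ a3 a4.
  have := normc_dist3 (F (g s) * g' s) (F (g p) * g' p) (F (ga e s) * ga' e s).
  by rewrite (normcBC (F (g p) * g' p)); lra.
pose u := Num.min e e0.
have u0 : 0 < u by rewrite lt_min ep.
have ue : u <= e by rewrite ge_min lexx.
have uee : u <= e0 by rewrite ge_min lexx orbT.
have cga : continuous (fun s => F (ga u s) * ga' u s).
  have c1 : continuous (ga u).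
    by move=> t; apply: cvgD; [exact: cg|apply: cvgM; [exact: cvg_cst|exact: cnu]].
  have c2 : continuous (ga' u).
    by move=> t; apply: cvgD; [exact: cg'|apply: cvgM; [exact: cvg_cst|exact: cnu']].
  have gaDG t : DG (ga u t) by left; exact: HD.
  by move=> s; apply: cvgM; [exact: (cont_ext_path cF c1 gaDG)|exact: c2].
rewrite -[Int _ _ _]subr0 -(zero u u0 uee) -(IntB 0 1 cFg cga).
rewrite -[q]mulr1 -[X in q * X](subr0 1).
apply: Int_bound; first exact: ler01.
  by move=> s; apply: cvgB; [exact: cFg|exact: cga].
by move=> s s01; exact: He.
Qed.

End GammaCauchy.

Section Polynomials.
Context {R : realType}.
Local Notation C := R[i].

Lemma cderivX (n : nat) (z : C) : cderiv (fun t => t ^+ n.+1) z (n.+1%:R * z ^+ n).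
Proof.
elim: n => [|n ih].
  by rewrite expr0 mulr1; exact: cderiv_id.
have -> : (fun t : C => t ^+ n.+2) = (fun t => t * t ^+ n.+1).
  by apply/funext => t; rewrite exprS.
rewrite (_ : _ * _ = 1 * z ^+ n.+1 + z * (n.+1%:R * z ^+ n)).
  by apply: cderivM => //; exact: cderiv_id.
by rewrite -[in LHS]natr1 exprS; ring.
Qed.

End Polynomials.

(** * Behaviour at infinity and polynomial parts *)

Section Infinity.
Context {R : realType}.
Local Notation C := R[i].

#[local] Existing Instance cinfty_filter.

Lemma cvg_cinfty_cst (l : C) : (fun=> l) @ (@cinfty R) --> l.
Proof. exact: cvg_cst. Qed.

Lemma cvg_cinfty_invB (a : C) : (fun z : C => (z - a)^-1) @ (@cinfty R) --> 0.
Proof.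
apply/cvg_cinftyP => e e0; exists (normc a + e^-1) => z za.
rewrite subr0 normcV; have := normcB_ge z a => h.
have ei : 0 < e^-1 by rewrite invr_gt0.
by rewrite invf_plt ?posrE//; lra.
Qed.

Lemma cvg_cinfty_inv : (fun z : C => z^-1) @ (@cinfty R) --> 0.
Proof.
have := cvg_cinfty_invB 0; rewrite (_ : (fun z => _) = (fun z : C => z^-1))//.
by apply/funext => z; rewrite subr0.
Qed.

Lemma cvg_cinfty_near (f h : C -> C) (l : C) (M : R) :
  (forall z, M < normc z -> f z = h z) -> f @ (@cinfty R) --> l -> h @ (@cinfty R) --> l.
Proof.
move=> fh /cvg_cinftyP H; apply/cvg_cinftyP => e /H[N HN].
by exists (Num.max M N) => z; rewrite gt_max => /andP[/fh <-]; exact: HN.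
Qed.

Lemma series_geometric_bound (x : nat -> C) (B q : R) (n : nat) : 0 <= B -> 0 <= q -> q <= 2^-1 ->
  (forall k, normc (x k) <= B * q ^+ k.+1) ->
  normc (\sum_(0 <= k < n) x k) <= 2 * B * q.
Proof.
move=> B0 q0 q2 xk.
have : normc (\sum_(0 <= k < n) x k) <= 2 * B * q * (1 - 2^-1 ^+ n).
  elim: n => [|n ih].
    by rewrite big_geq// normc0 expr0 subrr mulr0.
  rewrite big_nat_recr//=; apply: le_trans (normcD _ _) _.
  have h : normc (x n) <= B * q * 2^-1 ^+ n.
    apply: (le_trans (xk n)); rewrite exprS -[in leRHS]mulrA ler_wpM2l// ler_wpM2l//.
    by apply: lerXn2r; rewrite ?nnegrE ?invr_ge0.
  apply: le_trans (lerD ih h) _.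
  by rewrite exprS le_eqVlt; apply/orP; left; apply/eqP; field.
move=> h; apply: (le_trans h); apply: ler_piMr; first by rewrite !mulr_ge0.
by rewrite gerBl exprn_ge0// invr_ge0.
Qed.

(** The difference is the sum over negative powers. Convergence at the radius [r1] bounds the
    coefficients by [B r1^(k+1)], and for [|z| >= 2 r1] a geometric series gives the bound
    [2 B r1 / |z|]. *)
Lemma laurent_polynomial_part (f : C -> C) (p : {poly C}) : is_polynomial_part f p ->
  (fun z => f z - p.[z]) @ (@cinfty R) --> 0.
Proof.
move=> [a [[r Hr] pa]].
pose r1 := `|r| + 1.
have r10 : 0 < r1 by rewrite ltr_wpDl.
(* The coefficients of nonnegative index are those of [p], so the partial sums are eventually
   constant, equal to [p.[z]]. *)
have sE (z s : C) : [series a k%:Z * z ^+ k]_k @ \oo --> s -> s = p.[z].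
  move=> cs; apply: (@cvgc_unique R nat \oo _ _ _ _ cs).
  apply/(cvgcP (F := \oo)) => e e0; exists (size p) => // n /= np.
  rewrite (horner_coef_wide z np) /series /= big_mkord.
  have -> : \sum_(i < n) p`_i * z ^+ i = \sum_(i < n) a i%:Z * z ^+ i.
    by apply: eq_bigr => i _; rewrite pa.
  by rewrite subrr normc0.
have [B [B0 HB]] : exists B, 0 <= B /\ forall k : nat,
    normc (a (- k.+1%:Z)) <= B * r1 ^+ k.+1.
  have r1r : r < normc (r1%:C : C).
    by rewrite normcR gtr0_norm// /r1; have := ler_norm r; lra.
  have [s [t [_ ct _]]] := Hr _ r1r.
  have : cvgn [series a (- k.+1%:Z) * r1%:C ^- k.+1]_k by apply/cvg_ex; exists t.
  move=> /cvg_series_cvg_0 /cvgcP/(_ _ ltr01)[n _ Hn].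
  pose B := 1 + \sum_(0 <= k < n) normc (a (- k.+1%:Z) * r1%:C ^- k.+1).
  have S0 : 0 <= \sum_(0 <= k < n) normc (a (- k.+1%:Z) * r1%:C ^- k.+1).
    by apply: sumr_ge0 => k _; exact: normc_ge0.
  exists B; split; first by rewrite addr_ge0.
  move=> k; rewrite -ler_pdivrMr ?exprn_gt0//.
  have -> : normc (a (- k.+1%:Z)) / r1 ^+ k.+1 = normc (a (- k.+1%:Z) * r1%:C ^- k.+1).
    by rewrite normcM normcV normcX normcR gtr0_norm.
  have [nk|kn] := leqP n k.
    by have := Hn k nk; rewrite /= subr0 /B; lra.
  rewrite /B (bigD1_seq k) ?mem_index_iota ?iota_uniq//=.
    by rewrite addrCA lerDl addr_ge0// sumr_ge0// => i _; exact: normc_ge0.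
apply/cvg_cinftyP => e e0.
exists (2 * r1 + 2 * B * r1 / e) => z zM.
have Bre : 0 <= 2 * B * r1 / e by rewrite divr_ge0 ?mulr_ge0// ltW.
have z2 : 2 * r1 < normc z by lra.
have z0 : 0 < normc z by lra.
have rz : r < normc z by have := ler_norm r; rewrite /r1 in z2 r10 *; lra.
have [s [t [cs ct ->]]] := Hr z rz.
rewrite (sE _ _ cs) subr0 addrC addKr.
have q0 : 0 <= r1 / normc z by rewrite divr_ge0// ltW.
have q2 : r1 / normc z <= 2^-1 by rewrite ler_pdivrMr//; lra.
have tb : normc t <= 2 * B * (r1 / normc z).
  apply/ler_addgt0Pr => d d0.
  have /cvgcP/(_ _ d0)[n _ /(_ n (leqnn n)) Hn] := ct.
  have := normcB_ge t ([series a (- k.+1%:Z) * z ^- k.+1]_k n).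
  have := @series_geometric_bound (fun k => a (- k.+1%:Z) * z ^- k.+1) B (r1 / normc z) n B0 q0 q2.
  have Hk k : normc (a (- k.+1%:Z) * z ^- k.+1) <= B * (r1 / normc z) ^+ k.+1.
    by rewrite normcM normcV normcX exprMn exprVn mulrA ler_pM2r ?invr_gt0 ?exprn_gt0.
  move=> /(_ Hk) h1 h2; rewrite /= normcBC in Hn.
  move: h1 h2 Hn; rewrite /series /=; lra.
apply: (le_lt_trans tb); rewrite mulrA ltr_pdivrMr//.
have : 2 * B * r1 / e < normc z by lra.
by rewrite ltr_pdivrMr// => h; rewrite [ltRHS]mulrC.
Qed.

End Infinity.

(** * Residues at infinity and the winding number *)

Section ResidueIdentities.
Context {R : realType}.
Local Notation C := R[i].
Variables (g g' : R -> C) (phi psi : C -> C) (b : C).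
Hypothesis S : exterior_setting g g' phi psi b.
Let L := set_loop S.
Let E := set_pair S.
Local Notation D := (exterior (range g)).
Local Notation DG := (exterior (range g) `|` range g).
Local Notation cont_ext := (cont_ext g).

#[local] Existing Instance cinfty_filter.

Let cg : continuous g := curve_continuous L.
Let cg' : continuous g' := loop_cont L.
Let gp := loop_periodic L.
Let gDG s : DG (g s). Proof. by right; exists s. Qed.

Lemma phi_ge1 z : DG z -> 1 <= normc (phi z).
Proof. by case=> [/(phi_D E)/ltW//|/(phi_G E)->]. Qed.

Lemma phi_neq0 z : DG z -> phi z != 0.
Proof. by move=> /phi_ge1 h; rewrite -normc_gt0; apply: lt_le_trans h. Qed.

Lemma cont_extD F H : cont_ext F -> cont_ext H -> cont_ext (fun z => F z + H z).
Proof. by move=> cF cH z Dz; apply: cvgD; [exact: cF|exact: cH]. Qed.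

Lemma cont_extM F H : cont_ext F -> cont_ext H -> cont_ext (fun z => F z * H z).
Proof. by move=> cF cH z Dz; apply: cvgM; [exact: cF|exact: cH]. Qed.

Lemma cont_ext_cst (k : C) : cont_ext (fun=> k).
Proof. by move=> z Dz; exact: cvg_cst. Qed.

Lemma cont_ext_cderiv F : (forall z, exists l, cderiv F z l) -> cont_ext F.
Proof. by move=> dF z _; have [l dl] := dF z; exact: cderiv_cont dl. Qed.

Lemma cont_ext_phi : cont_ext phi.
Proof. exact: phi_cont E. Qed.

Lemma cont_extX F n : cont_ext F -> cont_ext (fun z => F z ^+ n).
Proof.
move=> cF; elim: n => [|n ih].
  have -> : (fun z => F z ^+ 0) = fun=> 1 by apply/funext => z; rewrite expr0.
  exact: cont_ext_cst.
have -> : (fun z => F z ^+ n.+1) = (fun z => F z * F z ^+ n).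
  by apply/funext => z; rewrite exprS.
exact: (cont_extM cF ih).
Qed.

Lemma cont_ext_phiV : cont_ext (fun z => (phi z)^-1).
Proof. by move=> z Dz; apply: cvgV; [exact: phi_neq0|exact: cont_ext_phi]. Qed.

Lemma cderiv_exp (F : C -> C) z n : (exists l, cderiv F z l) ->
  exists l, cderiv (fun t => F t ^+ n) z l.
Proof.
move=> [l dl]; elim: n => [|n [m dm]].
  have -> : (fun z => F z ^+ 0) = fun=> 1 by apply/funext => y; rewrite expr0.
  by exists 0; exact: cderiv_cst.
have -> : (fun z => F z ^+ n.+1) = (fun z => F z * F z ^+ n).
  by apply/funext => y; rewrite exprS.
by exists (l * F z ^+ n + F z * m); exact: cderivM.
Qed.

Lemma holo_phiV z : D z -> exists l, cderiv (fun t => (phi t)^-1) z l.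
Proof.
move=> Dz; have [l dl] := set_holo S Dz.
by eexists; apply: cderivV dl; apply: phi_neq0; left.
Qed.

Lemma cvg_cinfty_phi : (fun z => z * (phi z)^-1) @ (@cinfty R) --> b^-1.
Proof.
have h : (fun z => phi z / z) @ (@cinfty R) --> b by apply/cvg_cinftyP; exact: set_infty S.
have h2 : (fun z => (phi z / z)^-1) @ (@cinfty R) --> b^-1 by exact: cvgV (set_b S) h.
by apply: (cvg_cinfty_near (M := 0) _ h2) => z _; rewrite invf_div.
Qed.

Lemma cvg_cinfty_phiV : (fun z => (phi z)^-1) @ (@cinfty R) --> 0.
Proof.
have h : (fun z => z^-1 * (z * (phi z)^-1)) @ (@cinfty R) --> 0.
  by rewrite -(mul0r b^-1); apply: cvgM; [exact: cvg_cinfty_inv|exact: cvg_cinfty_phi].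
by apply: (cvg_cinfty_near (M := 0) _ h) => z z0; rewrite mulKf// -normc_gt0.
Qed.

(* Its value is 2 i pi up to the orientation of the loop, which comes out only
   at the very end, from the boundary values of the Faber identity. *)
Definition loop_const : C := b * Int (fun s => (phi (g s))^-1 * g' s) 0 1.
Local Notation K := loop_const.

Lemma continuous_loop F : cont_ext F -> continuous (fun s => F (g s) * g' s).
Proof.
by move=> cF s; apply: cvgM; [exact: (cont_ext_path cF cg gDG)|exact: cg'].
Qed.

(** Subtracting [rho b / phi], whose product with [z] has the same limit [rho], leaves a function to
    which [gamma_cauchy] applies. *)
Lemma loop_residue (F : C -> C) (z0 rho : C) : cont_ext F ->
  (forall z, D z -> z != z0 -> exists l, cderiv F z l) ->
  (fun z => z * F z) @ (@cinfty R) --> rho ->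
  Int (fun s => F (g s) * g' s) 0 1 = rho * K.
Proof.
move=> cF dF iF.
pose k : C := - (rho * b).
pose H (z : C) : C := F z + k * (phi z)^-1.
have cH : cont_ext H := cont_extD cF (cont_extM (@cont_ext_cst k) (@cont_ext_phiV)).
have dH z : D z -> z != z0 -> exists l, cderiv H z l.
  move=> Dz zz; have [l dl] := dF z Dz zz; have [m dm] := holo_phiV Dz.
  by exists (l + k * m); apply: cderivD => //; exact: cderivZ.
have iH : (fun z => z * H z) @ (@cinfty R) --> 0.
  have -> : 0 = rho + k * b^-1 by rewrite /k mulNr mulfK ?subrr// (set_b S).
  have -> : (fun z => z * H z) = (fun z => z * F z + k * (z * (phi z)^-1)).
    by apply/funext => z; rewrite /H; ring.
  by apply: cvgD; [exact: iF|apply: cvgM; [exact: cvg_cinfty_cst|exact: cvg_cinfty_phi]].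
have iH' e : 0 < e -> exists M : R, forall z, M < normc z -> normc (H z) <= e / normc z.
  move=> e0; have [M HM] := (cvg_cinftyP _ _).1 iH e e0.
  exists (Num.max M 0) => z; rewrite gt_max => /andP[/HM Mz z0'].
  by rewrite ler_pdivlMr// mulrC -normcM; move: Mz; rewrite subr0 => /ltW.
have := gamma_cauchy S cH dH iH'.
have -> : (fun s => H (g s) * g' s) =
    (fun s => F (g s) * g' s + k * ((phi (g s))^-1 * g' s)).
  by apply/funext => s; rewrite /H; ring.
have c1 := continuous_loop cF; have c2 := continuous_loop (@cont_ext_phiV).
have c3 : continuous (fun s => k * ((phi (g s))^-1 * g' s)).
  by move=> s; apply: cvgM; [exact: cvg_cst|exact: c2].
rewrite (IntD 0 1 c1 c3) (IntZ k 0 1 c2) => /eqP; rewrite addr_eq0 => /eqP ->.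
by rewrite /k /K; ring.
Qed.

(** For [m >= 2] the product [z phi^-m] tends to 0, so the residue at infinity vanishes. *)
Lemma loop_phi_power m : (1 < m)%N -> Int (fun s => (phi (g s))^-1 ^+ m * g' s) 0 1 = 0.
Proof.
case: m => [|[|m]]// _.
have -> : 0 = 0 * K by rewrite mul0r.
apply: (@loop_residue (fun z => (phi z)^-1 ^+ m.+2) 0).
- exact: (cont_extX (n := m.+2) (@cont_ext_phiV)).
- by move=> z Dz _; apply: cderiv_exp; exact: holo_phiV.
- have -> : (fun z => z * (phi z)^-1 ^+ m.+2) = (fun z => (z * (phi z)^-1) * ((phi z)^-1 * (phi z)^-1 ^+ m)).
    by apply/funext => z; rewrite !exprS; ring.
  rewrite (_ : 0 = b^-1 * (0 * 0 ^+ m)); last by rewrite mul0r mulr0.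
  apply: cvgM; first exact: cvg_cinfty_phi.
  apply: cvgM; first exact: cvg_cinfty_phiV.
  elim: m => [|m ih].
    rewrite expr0; have -> : (fun z => (phi z)^-1 ^+ 0) = (fun=> 1).
      by apply/funext => z; rewrite expr0.
    exact: cvg_cinfty_cst.
  rewrite exprS; have -> : (fun z => (phi z)^-1 ^+ m.+1) = (fun z => (phi z)^-1 * (phi z)^-1 ^+ m).
    by apply/funext => z; rewrite exprS.
  by apply: cvgM; [exact: cvg_cinfty_phiV|exact: ih].
Qed.

Lemma loop_off (z : C) : D z -> exists2 d, 0 < d & forall s, d <= normc (g s - z).
Proof.
move=> Dz; have [r r0 Hr] := exterior_open S Dz; exists r => // s.
rewrite leNgt; apply/negP => /Hr Ds.
by have := connected_component_sub Ds; apply; exists (g s).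
Qed.

Lemma loop_off_neq0 z s : D z -> g s - z != 0.
Proof. by move=> /loop_off[d d0 /(_ s)]; rewrite -normc_gt0; exact: lt_le_trans. Qed.

Lemma continuous_cauchy_kernel z : D z -> continuous (fun s => (g s - z)^-1).
Proof.
move=> Dz s; apply: cvgV; first exact: loop_off_neq0.
by apply: cvgB; [exact: cg|exact: cvg_cst].
Qed.

Definition winding (z : C) : C := Int (fun s => (g s - z)^-1 * g' s) 0 1.

Lemma continuous_winding_kernel z : D z -> continuous (fun s => (g s - z)^-1 * g' s).
Proof.
by move=> Dz s; apply: cvgM; [exact: (continuous_cauchy_kernel Dz)|exact: cg'].
Qed.

(** Differentiating under the integral gives [g' / (g - z)^2], which has the periodic primitive
    [-1 / (g - z)] and hence integral 0. *)
Lemma winding_deriv0 z : D z -> cderiv winding z 0.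
Proof.
move=> Dz; have [d d0 Hd] := loop_off Dz.
have [M M0 HM] := periodic_bounded (cg' : continuous g') (curve_deriv_periodic L).
have [r r0 Hr] := exterior_open S Dz.
pose B := M * (d^-1 * d^-1 * (d / 2)^-1).
have d2 : 0 < d / 2 by rewrite divr_gt0.
have B0 : 0 < B by rewrite !mulr_gt0 ?invr_gt0.
move=> e e0; exists (Num.min (Num.min r (d / 2)) (e / B)).
  by rewrite !lt_min r0 d2 divr_gt0.
move=> h; rewrite !lt_min => /andP[/andP[hr hd] he].
have Dzh : D (z + h) by apply: Hr; rewrite addrAC subrr add0r.
have gzh s : d / 2 <= normc (g s - (z + h)).
  have := Hd s; have := normcB_ge (g s - z) h.
  by rewrite (_ : g s - z - h = g s - (z + h)); [lra|ring].
have ck := continuous_winding_kernel Dz; have ckh := continuous_winding_kernel Dzh.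
have c1 : continuous (fun s => (g s - z)^-1) := continuous_cauchy_kernel Dz.
have c1h : continuous (fun s => (g s - (z + h))^-1) := continuous_cauchy_kernel Dzh.
have csq : continuous (fun s => (g s - z)^-1 * (g s - z)^-1 * g' s).
  by move=> s; apply: cvgM; [apply: cvgM; exact: c1|exact: cg'].
have sq0 : Int (fun s => (g s - z)^-1 * (g s - z)^-1 * g' s) 0 1 = 0.
  rewrite (Int_primitive (P := fun s => - (g s - z)^-1) 0 1 csq).
    by rewrite -[in X in X - _ = _](add0r 1) gp subrr.
  move=> s; have -> : (g s - z)^-1 * (g s - z)^-1 * g' s = - (- (1 - 0) / (g s - z) ^+ 2 * g' s).
    by rewrite subr0 expr2 invfM; ring.
  apply: rderivN; apply: (rderiv_comp (F := fun y => (y - z)^-1)); last exact: loop_rderiv L s.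
  apply: cderivV; first exact: loop_off_neq0.
  by apply: cderivB; [exact: cderiv_id|exact: cderiv_cst].
have -> : winding (z + h) - winding z - h * 0 =
   Int (fun s => h ^+ 2 * ((g s - z)^-1 * (g s - z)^-1 * (g s - (z + h))^-1 * g' s)) 0 1.
  rewrite mulr0 subr0 /winding -[RHS]addr0 -[X in _ = _ + X](mulr0 h) -sq0 -(IntZ h 0 1 csq).
  have c3 : continuous (fun s => h ^+ 2 * ((g s - z)^-1 * (g s - z)^-1 * (g s - (z + h))^-1 * g' s)).
    move=> s; apply: cvgM; first exact: cvg_cst.
    apply: cvgM; last exact: cg'.
    by apply: cvgM; [apply: cvgM; exact: c1|exact: c1h].
  have c4 : continuous (fun s => h * ((g s - z)^-1 * (g s - z)^-1 * g' s)).
    by move=> s; apply: cvgM; [exact: cvg_cst|exact: csq].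
  rewrite -(IntB 0 1 ckh ck) -(IntD 0 1 c3 c4).
  congr (Int _ 0 1); apply/funext => s.
  by field; rewrite !loop_off_neq0.
apply: le_trans (_ : (normc h ^+ 2 * B) * (1 - 0) <= _).
  apply: Int_bound; first exact: ler01.
    move=> s; apply: cvgM; first exact: cvg_cst.
    apply: cvgM; last exact: cg'.
    by apply: cvgM; [apply: cvgM; exact: c1|exact: c1h].
  move=> s _; rewrite normcM normcX !normcM !normcV ler_wpM2l ?exprn_ge0 ?normc_ge0//.
  rewrite /B [M * _]mulrC; apply: ler_pM => //.
  - by rewrite !mulr_ge0 ?invr_ge0 ?normc_ge0.
  - exact: normc_ge0.
  - have i1 : (normc (g s - z))^-1 <= d^-1.
      by rewrite lef_pV2 ?posrE//; apply: lt_le_trans (Hd s).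
    have i2 : (normc (g s - (z + h)))^-1 <= (d / 2)^-1.
      by rewrite lef_pV2 ?posrE//; apply: lt_le_trans (gzh s).
    by apply: ler_pM; rewrite ?mulr_ge0 ?invr_ge0 ?normc_ge0//; apply: ler_pM; rewrite ?invr_ge0 ?normc_ge0.
rewrite subr0 mulr1 expr2 -mulrA [leRHS]mulrC ler_wpM2l ?normc_ge0//.
by rewrite -ler_pdivlMr// ltW.
Qed.

Lemma winding_locally_const z : D z -> exists2 r, 0 < r &
  forall y, normc (y - z) < r -> winding y = winding z.
Proof.
move=> Dz; have [r r0 Hr] := exterior_open S Dz; exists r => // y yr.
apply/eqP; rewrite -subr_eq0 -normc_eq0; apply/eqP/le_anti; rewrite normc_ge0 andbT.
have zr : normc (z - z) < r by rewrite subrr normc0.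
have := @primitive_on_lip R (fun=> 0) winding z r 0 z y _ _ zr yr.
rewrite mul0r; apply; last by move=> x _; rewrite normc0.
by move=> x xr; apply: winding_deriv0; exact: Hr.
Qed.

(** The winding number is constant along [psi ((1 + |t|) phi z)], which leads from [z] to infinity
    inside the domain, and far away the kernel is uniformly small. *)
Lemma winding_exterior z : D z -> winding z = 0.
Proof.
move=> Dz.
have [M M0 HM] := periodic_bounded (cg' : continuous g') (curve_deriv_periodic L).
have [N [N0 HN]] := loop_bounded L.
have phi1 := phi_D E Dz.
pose ga (t : R) := psi ((1 + `|t|)%:C * phi z).
have w1 (t : R) : 1 < normc ((1 + `|t|)%:C * phi z).
  by rewrite normcM normcR ger0_norm ?addr_ge0//; have := normr_ge0 t; nra.
have gaD t : D (ga t) by apply: (psi_D E).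
have ga0 : ga 0 = z.
  by rewrite /ga normr0 addr0 mul1r; apply: (phiK E); left.
have cga : continuous ga.
  move=> t; apply/rcontP => e e0; have /ccontP/(_ _ e0)[d d0 Hd] := psi_cont E (ltW (w1 t)).
  have p0 : 0 < normc (phi z) by apply: lt_trans phi1.
  exists (d / normc (phi z)); first by rewrite divr_gt0.
  move=> u; rewrite ltr_pdivlMr// => ut; apply: Hd; first exact: ltW.
  have -> : (1 + `|u|)%:C * phi z - (1 + `|t|)%:C * phi z = (`|u| - `|t|)%:C * phi z.
    by rewrite rcB !rcD; ring.
  rewrite normcM normcR; apply: le_lt_trans ut.
  by rewrite ler_wpM2r ?normc_ge0// ler_dist_dist.
have cst T : 0 <= T -> winding (ga T) = winding z.
  move=> T0; rewrite -ga0.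
  pose Q x y : Prop := winding (ga y) = winding (ga x).
  suff : Q 0 T by [].
  apply: itv_induction => //; first by move=> x y u _ _ q1 q2; rewrite /Q q2.
  move=> p _; have [r r0 Hr] := winding_locally_const (gaD p).
  have /rcontP/(_ _ r0)[d d0 Hd] := cga p.
  exists d => // x y _ xp py _ yx; rewrite /Q.
  rewrite (Hr (ga y)) ?(Hr (ga x))//; apply: Hd.
    by rewrite ler0_norm ?subr_le0//; lra.
  by rewrite ger0_norm ?subr_ge0//; lra.
apply/eqP; rewrite -normc_eq0; apply/eqP/le_anti; rewrite normc_ge0 andbT.
apply/ler_addgt0Pr => e e0; rewrite add0r.
have [X HX] := psi_infty E (N + M / e).
have [T [T0 TX]] : exists T : R, 0 <= T /\ X < (1 + T) * normc (phi z).
  exists `|X|; split => //; have := ler_norm X; have := normr_ge0 X; nra.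
rewrite -(cst T T0).
have /HX big : X < normc ((1 + `|T|)%:C * phi z).
  by rewrite normcM normcR ger0_norm ?addr_ge0// ger0_norm.
have {}big := big (ltW (w1 T)); rewrite -/(ga T) in big.
have Me : 0 < M / e by rewrite divr_gt0.
have := Int_bound (M := M * (e / M)) ler01 (continuous_winding_kernel (gaD T)).
rewrite subr0 mulr1 [M * _]mulrC divfK ?gt_eqF//; apply.
move=> s _; rewrite normcM normcV mulrC.
have h : M / e <= normc (g s - ga T).
  by have := normcB_ge (ga T) (g s); have := HN s; rewrite normcBC; lra.
rewrite ler_pdivrMr; last exact: lt_le_trans h.
apply: (le_trans (HM s)); rewrite mulrC -ler_pdivrMr//.
Qed.

End ResidueIdentities.

(** * Cauchy integrals of the powers of the exterior map *)

Section FaberIdentity.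
Context {R : realType}.
Local Notation C := R[i].
Variables (g g' : R -> C) (phi psi : C -> C) (b : C).
Hypothesis S : exterior_setting g g' phi psi b.
Let L := set_loop S.
Let E := set_pair S.
Local Notation D := (exterior (range g)).
Local Notation DG := (exterior (range g) `|` range g).
Local Notation cont_ext := (cont_ext g).
Local Notation K := (loop_const g g' phi b).

#[local] Existing Instance cinfty_filter.

Let cg : continuous g := curve_continuous L.
Let cg' : continuous g' := loop_cont L.
Let gp := loop_periodic L.
Let gDG s : DG (g s). Proof. by right; exists s. Qed.

(** The difference quotient of [f] at [z], completed by the derivative [l], is continuous; [z] is
    the exceptional point tolerated by Goursat's theorem. It behaves like [- f z / y] at infinity,
    and the term [f z] in its numerator integrates to 0 because the winding number is 0. *)
Lemma loop_cauchy (f : C -> C) z : cont_ext f -> (forall y, D y -> exists l, cderiv f y l) ->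
  f @ (@cinfty R) --> 0 -> D z ->
  Int (fun s => f (g s) * ((g s - z)^-1 * g' s)) 0 1 = - f z * K.
Proof.
move=> cf df f0 Dz; have [l dl] := df z Dz.
pose H y := (f y - f z) * (y - z)^-1.
pose Q y : C := if y == z then l else H y.
have QH y : y != z -> Q y = H y by rewrite /Q => /negPf ->.
have near_ne y : y != z -> forall x, normc (x - y) < normc (y - z) -> x != z.
  by move=> _ x; apply: contraTneq => ->; rewrite normcBC ltxx.
have cQ : cont_ext Q.
  move=> y Dy; apply/ccontP => e e0; have [->|yz] := eqVneq y z.
    have e2 : 0 < e / 2 by rewrite divr_gt0.
    have [d d0 Hd] := dl _ e2; exists d => // t _ td.
    rewrite /Q eqxx; have [_|tz] := eqVneq t z; first by rewrite subrr normc0.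
    have := Hd _ td; rewrite [z + _]addrC subrK => h.
    have tz0 : t - z != 0 by rewrite subr_eq0.
    have n0 : 0 < normc (t - z) by rewrite normc_gt0.
    have -> : H t - l = (f t - f z - (t - z) * l) / (t - z) by rewrite /H; field.
    by rewrite normcM normcV ltr_pdivrMr//; apply: le_lt_trans h _; rewrite ltr_pM2r//; lra.
  have cH : H @ within DG (nbhs y) --> H y.
    apply: cvgM; first by apply: cvgB; [exact: cf|exact: cvg_cst].
    apply: cvgV; first by rewrite subr_eq0.
    by apply: cvgB; [exact: (cderiv_cont DG (cderiv_id y))|exact: cvg_cst].
  have /ccontP/(_ _ e0)[d d0 Hd] := cH.
  exists (Num.min d (normc (y - z))); first by rewrite lt_min d0 normc_gt0 subr_eq0.
  move=> t Dt; rewrite lt_min => /andP[td tyz].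
  by rewrite !QH//; [exact: Hd|exact: near_ne tyz].
have dQ y : D y -> y != z -> exists m, cderiv Q y m.
  move=> Dy yz; have [m dm] := df y Dy.
  have dH := cderivM (cderivB dm (cderiv_cst (f z) y))
    (cderivV (F := fun t => t - z) (_ : y - z != 0) (cderivB (cderiv_id y) (cderiv_cst z y))).
  have yz0 : y - z != 0 by rewrite subr_eq0.
  eexists; apply: cderiv_near (dH yz0); apply/nearcP.
  exists (normc (y - z)); first by rewrite normc_gt0.
  by move=> t ty; rewrite QH//; exact: near_ne ty.
have iQ : (fun y => y * Q y) @ (@cinfty R) --> - f z.
  have h : (fun y => (f y - f z) * (1 + z * (y - z)^-1)) @ (@cinfty R) --> - f z.
    have E0 : (0 - f z) * (1 + z * 0) = - f z by ring.
    rewrite -[X in _ --> X]E0; apply: cvgM.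
      by apply: cvgB; [exact: f0|exact: cvg_cinfty_cst].
    apply: cvgD; first exact: cvg_cinfty_cst.
    by apply: cvgM; [exact: cvg_cinfty_cst|exact: cvg_cinfty_invB].
  apply: (cvg_cinfty_near (M := normc z) _ h) => y zy.
  have yz : y != z by apply: contraTneq zy => ->; rewrite ltxx.
  by rewrite QH// /H; field; rewrite subr_eq0.
have := loop_residue S cQ dQ iQ.
have gz s : g s != z.
  by have := loop_off_neq0 S s Dz; rewrite subr_eq0.
have c1 : continuous (fun s => f (g s) * ((g s - z)^-1 * g' s)).
  move=> s; apply: cvgM; first exact: (cont_ext_path cf cg gDG).
  exact: (continuous_winding_kernel S Dz).
have c2 : continuous (fun s => f z * ((g s - z)^-1 * g' s)).
  by move=> s; apply: cvgM; [exact: cvg_cst|exact: (continuous_winding_kernel S Dz)].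
have -> : (fun s => Q (g s) * g' s) = (fun s => f (g s) * ((g s - z)^-1 * g' s) -
    f z * ((g s - z)^-1 * g' s)).
  by apply/funext => s; rewrite QH// /H; ring.
rewrite (IntB 0 1 c1 c2) (IntZ (f z) 0 1 (continuous_winding_kernel S Dz)).
by rewrite -/(winding g g' z) (winding_exterior S Dz) mulr0 subr0.
Qed.

Lemma loop_monomial (k : C) n : Int (fun s => k * g s ^+ n * g' s) 0 1 = 0.
Proof.
have cX : continuous (fun s => k * g s ^+ n * g' s).
  move=> s; apply: cvgM; last exact: cg'.
  apply: cvgM; first exact: cvg_cst.
  elim: n => [|n ih].
    rewrite expr0 (_ : (fun s => g s ^+ 0) = fun=> 1); first exact: cvg_cst.
    by apply/funext => t; rewrite expr0.
  rewrite exprS (_ : (fun s => g s ^+ n.+1) = fun s => g s * g s ^+ n).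
    by apply: cvgM; [exact: cg|exact: ih].
  by apply/funext => t; rewrite exprS.
rewrite (Int_primitive (P := fun s => k / n.+1%:R * g s ^+ n.+1) 0 1 cX).
  by have -> : g 1 = g 0; [rewrite -(gp 0) add0r|rewrite subrr].
move=> s.
have -> : k * g s ^+ n * g' s = k / n.+1%:R * (n.+1%:R * g s ^+ n * g' s).
  by rewrite !mulrA divfK ?pnatr_eq0.
apply: rderivZ; apply: (rderiv_comp (F := fun z => z ^+ n.+1)); last exact: loop_rderiv L s.
exact: cderivX.
Qed.

Lemma continuous_horner (p : {poly C}) : continuous (fun s => p.[g s] * g' s).
Proof.
have -> : (fun s => p.[g s] * g' s) = (fun s => \sum_(i < size p) (p`_i * g s ^+ i * g' s)).
  by apply/funext => s; rewrite horner_coef mulr_suml.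
apply: continuous_sum => i s; apply: cvgM; last exact: cg'.
apply: cvgM; first exact: cvg_cst.
elim: (i : nat) => [|n ih].
  rewrite expr0 (_ : (fun s => g s ^+ 0) = fun=> 1); first exact: cvg_cst.
  by apply/funext => t; rewrite expr0.
rewrite exprS (_ : (fun s => g s ^+ n.+1) = fun s => g s * g s ^+ n).
  by apply: cvgM; [exact: cg|exact: ih].
by apply/funext => t; rewrite exprS.
Qed.

Lemma loop_polynomial (p : {poly C}) : Int (fun s => p.[g s] * g' s) 0 1 = 0.
Proof.
have -> : (fun s => p.[g s] * g' s) = (fun s => \sum_(i < size p) (p`_i * g s ^+ i * g' s)).
  by apply/funext => s; rewrite horner_coef mulr_suml.
rewrite Int_sum; first by apply: big1 => i _; exact: loop_monomial.
move=> i; have := @continuous_horner (p`_i *: 'X^i).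
rewrite (_ : (fun s => _) = (fun s => p`_i * g s ^+ i * g' s))//.
by apply/funext => s; rewrite hornerZ hornerXn.
Qed.

(** [p - p.[z]] is divisible by ['X - z], the quotient is a polynomial and integrates to 0, and the
    winding number about [z] is 0. *)
Lemma loop_polynomial_cauchy (p : {poly C}) z : D z ->
  Int (fun s => p.[g s] * ((g s - z)^-1 * g' s)) 0 1 = 0.
Proof.
move=> Dz.
have [q qE] : exists q, p - p.[z]%:P = q * ('X - z%:P).
  by apply/factor_theorem; rewrite /root !hornerE subrr.
have gz s : g s - z != 0 := loop_off_neq0 S s Dz.
have -> : (fun s => p.[g s] * ((g s - z)^-1 * g' s)) =
    (fun s => q.[g s] * g' s + p.[z] * ((g s - z)^-1 * g' s)).
  apply/funext => s.
  have pE : p.[g s] = q.[g s] * (g s - z) + p.[z].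
    have := congr1 (fun r : {poly C} => r.[g s]) qE.
    by rewrite hornerM hornerXsubC hornerD hornerN hornerC => <-; rewrite subrK.
  by rewrite pE mulrDl; congr (_ + _); rewrite -mulrA (mulVKf (gz s)).
have ck := continuous_winding_kernel S Dz.
have c2 : continuous (fun s => p.[z] * ((g s - z)^-1 * g' s)).
  by move=> s; apply: cvgM; [exact: cvg_cst|exact: ck].
rewrite (IntD 0 1 (@continuous_horner q) c2) (IntZ p.[z] 0 1 ck) loop_polynomial.
by rewrite -/(winding g g' z) (winding_exterior S Dz) mulr0 addr0.
Qed.

Lemma faber_error n (p : {poly C}) : is_faber_polynomial phi n p ->
  (fun z => phi z ^+ n - p.[z]) @ (@cinfty R) --> 0.
Proof. exact: laurent_polynomial_part. Qed.

Lemma cderiv_horner (p : {poly C}) z : exists l, cderiv (fun t => p.[t]) z l.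
Proof.
elim/poly_ind: p => [|p c [l dl]].
  exists 0; have -> : (fun t => (0 : {poly C}).[t]) = fun=> 0 by apply/funext => t; rewrite horner0.
  exact: cderiv_cst.
exists (l * z + p.[z] * 1 + 0).
have -> : (fun t => (p * 'X + c%:P).[t]) = (fun t => p.[t] * t + c).
  by apply/funext => t; rewrite !hornerE.
apply: cderivD; last exact: cderiv_cst.
by apply: cderivM; [exact: dl|exact: cderiv_id].
Qed.

(* The Cauchy integrals of phi^n and phi^-n on the loop; the second one is
   conjugated, which exchanges phi^-n and phi^n where |phi| = 1. *)
Lemma faber_identity n (p : {poly C}) z : (0 < n)%N -> is_faber_polynomial phi n p -> D z ->
  K * (p.[z] - phi z ^+ n) + conjc K * conjc ((phi z)^-1 ^+ n) =
  2 * 'i%C * Int (fun s => phi (g s) ^+ n * (Im ((g s - z)^-1 * g' s))%:C) 0 1.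
Proof.
move=> n0 pF Dz.
have ck := continuous_winding_kernel S Dz.
have cphi : cont_ext phi := @cont_ext_phi _ _ _ _ _ _ S.
have cphin : cont_ext (fun z => phi z ^+ n) := cont_extX (n := n) cphi.
have c1 : continuous (fun s => phi (g s) ^+ n * ((g s - z)^-1 * g' s)).
  by move=> s; apply: cvgM; [exact: (cont_ext_path cphin cg gDG)|exact: ck].
have cp : continuous (fun s => p.[g s] * ((g s - z)^-1 * g' s)).
  move=> s; apply: cvgM; last exact: ck.
  have cpe : cont_ext (fun t => p.[t]) := cont_ext_cderiv (cderiv_horner p).
  exact: (cont_ext_path cpe cg gDG).
have A1 : Int (fun s => phi (g s) ^+ n * ((g s - z)^-1 * g' s)) 0 1 = K * (p.[z] - phi z ^+ n).
  have cpe : cont_ext (fun t => p.[t]) := cont_ext_cderiv (cderiv_horner p).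
  have cerr : cont_ext (fun t => phi t ^+ n - p.[t]).
    by move=> t Dt; apply: cvgB; [exact: cphin|exact: cpe].
  have derr y : D y -> exists l, cderiv (fun t => phi t ^+ n - p.[t]) y l.
    move=> Dy; have [l dl] := cderiv_exp n (set_holo S Dy).
    by have [m dm] := cderiv_horner p y; exists (l - m); exact: cderivB.
  have := loop_cauchy cerr derr (faber_error pF) Dz.
  have -> : (fun s => (phi (g s) ^+ n - p.[g s]) * ((g s - z)^-1 * g' s)) =
     (fun s => phi (g s) ^+ n * ((g s - z)^-1 * g' s) - p.[g s] * ((g s - z)^-1 * g' s)).
    by apply/funext => s; ring.
  by rewrite (IntB 0 1 c1 cp) loop_polynomial_cauchy// subr0 => ->; ring.
have cphiV : cont_ext (fun z => (phi z)^-1) := @cont_ext_phiV _ _ _ _ _ _ S.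
have cphiVn : cont_ext (fun z => (phi z)^-1 ^+ n) := cont_extX (n := n) cphiV.
have c2 : continuous (fun s => (phi (g s))^-1 ^+ n * ((g s - z)^-1 * g' s)).
  by move=> s; apply: cvgM; [exact: (cont_ext_path cphiVn cg gDG)|exact: ck].
have A2 : Int (fun s => (phi (g s))^-1 ^+ n * ((g s - z)^-1 * g' s)) 0 1 = - (phi z)^-1 ^+ n * K.
  apply: (loop_cauchy cphiVn) Dz.
    by move=> y Dy; apply: cderiv_exp; exact: holo_phiV S _ Dy.
  case: n n0 {pF cphin c1 A1 cphiVn c2} => // n _.
  have -> : (fun z => (phi z)^-1 ^+ n.+1) = (fun z => (phi z)^-1 * (phi z)^-1 ^+ n).
    by apply/funext => y; rewrite exprS.
  elim: n => [|n ih].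
    rewrite (_ : (fun z => _) = (fun z => (phi z)^-1)); first exact: (cvg_cinfty_phiV S).
    by apply/funext => y; rewrite expr0 mulr1.
  rewrite (_ : (fun z => _) = (fun z => (phi z)^-1 * ((phi z)^-1 * (phi z)^-1 ^+ n))).
    by rewrite -(mulr0 0); apply: cvgM; [exact: (cvg_cinfty_phiV S)|exact: ih].
  by apply/funext => y; rewrite exprS.
have A3 : Int (fun s => phi (g s) ^+ n * conjc ((g s - z)^-1 * g' s)) 0 1 =
    - (conjc K * conjc ((phi z)^-1 ^+ n)).
  have -> : (fun s => phi (g s) ^+ n * conjc ((g s - z)^-1 * g' s)) =
     (fun s => conjc ((phi (g s))^-1 ^+ n * ((g s - z)^-1 * g' s))).
    apply/funext => s; rewrite [RHS]conjcM conjcX conjcV.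
    have -> : conjc (phi (g s)) = (phi (g s))^-1.
      by rewrite normc_inv_conj// (phi_G E)//; exists s.
    by rewrite invrK.
  rewrite (IntJ 0 1 c2) A2 -conjcM mulNr [K * _]mulrC.
  by rewrite -sub0r conjcB -[in RHS]sub0r; congr (_ - _); apply: complex_eq; rewrite /= ?oppr0.
rewrite -A1 -[X in _ + X]opprK -A3.
have cim : continuous (fun s => (Im ((g s - z)^-1 * g' s))%:C).
  by move=> s; apply: cvg_RC; apply: cvg_Im; exact: ck.
have c3 : continuous (fun s => phi (g s) ^+ n * conjc ((g s - z)^-1 * g' s)).
  move=> s; apply: cvgM; first exact: (cont_ext_path cphin cg gDG).
  by apply: cvg_conjc; exact: ck.
have c4 : continuous (fun s => phi (g s) ^+ n * (Im ((g s - z)^-1 * g' s))%:C).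
  by move=> s; apply: cvgM; [exact: (cont_ext_path cphin cg gDG)|exact: cim].
rewrite -(IntB 0 1 c1 c3) -(IntZ (2 * 'i%C) 0 1 c4).
congr (Int _ 0 1); apply/funext => s.
rewrite -mulrBr; have -> (x : C) : x - conjc x = 2 * (Im x)%:C * 'i%C.
  by apply: complex_eq; rewrite !(cReM, cImM, cReD, cImD, cReN, cImN, cReJ, cImJ) /=; ring.
by ring.
Qed.

End FaberIdentity.

(** * The Dini condition *)

Section DiniTail.
Context {R : realType}.
Local Notation mu := (@lebesgue_measure R).
Variable w : R -> R.
Hypothesis w_ge0 : forall t, 0 <= t -> 0 <= w t.
Hypothesis w_mono : forall t u, 0 <= t -> t <= u -> w t <= w u.
Hypothesis w_dini : (\int[mu]_(t in `]0%R, 1%R]) (w t / t)%:E < +oo)%E.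

(** [w] is monotone only on nonnegative arguments; composed with [max t 0] it is monotone on the
    whole line, and monotone functions are measurable. *)
Lemma dini_quotient_measurable : measurable_fun (`]0, 1]%classic : set R) (fun t => w t / t).
Proof.
apply: measurable_realfun.measurable_funM.
  have m : measurable_fun (`]0, 1]%classic : set R) (fun t : R => w (Num.max t 0)).
    apply: measurable_realfun.nondecreasing_measurable => // s t st.
    by apply: w_mono; [rewrite le_max lexx orbT|rewrite ge_max !le_max st lexx orbT].
  apply: eq_measurable_fun m.
  by move=> t /set_mem; rewrite /= in_itv/= => /andP[t0 _]; rewrite max_l ?ltW.
apply: (@measurable_funS _ _ _ _ (`]0, +oo[%classic : set R)) => //.
  by move=> t; rewrite /= !in_itv/= => /andP[->].
apply: measurable_realfun.open_continuous_measurable_fun; first exact: interval_open.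
move=> t /set_mem; rewrite /= in_itv/= andbT => t0.
by apply: inv_continuous; rewrite gt_eqF.
Qed.

Lemma dini_quotient_integrable : mu.-integrable (`[0, 1]%classic : set R) (EFin \o (fun t => w t / t)).
Proof.
have m0 := dini_quotient_measurable.
apply/integrableP; split.
  by apply/measurable_realfun.measurable_EFinP/measurable_realfun.measurable_fun_itv_obnd_cbndP.
apply: le_lt_trans w_dini.
rewrite integral_itv_obnd_cbnd; last exact/measurable_realfun.measurable_EFinP.
rewrite le_eqVlt; apply/orP; left; apply/eqP.
apply: eq_integral => t /set_mem; rewrite /= in_itv/= => /andP[t0 _].
by rewrite ger0_norm// divr_ge0 ?w_ge0.
Qed.

Lemma dini_tail (eta : R) : 0 < eta -> exists2 d, 0 < d <= 2^-1 &
  forall (A : R) (f : R -> R[i]), 0 <= A -> continuous f ->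
    (forall t, 0 < t <= d -> normc (f t) <= A * (w t / t)) ->
    normc (Int f 0 d) <= A * eta.
Proof.
move=> eta0.
have ih := dini_quotient_integrable.
have cvg0 := parameterized_integral_cvg_left ltr01 ih.
have [d /andP[d0 d2] Hd] : exists2 d, 0 < d <= 2^-1 &
    \int[mu]_(t in (`]0, d]%classic : set R)) (w t / t) <= eta.
  have [d /= d0 Hd] := (cvgrPdist_le _ _).1 cvg0 eta eta0.
  have m0 : 0 < Num.min (d / 2) 2^-1 by rewrite lt_min divr_gt0//= invr_gt0.
  exists (Num.min (d / 2) 2^-1); first by rewrite m0 ge_min lexx orbT.
  have := Hd (Num.min (d / 2) 2^-1); rewrite /= !sub0r !normrN => H.
  rewrite Rintegral_itv_obnd_cbnd; last first.
    apply: integrableS ih => // t; rewrite /= !in_itv/= => /andP[/ltW -> td].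
    by apply: le_trans td _; rewrite ge_min; apply/orP; right; lra.
  apply: le_trans (H _); first exact: ler_norm.
  by rewrite gtr0_norm// gt_min; apply/orP; left; lra.
exists d; first by rewrite d0.
move=> A f A0 cf fle.
have cr : continuous (fun t => normc (f t)).
  by move=> t; exact: (cvg_Re (cvg_normc (cf t))).
apply: le_trans (Int_dominated (ltW d0) cf cr (fun s _ => lexx _)) _.
have [P dP] := real_primitive cr.
have cc : continuous (fun t => (normc (f t))%:C) by move=> t; exact: (cvg_RC (cr t)).
rewrite (Int_primitive 0 d cc dP) -rcB /=.
have ir : mu.-integrable (`[0, d]%classic : set R) (EFin \o (fun t => normc (f t))).
  by apply: continuous_compact_integrable; [exact: segment_compact|exact: continuous_subspaceT].
have dP' s := (rderiv_realE P s (normc (f s))).1 (dP s).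
have FTC : (\int[mu]_(t in (`[0%R, d]%classic : set R)) (normc (f t))%:E)%E = ((P d)%:E - (P 0)%:E)%E.
  apply: (@continuous_FTC2 R (fun t => normc (f t)) P 0 d d0).
  - exact: continuous_subspaceT.
  - split.
    + by move=> t _; have [] := dP' t.
    + by apply: cvg_at_right_filter; apply: differentiable_continuous; apply/derivable1_diffP; have [] := dP' 0.
    + by apply: cvg_at_left_filter; apply: differentiable_continuous; apply/derivable1_diffP; have [] := dP' d.
  - by move=> t _; rewrite derive1E; have [] := dP' t.
have io : mu.-integrable (`]0, d]%classic : set R) (EFin \o (fun t => normc (f t))).
  by apply: integrableS ir => // t; rewrite /= !in_itv/= => /andP[/ltW -> ->].
have ihd : mu.-integrable (`]0, d]%classic : set R) (EFin \o (fun t => w t / t)).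
  apply: integrableS ih => // t; rewrite /= !in_itv/= => /andP[/ltW -> td].
  by apply: le_trans td _; lra.
have -> : P d - P 0 = \int[mu]_(t in (`]0, d]%classic : set R)) normc (f t).
  by rewrite Rintegral_itv_obnd_cbnd// /Rintegral FTC.
apply: (@le_trans _ _ (\int[mu]_(t in (`]0, d]%classic : set R)) (A * (w t / t)))).
  apply: le_Rintegral => //.
  have : mu.-integrable (`]0, d]%classic : set R) (fun t => A%:E * (EFin \o (fun t : R => (w t / t)%R)) t)%E by apply: integrableZl.
  by congr (integrable _ _ _); apply/funext => t /=; rewrite EFinM.
by rewrite RintegralZl// ler_wpM2l.
Qed.
End DiniTail.

(** * The Cauchy kernel near the curve: Poisson part and Dini remainder *)

Section KernelDef.
Context {R : realType}.
Local Notation C := R[i].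
Variables g g' : R -> C.

(* Offset from the point at signed height [e] above [g s], in the normal direction [i g' s]. *)
Definition loop_offset (s e t : R) : C := g (s + t) - g s - e%:C * ('i%C * g' s).

Definition cauchy_im (s e t : R) : R := Im ((loop_offset s e t)^-1 * g' (s + t)).

(* What remains of the Cauchy kernel once the Poisson kernel of the tangent line is removed. *)
Definition kernel_remainder (s e t : R) : R := cauchy_im s e t - e / (t ^+ 2 + e ^+ 2).

(** The imaginary part of [g'(u) / (g u - g s)], with the modulus in the denominator kept at least
    [d]: continuous through [u = s], unchanged for points at distance at least [d]. *)
Definition cutoff_kernel (d s u : R) : R :=
  Im (conjc (g u - g s) * g' u) / Num.max (normc (g u - g s)) d ^+ 2.

End KernelDef.

Section Kernel.
Context {R : realType}.
Local Notation C := R[i].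
Variables g g' : R -> C.
Hypothesis L : smooth_loop g g'.
Local Notation omega := (modulus_of_continuity g').
Local Notation off := (loop_offset g g').
Local Notation kern := (cauchy_im g g').
Local Notation rem := (kernel_remainder g g').
Local Notation regk := (cutoff_kernel g g').
Variables c e0 : R.
Hypothesis c_gt0 : 0 < c.
Hypothesis e0_gt0 : 0 < e0.
Hypothesis off_ge : forall s t e, `|t| <= 2^-1 -> `|e| <= e0 -> c * (`|t| + `|e|) <= normc (off s e t).

Let cg : continuous g := curve_continuous L.
Let cg' : continuous g' := loop_cont L.
Let gp := loop_periodic L.

Lemma offset_deviation s e t :
  normc (off s e t - (t%:C - e%:C * 'i%C) * g' s) <= omega `|t| * `|t|.
Proof.
have -> : off s e t - (t%:C - e%:C * 'i%C) * g' s = 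
    g (s + t) - g s - t%:C * g' s + (e%:C * 'i%C * g' s - e%:C * ('i%C * g' s)).
  by rewrite /loop_offset; ring.
by rewrite mulrA subrr addr0; exact: curve_taylor.
Qed.

Lemma poisson_Im (t e : R) : 0 < t ^+ 2 + e ^+ 2 ->
  Im (t%:C - e%:C * 'i%C)^-1 = e / (t ^+ 2 + e ^+ 2).
Proof.
move=> p.
have -> : (t%:C - e%:C * 'i%C)^-1 = ((t ^+ 2 + e ^+ 2)^-1)%:C * (t%:C + e%:C * 'i%C).
  have n0 : t%:C - e%:C * 'i%C != 0.
    apply/eqP => /(congr1 (fun z => normc z ^+ 2)).
    rewrite normc_sqr normc0 expr0n !(cReD, cReN, cImD, cImN, cReM, cImM) /= => h.
    by move: p; rewrite (_ : _ + _ = 0) ?ltxx// -[RHS]h; ring.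
  apply: (mulfI n0); rewrite divff// mulrCA.
  have -> : (t%:C - e%:C * 'i%C) * (t%:C + e%:C * 'i%C) = (t ^+ 2 + e ^+ 2)%:C.
    rewrite rcD !rcX -subr_sqr exprMn.
    have -> : 'i%C ^+ 2 = -1 :> C by rewrite sqr_i.
    by ring.
  by rewrite -rcM mulVf ?gt_eqF.
by rewrite cImM cImD cReD cImM cReM /=; rewrite mulrC; ring.
Qed.

(** With [w = t - i e], whose inverse has the Poisson kernel as imaginary part,
    [g'(s + t) / off - 1 / w] consists of two errors, the variation of [g'] and the deviation of
    [off / w] from [g' s]. Each is at most [omega |t|], divided by [|off| >= c |t|]. *)
Lemma kernel_remainder_le s e t : 0 < `|t| <= 2^-1 -> `|e| <= e0 ->
  `|rem s e t| <= 2 / c * (omega `|t| / `|t|).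
Proof.
move=> /andP[t0 t2] ee.
have ct : c * `|t| <= normc (off s e t).
  apply: le_trans (off_ge s t2 ee); rewrite ler_pM2l// lerDl//.
have on0 : off s e t != 0 by rewrite -normc_gt0 (lt_le_trans _ ct)// mulr_gt0.
pose w : C := t%:C - e%:C * 'i%C.
have wt : `|t| <= normc w.
  by apply: le_trans (normc_Re _); rewrite cReD cReN cReM /= mulr0 mul0r !subr0.
have w0 : w != 0 by rewrite -normc_gt0 (lt_le_trans t0).
have te : 0 < t ^+ 2 + e ^+ 2.
  by rewrite ltr_wpDr ?sqr_ge0// -real_normK ?num_real// exprn_gt0.
have -> : rem s e t = Im ((off s e t)^-1 * (g' (s + t) - g' s) - (off s e t)^-1 * ((off s e t - w * g' s) / w)).
  rewrite /kernel_remainder /cauchy_im -(poisson_Im te) -/w -cImN -cImD; congr (Im _).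
  by field; rewrite w0 on0.
apply: le_trans (normc_Im _) _; apply: le_trans (normcB _ _) _.
rewrite !normcM !normcV.
have om := modulus_ge0 L (normr_ge0 t).
have A : (normc (off s e t))^-1 <= (c * `|t|)^-1.
  by rewrite lef_pV2 ?posrE ?normc_gt0// mulr_gt0.
have B : normc (g' (s + t) - g' s) <= omega `|t|.
  by apply: (modulus_ge L); rewrite addrAC subrr add0r.
have B2 : normc (off s e t - w * g' s) / normc w <= omega `|t|.
  rewrite ler_pdivrMr; last by apply: lt_le_trans wt.
  by apply: le_trans (offset_deviation s e t) _; rewrite ler_wpM2l.
apply: (@le_trans _ _ ((c * `|t|)^-1 * omega `|t| + (c * `|t|)^-1 * omega `|t|)).
  apply: lerD; apply: ler_pM => //; rewrite ?invr_ge0 ?normc_ge0//.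
  by rewrite divr_ge0 ?normc_ge0.
rewrite le_eqVlt; apply/orP; left; apply/eqP; field.
by rewrite !gt_eqF.
Qed.

Lemma cutoff_kernel_le d s t : `|regk d s (s + t)| <= `|kern s 0 t|.
Proof.
rewrite /cutoff_kernel /cauchy_im /loop_offset mul0r subr0.
set D := g (s + t) - g s.
have [->|D0] := eqVneq D 0.
  by rewrite conjcR mul0r /= mul0r normr0.
have nD : 0 < normc D by rewrite normc_gt0.
have -> : conjc D * g' (s + t) = (normc D ^+ 2)%:C * (D^-1 * g' (s + t)).
  by rewrite -mulzJ; field.
rewrite [X in `|X / _|]cImM mul0r addr0 normrM [`|(_ * _)|]normrM normfV.
rewrite mulrAC ler_piMl// ?normr_ge0//= ler_pdivrMr; last first.
  by rewrite normr_gt0 expf_neq0// gt_eqF// lt_max nD.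
rewrite mul1r !normrX; apply: lerXn2r; rewrite ?nnegrE//.
have nm : normc D <= Num.max (normc D) d by rewrite le_max lexx.
by rewrite !ger0_norm ?normc_ge0// (le_trans (normc_ge0 _) nm).
Qed.

Lemma cutoff_kernelE d s t : d <= normc (off s 0 t) -> off s 0 t != 0 -> regk d s (s + t) = kern s 0 t.
Proof.
rewrite /cutoff_kernel /cauchy_im /loop_offset mul0r subr0.
set D := g (s + t) - g s => dD D0.
have nD : 0 < normc D by rewrite normc_gt0.
have -> : conjc D * g' (s + t) = (normc D ^+ 2)%:C * (D^-1 * g' (s + t)).
  by rewrite -mulzJ; field.
by rewrite [X in X / _]cImM mul0r addr0 max_l//=; field; rewrite gt_eqF.
Qed.

Lemma offset_neq0 s e t : 0 < `|e| -> `|e| <= e0 -> off s e t != 0.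
Proof.
move=> e_gt0 ee; have [m /andP[m0 m1]] := period_reduce (t + 2^-1).
have -> : off s e t = off s e (t - m%:~R).
  rewrite /loop_offset -[in LHS](subrK m%:~R t) [in LHS]addrA.
  by rewrite periodic_int.
rewrite -normc_gt0; apply: lt_le_trans (off_ge _ _ ee); last first.
  by rewrite ler_norml; apply/andP; split; lra.
by rewrite mulr_gt0// ltr_wpDl.
Qed.

Lemma continuous_shift (h : R -> C) s : continuous h -> continuous (fun t => h (s + t)).
Proof.
move=> ch t; apply: (@continuous_comp _ _ _ (fun t : R => s + t) h); last exact: ch.
by apply: cvgD; [exact: cvg_cst|exact: cvg_id].
Qed.

Lemma continuous_offset s e : continuous (off s e).
Proof.
rewrite /loop_offset => t; apply: cvgB; last exact: cvg_cst.
by apply: cvgB; [exact: (@continuous_shift g s cg t)|exact: cvg_cst].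
Qed.

Lemma continuous_poisson e : e != 0 -> continuous (fun t : R => (e / (t ^+ 2 + e ^+ 2))%:C).
Proof.
move=> ene0 t; apply: cvg_RC; apply: cvgM; first exact: cvg_cst.
apply: cvgV; last by apply: cvgD; [exact: exprn_continuous|exact: cvg_cst].
by rewrite gt_eqF// ltr_wpDl ?sqr_ge0// exprn_even_gt0.
Qed.

Lemma continuous_kernel_remainder s e : 0 < `|e| <= e0 -> continuous (fun t => (rem s e t)%:C).
Proof.
move=> /andP[ep ee].
have -> : (fun t => (rem s e t)%:C) = (fun t => (kern s e t)%:C - (e / (t ^+ 2 + e ^+ 2))%:C).
  by apply/funext => t; rewrite rcB.
have co : continuous (fun t => (off s e t)^-1 * g' (s + t)).
  move=> t; apply: cvgM; last exact: (@continuous_shift g' s cg' t).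
  by apply: cvgV; [exact: offset_neq0|exact: continuous_offset].
have en0 : e != 0 by rewrite -normr_gt0.
move=> t; exact: (cvgB (cvg_RC (cvg_Im (co t))) (@continuous_poisson e en0 t)).
Qed.

Lemma continuous_cutoff_kernel d s : 0 < d -> continuous (fun u => (regk d s u)%:C).
Proof.
move=> d0 u; rewrite /cutoff_kernel.
have c1 : continuous (fun u => g u - g s).
  by move=> t; apply: cvgB; [exact: cg|exact: cvg_cst].
have c2 : continuous (fun u => conjc (g u - g s) * g' u).
  by move=> t; apply: cvgM; [exact: (cvg_conjc (c1 t))|exact: cg'].
have c3 : continuous (fun u => Num.max (normc (g u - g s)) d).
  move=> t; apply: (@continuous_max _ _ (fun u => normc (g u - g s)) (fun=> d)).
    exact: (cvg_Re (cvg_normc (c1 t))).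
  exact: cvg_cst.
apply: (@cvg_RC _ _ _ _ (fun u => Im (conjc (g u - g s) * g' u) / Num.max (normc (g u - g s)) d ^+ 2)).
apply: cvgM; first exact: (cvg_Im (c2 u)).
apply: cvgV; first by rewrite expf_neq0// gt_eqF// lt_max d0 orbT.
by apply: cvgM; exact: c3.
Qed.

(** For [|t| >= d] all offsets have modulus at least [c d], so the cutoff at [c d] is inactive and
    lowering the height from [e] to 0 costs [O(|e| / d^2)]; the subtracted Poisson kernel is itself
    at most [|e| / d^2]. *)
Lemma kernel_remainder_far : exists2 B : R, 0 < B & forall s t e d, 0 < d -> d <= `|t| -> `|t| <= 2^-1 ->
  0 < `|e| <= e0 -> `|rem s e t - regk (c * d) s (s + t)| <= B / d ^+ 2 * `|e|.
Proof.
have [M M0 HM] := periodic_bounded cg' (curve_deriv_periodic L).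
exists (M ^+ 2 / c ^+ 2 + 1); first by rewrite ltr_wpDl// divr_ge0 ?sqr_ge0.
move=> s t e d d0 dt t2 /andP[ep ee].
have off_far e' : `|e'| <= e0 -> c * d <= normc (off s e' t).
  move=> e'0; apply: le_trans (off_ge s t2 e'0); rewrite ler_pM2l//.
  by apply: le_trans dt _; rewrite lerDl.
have f0 := off_far 0; rewrite normr0 in f0; have {}f0 := f0 (ltW e0_gt0).
have fe := off_far e ee.
have cd : 0 < c * d by rewrite mulr_gt0.
have n0 : off s 0 t != 0 by rewrite -normc_gt0 (lt_le_trans cd).
have ne : off s e t != 0 by rewrite -normc_gt0 (lt_le_trans cd).
rewrite cutoff_kernelE//.
have -> : rem s e t - kern s 0 t = 
    Im (e%:C * ('i%C * g' s) * g' (s + t) / (off s e t * off s 0 t)) - e / (t ^+ 2 + e ^+ 2).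
  rewrite /kernel_remainder /cauchy_im addrAC -cImN -cImD; congr (Im _ - _).
  have -> : e%:C * ('i%C * g' s) = off s 0 t - off s e t.
    by rewrite /loop_offset mul0r; ring.
  by field; rewrite n0 ne.
apply: le_trans (ler_normB _ _) _.
have -> : (M ^+ 2 / c ^+ 2 + 1) / d ^+ 2 * `|e| = M ^+ 2 / c ^+ 2 / d ^+ 2 * `|e| + `|e| * (d ^+ 2)^-1.
  by ring.
apply: lerD.
  apply: le_trans (normc_Im _) _.
  rewrite normcM normcV !normcM normcR normci mul1r.
  apply: (@le_trans _ _ (`|e| * (M * M) / (c * d * (c * d)))).
    apply: ler_pM; rewrite ?invr_ge0 ?mulr_ge0 ?normc_ge0//.
      by rewrite -mulrA ler_wpM2l// ler_pM ?normc_ge0.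
    rewrite lef_pV2 ?posrE ?mulr_gt0 ?normc_gt0//.
    by apply: ler_pM => //; exact: ltW.
  by rewrite le_eqVlt; apply/orP; left; apply/eqP; field; rewrite !gt_eqF.
rewrite normrM normfV ler_wpM2l//.
have d2 : 0 < d ^+ 2 by rewrite exprn_gt0.
have h : d ^+ 2 <= t ^+ 2 + e ^+ 2.
  rewrite -(real_normK (num_real t)); apply: le_trans (_ : `|t| ^+ 2 <= _).
    by rewrite ler_pXn2r ?nnegrE// ltW.
  by rewrite lerDl sqr_ge0.
by rewrite lef_pV2 ?posrE// gtr0_norm// (lt_le_trans d2).
Qed.

(** The order of choices matters: [d] comes from the Dini tail and controls [|t| <= d] for all
    heights at once; only then is the height made small, to control [d <= |t| <= 1/2]. *)
Lemma kernel_estimate (eta : R) :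
  (\int[lebesgue_measure]_(t in `]0%R, 1%R]) (omega t / t)%:E < +oo)%E -> 0 < eta ->
  exists2 d, 0 < d & exists2 e1, 0 < e1 <= e0 & forall s e (F : R -> C),
    0 < `|e| <= e1 -> continuous F -> (forall t, normc (F t) <= 1) ->
    normc (Int (fun t => F t * (rem s e t)%:C) (- 2^-1) 2^-1 -
           Int (fun t => F t * (regk d s (s + t))%:C) (- 2^-1) 2^-1) <= eta.
Proof.
move=> dini eta0.
(* Remainder and cut-off kernel are each at most [2 / c * (omega |t| / |t|)], so each half of
   [[-d, d]] costs [4 / c * (eta * c / 16) = eta / 4]; the far part costs at most [eta / 2]. *)
have eta'0 : 0 < eta * c / 16 by rewrite divr_gt0// mulr_gt0.
have [d /andP[d0 d2] Hd] := dini_tail (modulus_ge0 L) (modulus_mono L) dini eta'0.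
have [B B0 HB] := kernel_remainder_far.
have q0 : 0 < eta * d ^+ 2 / (2 * B) by rewrite divr_gt0 ?mulr_gt0// exprn_gt0.
exists (c * d); first by rewrite mulr_gt0.
exists (Num.min e0 (eta * d ^+ 2 / (2 * B))); first by rewrite lt_min e0_gt0 q0 ge_min lexx.
move=> s e F /andP[ep]; rewrite le_min => /andP[ee eq] cF F1.
have crem := @continuous_kernel_remainder s e (introT andP (conj ep ee)).
have cd0 : 0 < c * d by rewrite mulr_gt0.
have creg : continuous (fun t => (regk (c * d) s (s + t))%:C).
  exact: (@continuous_shift (fun u => (regk (c * d) s u)%:C) s (@continuous_cutoff_kernel (c * d) s cd0)).
pose A t := F t * (rem s e t)%:C - F t * (regk (c * d) s (s + t))%:C.
have cA1 : continuous (fun t => F t * (rem s e t)%:C).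
  by move=> t; apply: cvgM; [exact: cF|exact: crem].
have cA2 : continuous (fun t => F t * (regk (c * d) s (s + t))%:C).
  by move=> t; apply: cvgM; [exact: cF|exact: creg].
have cA : continuous A by move=> t; apply: cvgB; [exact: cA1|exact: cA2].
rewrite -(IntB (- 2^-1) 2^-1 cA1 cA2) -/A.
have Ale t : normc (A t) <= `|rem s e t - regk (c * d) s (s + t)|.
  rewrite /A -mulrBr normcM -rcB normcR ler_piMl//.
have near0 t : 0 < `|t| <= d -> normc (A t) <= 4 / c * (omega `|t| / `|t|).
  move=> /andP[t0 td]; have t2 : 0 < `|t| <= 2^-1 by rewrite t0 (le_trans td).
  apply: le_trans (Ale t) _; apply: le_trans (ler_normB _ _) _.
  have k1 := kernel_remainder_le s t2 ee.
  (* At height 0 the Poisson term is 0, so the remainder bound holds for the full kernel, which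
     dominates its cut-off version. *)
  have z0 : `|0 : R| <= e0 by rewrite normr0 ltW.
  have k2 := kernel_remainder_le s t2 z0.
  rewrite /kernel_remainder mul0r subr0 in k2.
  have k3 := le_trans (cutoff_kernel_le (c * d) s t) k2.
  apply: le_trans (lerD k1 k3) _.
  by rewrite le_eqVlt; apply/orP; left; apply/eqP; ring.
have far t : d <= `|t| -> `|t| <= 2^-1 -> normc (A t) <= eta / 2.
  move=> dt t2; apply: le_trans (Ale t) _.
  apply: le_trans (HB s t e d d0 dt t2 (introT andP (conj ep ee))) _.
  apply: le_trans (_ : B / d ^+ 2 * (eta * d ^+ 2 / (2 * B)) <= _).
    by rewrite ler_wpM2l// divr_ge0 ?sqr_ge0// ltW.
  by rewrite le_eqVlt; apply/orP; left; apply/eqP; field; rewrite !gt_eqF.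
have A40 : 0 <= 4 / c by rewrite divr_ge0// ltW.
have i1 : normc (Int A 0 d) <= 4 / c * (eta * c / 16).
  apply: Hd => // t /andP[t0 td].
  by have := near0 t; rewrite gtr0_norm// t0 td => /(_ isT).
have i2 : normc (Int A (- d) 0) <= 4 / c * (eta * c / 16).
  have E := Int_affine (-1) 0 0 d cA.
  rewrite mulr0 addr0 mulN1r addr0 in E.
  set A' := (fun t => _) in E.
  have cA' : continuous A'.
    have ct : continuous (fun t : R => -1 * t + 0).
      move=> u; apply: cvgD; last exact: cvg_cst.
      by apply: cvgM; [exact: cvg_cst|exact: cvg_id].
    have cc := fun u => @continuous_comp _ _ _ (fun t : R => -1 * t + 0) A u (ct u) (cA _).
    by move=> u; apply: cvgM; [exact: cvg_cst|exact: cc].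
  have -> : Int A (- d) 0 = - Int A' 0 d by rewrite E -Int_swap.
  rewrite normcN; apply: (Hd _ A' A40 cA') => t /andP[t0 td].
  rewrite /A' normcM normcR normrN normr1 mul1r mulN1r addr0.
  by have := near0 (- t); rewrite normrN gtr0_norm// t0 td => /(_ isT).
have i3 : normc (Int A (- 2^-1) (- d)) <= eta / 2 * (- d - - 2^-1).
  apply: Int_bound => //; first by lra.
  move=> t /andP[ta tb]; apply: far; first by rewrite ler0_norm; lra.
  by rewrite ler0_norm; lra.
have i4 : normc (Int A d 2^-1) <= eta / 2 * (2^-1 - d).
  apply: Int_bound => //.
  move=> t /andP[ta tb]; apply: far; first by rewrite ger0_norm; lra.
  by rewrite ger0_norm; lra.
have cc : 4 / c * (eta * c / 16) = eta / 4 by field; rewrite gt_eqF.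
rewrite cc in i1 i2.
rewrite -(Int_chasles A _ (- d)) -(Int_chasles A (- d) 0) -(Int_chasles A 0 d).
apply: le_trans (normcD _ _) _; apply: le_trans (lerD i3 (normcD _ _)) _.
have j : normc (Int A 0 d + Int A d 2^-1) <= eta / 4 + eta / 2 * (2^-1 - d).
  by apply: le_trans (normcD _ _) _; exact: lerD.
apply: le_trans (lerD (lexx _) (lerD i2 j)) _.
have : 0 <= eta * d by rewrite mulr_ge0 ?ltW.
by nra.
Qed.

End Kernel.

(** * Boundary values *)

Section Poisson.
Context {R : realType}.
Local Notation C := R[i].

Lemma rderiv_atan (e t : R) : 0 < e ->
  rderiv (fun t => (atan (t / e))%:C) t (e / (t ^+ 2 + e ^+ 2))%:C.
Proof.
move=> e0; apply/rderiv_realE.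
have D1 : is_derive t 1 (fun t : R => t / e) e^-1.
  have -> : (fun t : R => t / e) = (fun t : R => e^-1 *: t).
    by apply/funext => u; rewrite mulrC.
  by rewrite -[X in is_derive _ _ _ X]mulr1; apply: is_deriveZ.
have := @is_derive1_comp R atan (fun t => t / e) t _ _ (is_derive1_atan (t / e)) D1.
rewrite (_ : _ * _ = e / (t ^+ 2 + e ^+ 2))//.
have p : 0 < t ^+ 2 + e ^+ 2 by rewrite ltr_wpDl ?sqr_ge0// exprn_gt0.
have q : t ^+ 2 + e ^+ 2 != 0 by rewrite gt_eqF.
rewrite expr_div_n.
have -> : 1 + t ^+ 2 / e ^+ 2 = (t ^+ 2 + e ^+ 2) / e ^+ 2 by field; rewrite gt_eqF.
by field; rewrite q gt_eqF.
Qed.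

Lemma poisson_mass (e : R) : 0 < e ->
  Int (fun t : R => (e / (t ^+ 2 + e ^+ 2))%:C) (- 2^-1) 2^-1 = (2 * atan (2^-1 / e))%:C.
Proof.
move=> e0; have ene : e != 0 by rewrite gt_eqF.
rewrite (@Int_primitive _ _ (fun t => (atan (t / e))%:C)); last first.
- by move=> s; exact: rderiv_atan.
- exact: (@continuous_poisson R e ene).
by rewrite -rcB mulNr atanN opprK -mulr2n mulr_natl.
Qed.

(** The Poisson kernel is an approximate identity of mass [2 atan (1 / (2 e))], which tends to [pi].
    Three errors of [xi / 3] come from [|t| < dl], from [|t| >= dl] and from the missing mass. *)
Lemma poisson_limit (F : R -> C) (xi : R) : continuous F -> (forall t, normc (F t) <= 1) ->
  0 < xi -> exists2 e1, 0 < e1 & forall e, 0 < e <= e1 ->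
  normc (Int (fun t => F t * (e / (t ^+ 2 + e ^+ 2))%:C) (- 2^-1) 2^-1 - pi%:C * F 0) <= xi.
Proof.
move=> cF F1 xi0.
have pi0 : 0 < pi :> R by exact: pi_gt0.
pose x1 := xi / (3 * pi).
have x10 : 0 < x1 by rewrite divr_gt0// mulr_gt0.
have [dl dl0 Hd] := (rcontP F 0).1 (cF 0) _ x10.
have [A [_ HA]] : \forall x \near +oo, `|pi / 2 - atan x| <= xi / 6.
  by have := @cvgy_atan R; move=> /cvgrPdist_le; apply; rewrite divr_gt0.
pose A1 := Num.max A 1.
have A10 : 0 < A1 by rewrite lt_max ltr01 orbT.
have a0 : 0 < (3 * A1)^-1 by rewrite invr_gt0 mulr_gt0.
have b0 : 0 < xi * dl ^+ 2 / 6 by rewrite divr_gt0// mulr_gt0// exprn_gt0.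
(* The first entry makes [1 / (2 e)] exceed [A], beyond which [atan] is within [xi / 6] of [pi / 2];
   the second makes [e / dl^2] at most [xi / 6]. *)
exists (Num.min (3 * A1)^-1 (xi * dl ^+ 2 / 6)); first by rewrite lt_min a0 b0.
move=> e /andP[e0]; rewrite le_min => /andP[ea eb].
have ene : e != 0 by rewrite gt_eqF.
have cp := @continuous_poisson R e ene.
pose p t : R := e / (t ^+ 2 + e ^+ 2).
have cG : continuous (fun t => F t * (p t)%:C).
  by move=> t; apply: cvgM; [exact: cF|exact: cp].
have cH : continuous (fun t => F 0 * (p t)%:C).
  by move=> t; apply: cvgM; [exact: cvg_cst|exact: cp].
have cGH : continuous (fun t => F t * (p t)%:C - F 0 * (p t)%:C).
  by move=> t; apply: cvgB; [exact: cG|exact: cH].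
have cpr : continuous p by move=> t; exact: (cvg_Re (cp t)).
pose h t := x1 * p t + 2 * (e / dl ^+ 2).
have chR : continuous h.
  by move=> t; apply: cvgD; [apply: cvgM; [exact: cvg_cst|exact: cpr]|exact: cvg_cst].
have p0 t : 0 < t ^+ 2 + e ^+ 2 by rewrite ltr_wpDl ?sqr_ge0// exprn_gt0.
have pp t : 0 <= p t by rewrite divr_ge0 ?ltW.
have dom t : normc (F t * (p t)%:C - F 0 * (p t)%:C) <= h t.
  rewrite -mulrBl normcM normcR ger0_norm//.
  have q0 : 0 <= e / dl ^+ 2 by rewrite divr_ge0 ?sqr_ge0 ?ltW.
  have [lt|le] := ltP `|t| dl.
    apply: le_trans (_ : x1 * p t <= _); last by rewrite lerDl mulr_ge0.
    by rewrite ler_wpM2r//; apply/ltW/Hd; rewrite subr0.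
  apply: le_trans (_ : 2 * (e / dl ^+ 2) <= _); last by rewrite lerDr mulr_ge0// ltW.
  apply: ler_pM; rewrite ?normc_ge0//.
    by apply: le_trans (normcB _ _) _; have := F1 t; have := F1 0; lra.
  rewrite ler_wpM2l ?(ltW e0)// lef_pV2 ?posrE ?exprn_gt0//.
  rewrite -(real_normK (num_real t)); apply: le_trans (_ : `|t| ^+ 2 <= _).
    by rewrite ler_pXn2r ?nnegrE// ltW.
  by rewrite lerDl sqr_ge0.
have E1 : Int (fun t => F t * (p t)%:C) (- 2^-1) 2^-1 - pi%:C * F 0 =
    Int (fun t => F t * (p t)%:C - F 0 * (p t)%:C) (- 2^-1) 2^-1 +
    (2 * atan (2^-1 / e) - pi)%:C * F 0.
  rewrite (IntB _ _ cG cH) (IntZ (F 0) _ _ cp) poisson_mass// rcB.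
  by ring.
rewrite E1; apply: le_trans (normcD _ _) _.
have lo : - 2^-1 <= 2^-1 :> R by lra.
have I1 := Int_dominated lo cGH chR (fun s _ => dom s).
have Eh : (fun t => (h t)%:C) = (fun t => x1%:C * (p t)%:C + (2 * (e / dl ^+ 2))%:C).
  by apply/funext => t; rewrite rcD rcM.
have c3 : continuous (fun t => x1%:C * (p t)%:C).
  by move=> t; apply: cvgM; [exact: cvg_cst|exact: cp].
have c4 : continuous (fun t : R => (2 * (e / dl ^+ 2))%:C) by move=> t; exact: cvg_cst.
rewrite Eh (IntD (- 2^-1) 2^-1 c3 c4) (IntZ x1%:C (- 2^-1) 2^-1 cp) poisson_mass// Int_cst -!rcM -rcD cReR in I1.
have ple := atan_ltpi2 (2^-1 / e).
have I2 : x1 * (2 * atan (2^-1 / e)) <= xi / 3.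
  apply: le_trans (_ : x1 * pi <= _); first by rewrite ler_wpM2l ?ltW//; lra.
  by rewrite /x1 invfM mulrA mulfVK ?gt_eqF.
have I3 : e / dl ^+ 2 <= xi / 6.
  by rewrite ler_pdivrMr ?exprn_gt0//; apply: le_trans eb _; rewrite mulrAC.
have I4 : normc ((2 * atan (2^-1 / e) - pi)%:C * F 0) <= xi / 3.
  rewrite normcM normcR -[leRHS]mulr1; apply: ler_pM; rewrite ?normc_ge0//.
  have Ae : A < 2^-1 / e.
    apply: le_lt_trans (_ : A1 < _); first by rewrite le_max lexx.
    rewrite ltr_pdivlMr//; apply: le_lt_trans (_ : A1 * (3 * A1)^-1 < _).
      by rewrite ler_wpM2l// ltW.
    by rewrite invfM mulrCA mulfV ?gt_eqF// mulr1; lra.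
  have := HA _ Ae; rewrite !ler_norml => /andP[u v]; apply/andP; split; lra.
apply: le_trans (lerD I1 I4) _.
move: I2 I3; set X := x1 * _; set Y := e / _ => I2 I3; lra.
Qed.

End Poisson.

Section FaberBoundary.
Context {R : realType}.
Local Notation C := R[i].
Variables (g g' : R -> C) (phi psi : C -> C) (b : C).
Hypothesis S : exterior_setting g g' phi psi b.
Hypothesis dini :
  (\int[lebesgue_measure]_(t in `]0%R, 1%R]) (modulus_of_continuity g' t / t)%:E < +oo)%E.
Let L := set_loop S.
Let E := set_pair S.
Local Notation D := (exterior (range g)).
Local Notation DG := (exterior (range g) `|` range g).
Local Notation cont_ext := (cont_ext g).
Local Notation K := (loop_const g g' phi b).

Let cg : continuous g := curve_continuous L.
Let gp := loop_periodic L.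
Let gDG s : DG (g s). Proof. by right; exists s. Qed.

Lemma continuous_loop_phiX n : continuous (fun u => phi (g u) ^+ n).
Proof.
have cphi : cont_ext phi := @cont_ext_phi _ _ _ _ _ _ S.
exact: (cont_ext_path (cont_extX (n := n) cphi) cg gDG).
Qed.

Lemma Int_recenter (h : R -> C) s : continuous h -> (forall u, h (u + 1) = h u) ->
  Int h 0 1 = Int (fun t => h (s + t)) (- 2^-1) 2^-1.
Proof.
move=> ch hp.
have -> : (fun t => h (s + t)) = (fun t => 1%:C * h (1 * t + s)).
  by apply/funext => t; rewrite !mul1r addrC.
rewrite Int_affine// !mul1r -[X in Int h X 1](addr0) -[1 in LHS]add0r.
rewrite addr0 (Int_periodic 0 (- 2^-1 + s) ch hp); congr (Int _ _ _).
by lra.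
Qed.

Lemma cauchy_im_int n s z (e : R) : D z -> z = g s + e%:C * ('i%C * g' s) ->
  Int (fun u => phi (g u) ^+ n * (Im ((g u - z)^-1 * g' u))%:C) 0 1 =
  Int (fun t => phi (g (s + t)) ^+ n * (cauchy_im g g' s e t)%:C) (- 2^-1) 2^-1.
Proof.
move=> Dz ze; rewrite (@Int_recenter _ s).
- congr (Int _ _ _); apply/funext => t; rewrite /cauchy_im /loop_offset.
  by rewrite ze opprD addrA.
- move=> u; apply: cvgM; first exact: continuous_loop_phiX.
  exact: (cvg_RC (cvg_Im (@continuous_winding_kernel _ _ _ _ _ _ S z Dz u))).
- by move=> u; rewrite gp (curve_deriv_periodic L).
Qed.

(** [faber_identity] is taken at signed height [sigma e] over [g s]. Its left side extends
    continuously to the curve, where [conj (phi^-n) = phi^n]; its right side is close to the Poisson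
    limit [sigma pi phi^n] plus the cut-off integral. *)
Lemma faber_boundary : exists sigma : R, `|sigma| = 1 /\ forall eta, 0 < eta ->
  exists2 d, 0 < d & forall n (p : {poly C}) s, (0 < n)%N -> is_faber_polynomial phi n p ->
  normc (K * (p.[g s] - phi (g s) ^+ n) + conjc K * phi (g s) ^+ n -
    2 * 'i%C * ((sigma * pi)%:C * phi (g s) ^+ n +
      Int (fun u => phi (g u) ^+ n * (cutoff_kernel g g' d s u)%:C) 0 1)) <= eta.
Proof.
have [sg [c [e0 [eta0 [[sg1 c0 e00 eta00] H1 H2]]]]] := exterior_side S.
exists sg; split=> // eta eta_gt0.
have off_ge s t e : `|t| <= 2^-1 -> `|e| <= e0 -> c * (`|t| + `|e|) <= normc (loop_offset g g' s e t).
  by move=> t2 ee; apply: H1 => //; rewrite subrr normc0 ltW.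
have eta4 : 0 < eta / 4 by rewrite divr_gt0.
have eta8 : 0 < eta / 8 by rewrite divr_gt0.
have [d d0 [e1 /andP[e10 e1e0] Hd]] := kernel_estimate L c0 e00 off_ge dini eta4.
exists d => // n p s n0 pF.
pose F t := phi (g (s + t)) ^+ n.
have cF : continuous F := @continuous_shift R (fun u => phi (g u) ^+ n) s (@continuous_loop_phiX n).
have Fn u : normc (phi (g u) ^+ n) = 1.
  by rewrite normcX (phi_G E) ?expr1n//; exists u.
have F1 t : normc (F t) <= 1 by rewrite /F Fn.
have [e2 e20 He2] := poisson_limit cF F1 eta8.
pose X z := K * (p.[z] - phi z ^+ n) + conjc K * conjc ((phi z)^-1 ^+ n).
have cX : cont_ext X.
  have cp : cont_ext (fun t => p.[t]) := cont_ext_cderiv (cderiv_horner p).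
  have cphi : cont_ext phi := @cont_ext_phi _ _ _ _ _ _ S.
  have c1 : cont_ext (fun z => phi z ^+ n) := cont_extX (n := n) cphi.
  have c2 : cont_ext (fun z => (phi z)^-1 ^+ n).
    exact: (cont_extX (n := n) (@cont_ext_phiV _ _ _ _ _ _ S)).
  move=> z Dz; apply: cvgD; first by apply: cvgM; [exact: cvg_cst|apply: cvgB; [exact: cp|exact: c1]].
  apply: cvgM; first exact: cvg_cst.
  exact: (cvg_conjc (c2 z Dz)).
have [r r0 Hr] := (ccontP _ _ _).1 (cX _ (gDG s)) _ eta4.
have w0 : 0 < normc (g' s) by rewrite normc_gt0 (loop_neq0 L).
(* The height may depend on [n], [p] and [s]; only the cutoff [d], fixed before them, has to be
   uniform. *)
pose e := Num.min e1 (Num.min e2 (r / (2 * normc (g' s)))).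
have q0 : 0 < r / (2 * normc (g' s)) by rewrite divr_gt0// mulr_gt0.
have ep : 0 < e by rewrite !lt_min e10 e20 q0.
have ee1 : e <= e1 by rewrite /e ge_min lexx.
have ee2 : e <= e2 by rewrite /e !ge_min lexx orbT.
have ee3 : e <= r / (2 * normc (g' s)) by rewrite /e !ge_min lexx !orbT.
pose z := g s + (sg * e)%:C * ('i%C * g' s).
have Dz : D z.
  by apply: H2 => //; [exact: le_trans ee1 e1e0|rewrite subrr normc0 ltW].
have ae : `|sg * e| = e by rewrite normrM sg1 mul1r gtr0_norm.
have Xz : normc (X z - X (g s)) < eta / 4.
  apply: Hr; first by left.
  rewrite /z addrC addKr normcM normcR ae normcM normci mul1r.
  apply: le_lt_trans (_ : r / 2 < _); last by lra.
  apply: le_trans (_ : r / (2 * normc (g' s)) * normc (g' s) <= _).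
    by rewrite ler_wpM2r// normc_ge0.
  by rewrite invfM mulrA mulfVK ?gt_eqF.
have XE : X z = 2 * 'i%C * Int (fun t => F t * (cauchy_im g g' s (sg * e) t)%:C) (- 2^-1) 2^-1.
  by rewrite /X (faber_identity S n0 pF Dz) (@cauchy_im_int n s z _ Dz (erefl _)).
have Xs : X (g s) = K * (p.[g s] - phi (g s) ^+ n) + conjc K * phi (g s) ^+ n.
  rewrite /X exprVn -(normc_inv_conj (_ : normc (phi (g s) ^- n) = 1)) ?invrK//.
  by rewrite normcV Fn invr1.
rewrite -Xs.
have sge : 0 < `|sg * e| <= e1 by rewrite ae ep.
have sge0 : 0 < `|sg * e| <= e0 by rewrite ae ep (le_trans ee1).
have crem := @continuous_kernel_remainder R g g' L c e0 c0 off_ge s (sg * e) sge0.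
pose J := Int (fun u => phi (g u) ^+ n * (cutoff_kernel g g' d s u)%:C) 0 1.
have JE : J = Int (fun t => F t * (cutoff_kernel g g' d s (s + t))%:C) (- 2^-1) 2^-1.
  have cJ : continuous (fun u => phi (g u) ^+ n * (cutoff_kernel g g' d s u)%:C).
    move=> u; apply: cvgM; first exact: continuous_loop_phiX.
    exact: (@continuous_cutoff_kernel R g g' L d s d0).
  have pJ u : phi (g (u + 1)) ^+ n * (cutoff_kernel g g' d s (u + 1))%:C =
      phi (g u) ^+ n * (cutoff_kernel g g' d s u)%:C.
    by rewrite /cutoff_kernel !gp (curve_deriv_periodic L).
  exact: (Int_recenter s cJ pJ).
have A1 := Hd s (sg * e) F sge cF F1; rewrite -JE in A1.
have A2 := He2 e (introT andP (conj ep ee2)).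
have ene : e != 0 by rewrite gt_eqF.
have cpo := @continuous_poisson R e ene.
(* Hence the Poisson kernel at height [sg * e] is [sg] times the one at height [e]. *)
have sg2 : sg ^+ 2 = 1 by rewrite -real_normK ?num_real// sg1 expr1n.
have Isplit : Int (fun t => F t * (cauchy_im g g' s (sg * e) t)%:C) (- 2^-1) 2^-1 =
    Int (fun t => F t * (kernel_remainder g g' s (sg * e) t)%:C) (- 2^-1) 2^-1 +
    sg%:C * Int (fun t => F t * (e / (t ^+ 2 + e ^+ 2))%:C) (- 2^-1) 2^-1.
  have k1 : continuous (fun t => F t * (kernel_remainder g g' s (sg * e) t)%:C).
    by move=> t; apply: cvgM; [exact: cF|exact: crem].
  have k2 : continuous (fun t => F t * (e / (t ^+ 2 + e ^+ 2))%:C).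
    by move=> t; apply: cvgM; [exact: cF|exact: cpo].
  have k3 : continuous (fun t => sg%:C * (F t * (e / (t ^+ 2 + e ^+ 2))%:C)).
    by move=> t; apply: cvgM; [exact: cvg_cst|exact: k2].
  rewrite -(IntZ sg%:C (- 2^-1) 2^-1 k2) -(IntD (- 2^-1) 2^-1 k1 k3).
  congr (Int _ _ _); apply/funext => t.
  have -> : cauchy_im g g' s (sg * e) t =
      kernel_remainder g g' s (sg * e) t + sg * (e / (t ^+ 2 + e ^+ 2)).
    by rewrite /kernel_remainder exprMn sg2 mul1r; ring.
  by rewrite rcD rcM; ring.
set I1 := Int (fun t => F t * (kernel_remainder _ _ _ _ _)%:C) _ _ in Isplit A1.
set I2 := Int (fun t => F t * (e / _)%:C) _ _ in Isplit A2.
have F0 : F 0 = phi (g s) ^+ n by rewrite /F addr0.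
rewrite F0 in A2.
have -> : X (g s) - 2 * 'i%C * ((sg * pi)%:C * phi (g s) ^+ n + J) =
    - (X z - X (g s)) + 2 * 'i%C * ((I1 - J) + sg%:C * (I2 - pi%:C * phi (g s) ^+ n)).
  by rewrite XE Isplit rcM; ring.
apply: le_trans (normcD _ _) _; rewrite normcN !normcM normci mulr1.
have n2 : normc (2 : C) = 2 by rewrite -[2]/(2%:R) -(rmorph_nat (real_complex R)) normcR ger0_norm.
rewrite n2.
apply: le_trans (lerD (ltW Xz) (ler_wpM2l _ (le_trans (normcD _ _) (lerD A1 (_ : _ <= eta / 8))))) _ => //.
  by rewrite normcM normcR sg1 mul1r.
by lra.
Qed.

End FaberBoundary.

(** * The discrete Landau kernel *)

Section RootsOfUnity.
Context {R : realType}.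
Local Notation C := R[i].

(** ['X^n - 1] splits over the algebraically closed [R[i]] and is separable in characteristic 0, so
    it has [n] distinct roots. *)
Lemma complex_prim_root_exists n : (0 < n)%N -> exists z : C, n.-primitive_root z.
Proof.
pose p : {poly C} := 'X^n - 1; have [r Dp] := closed_field_poly_normal p.
move=> n0; rewrite (monicP _) ?monicXnsubC // scale1r in Dp.
have rn1 : all n.-unity_root r by apply/allP => z; rewrite -root_prod_XsubC -Dp.
have sz_r : (n < (size r).+1)%N.
  by rewrite -(size_prod_XsubC r id) -Dp size_XnsubC.
have [|z] := hasP (cyclic.has_prim_root n0 rn1 _ sz_r); last by exists z.
rewrite -separable.separable_prod_XsubC -Dp cyclotomic.separable_Xn_sub_1//.
by rewrite pnatr_eq0 -lt0n.
Qed.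

Lemma prim_root_normc n (z : C) : n.-primitive_root z -> normc z = 1.
Proof.
move=> pz; have n0 := prim_order_gt0 pz.
apply/eqP; rewrite -(@pexpr_eq1 _ _ n) ?normc_ge0//.
by rewrite -normcX (prim_expr_order pz) normc1.
Qed.

(** On the unit circle [|1 + w|^2] is the Laurent polynomial [w + 2 + 1 / w]. Its N-th power, peaked
    at [w = 1], therefore has degrees between [-N] and [N] and binomial coefficients. *)
Lemma normc1D_sqr (w : C) : normc w = 1 -> (normc (1 + w) ^+ 2)%:C = w^-1 * (1 + w) ^+ 2.
Proof.
move=> w1; have w0 : w != 0 by rewrite -normc_gt0 w1.
have -> : (normc (1 + w) ^+ 2)%:C = (1 + w) * (1 + w^-1).
  rewrite (normc_inv_conj w1) -mulzJ; congr (_ * _).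
  by apply: complex_eq; rewrite ?(cReJ, cImJ, cReD, cImD)/= ?oppr0 ?add0r.
by field.
Qed.

Lemma landau_expansion N (w : C) : normc w = 1 ->
  ((normc (1 + w) ^+ 2) ^+ N)%:C = \sum_(k < (2 * N).+1) (w^-1 ^+ N * w ^+ k) *+ 'C(2 * N, k).
Proof.
move=> w1; rewrite rcX normc1D_sqr// exprMn -exprM exprDn mulr_sumr.
by apply: eq_bigr => k _; rewrite expr1n mul1r mulrnAr.
Qed.

(** Summation over the [M]-th roots of unity annihilates every term with [k != N], because
    [0 < |k - N| <= N < M] is no multiple of [M]; the central binomial coefficient remains. *)
Lemma landau_mass M N (z u : C) : M.-primitive_root z -> (N < M)%N -> normc u = 1 ->
  \sum_(j < M) (normc (1 + u * conjc (z ^+ j)) ^+ 2) ^+ N = M%:R * 'C(2 * N, N)%:R.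
Proof.
move=> pz NM u1; have z1 := prim_root_normc pz.
have z0 : z != 0 by rewrite -normc_gt0 z1.
have u0 : u != 0 by rewrite -normc_gt0 u1.
apply: complexI; rewrite rmorph_sum/=.
have -> : \sum_(j < M) ((normc (1 + u * conjc (z ^+ j)) ^+ 2) ^+ N)%:C =
    \sum_(k < (2 * N).+1) \sum_(j < M) (u^-1 ^+ N * u ^+ k * (z ^+ N * z^-1 ^+ k) ^+ j) *+ 'C(2 * N, k).
  rewrite exchange_big/=; apply: eq_bigr => j _.
  have zj1 : normc (z ^+ j) = 1 by rewrite normcX z1 expr1n.
  rewrite landau_expansion ?normcM ?normcJ ?u1 ?zj1 ?mulr1//.
  apply: eq_bigr => k _; congr (_ *+ _).
  rewrite -(normc_inv_conj zj1) invfM invrK !exprMn.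
  rewrite -!exprM -!exprVn -!exprM [(j * N)%N]mulnC [(j * k)%N]mulnC; ring.
have N2 : (N < (2 * N).+1)%N by rewrite ltnS mul2n -addnn leq_addr.
rewrite (bigD1 (Ordinal N2))//= [X in _ + X]big1 => [|k kN].
  rewrite addr0.
  under eq_bigr do rewrite -!exprMn mulVf// expr1n mul1r mulfV// !expr1n.
  by rewrite sumr_const card_ord -mulrnA -natrM (rmorph_nat (real_complex R)) mulnC.
rewrite sumrMnl -mulr_sumr.
have xn1 : z ^+ N * z^-1 ^+ k != 1.
  apply/eqP => h; have : z ^+ N == z ^+ k.
    by apply/eqP; rewrite -[RHS]mul1r -h -mulrA -exprMn mulVf// expr1n mulr1.
  rewrite (eq_prim_root_expr pz) => /eqP e.
  move/eqP: kN; apply; apply: val_inj => /=.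
  have k2 := ltn_ord k; have [kN|Nk] := leqP k N.
    by move: e; rewrite !modn_small// (leq_ltn_trans kN).
  have : (M %| k - N)%N by rewrite -eqn_mod_dvd ?(ltnW Nk)//; apply/eqP; rewrite e.
  move=> /dvdn_leq; rewrite subn_gt0 => /(_ Nk).
  by lia.
have : (z ^+ N * z^-1 ^+ k) ^+ M - 1 = 0.
  rewrite exprMn -!exprM !(mulnC _ M) !exprM exprVn (prim_expr_order pz) invr1 !expr1n mulr1.
  exact: subrr.
rewrite subrX1 => /eqP; rewrite mulf_eq0 subr_eq0 (negPf xn1)/= => /eqP ->.
by rewrite mulr0 mul0rn.
Qed.

(* |1 + w|^2 + |1 - w|^2 = 4 on the unit circle, so that the masses of orders N
   and N + 1 control the concentration, as in Chebyshev's inequality. *)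
Lemma landau_spread M N (z u : C) : M.-primitive_root z -> (N.+1 < M)%N -> normc u = 1 ->
  \sum_(j < M) (normc (1 + u * conjc (z ^+ j)) ^+ 2) ^+ N * normc (u - z ^+ j) ^+ 2 =
  M%:R * 'C(2 * N, N)%:R * (2 / N.+1%:R).
Proof.
move=> pz NM u1; have z1 := prim_root_normc pz.
have -> : \sum_(j < M) (normc (1 + u * conjc (z ^+ j)) ^+ 2) ^+ N * normc (u - z ^+ j) ^+ 2 =
    4 * (\sum_(j < M) (normc (1 + u * conjc (z ^+ j)) ^+ 2) ^+ N) -
    \sum_(j < M) (normc (1 + u * conjc (z ^+ j)) ^+ 2) ^+ N.+1.
  rewrite mulr_sumr -sumrB; apply: eq_bigr => j _.
  have zj1 : normc (z ^+ j) = 1 by rewrite normcX z1 expr1n.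
  have -> : normc (u - z ^+ j) ^+ 2 = 4 - normc (1 + u * conjc (z ^+ j)) ^+ 2.
    set w := u * _; have w1 : normc w = 1 by rewrite normcM normcJ u1 zj1 mulr1.
    have -> : normc (u - z ^+ j) = normc (1 - w).
      have -> : 1 - w = - (conjc (z ^+ j) * (u - z ^+ j)).
        have : z ^+ j * conjc (z ^+ j) = 1 by rewrite mulzJ zj1 expr1n.
        by rewrite /w => h; rewrite -h; ring.
      by rewrite normcN normcM normcJ zj1 mul1r.
    have := normc_sqr w; rewrite w1 expr1n !normc_sqr !(cReD, cImD, cReN, cImN) /= => h.
    rewrite -[4](_ : 2 + 2 * 1 = 4); last by ring.
    by rewrite h; ring.
  by rewrite (exprS _ N); ring.
rewrite (landau_mass pz (ltnW NM) u1) (landau_mass pz NM u1).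
(* The ratio of consecutive central binomial coefficients is [2 (2 N + 1) / (N + 1)]; four minus
   this ratio is the factor [2 / (N + 1)]. *)
have bin : (N.+1 * 'C(2 * N.+1, N.+1) = 2 * (2 * N).+1 * 'C(2 * N, N))%N.
  have e1 := mul_bin_diag (2 * N).+1.+1 N.
  have e2 := mul_bin_down (2 * N).+1 N.
  have -> : (2 * N.+1 = (2 * N).+2)%N by rewrite mulnS.
  rewrite -e1 /=.
  have e3 : ((2 * N).+1 - N = N.+1)%N by lia.
  rewrite /= e3 in e2.
  have : (N.+1 * ((2 * N).+2 * 'C((2 * N).+1, N)) = N.+1 * (2 * (2 * N).+1 * 'C(2 * N, N)))%N.
    rewrite mulnCA -e2; lia.
  by move=> /eqP; rewrite eqn_pmul2l// => /eqP.
have /(congr1 (fun k : nat => k%:R : R)) := bin; rewrite !natrM => rb.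
have N0 : N.+1%:R != 0 :> R by rewrite pnatr_eq0.
have -> : 'C(2 * N.+1, N.+1)%:R = 2 * (2 * N).+1%:R * 'C(2 * N, N)%:R / N.+1%:R :> R.
  by rewrite -rb mulrAC mulfV// mul1r.
apply: (mulIf N0); rewrite mulrBl -!mulrA mulVf// mulr1.
have -> : (2 * N).+1%:R = 2 * N%:R + 1 :> R by rewrite -natr1 natrM.
by rewrite -natr1; ring.
Qed.

End RootsOfUnity.

(** * A uniform Riemann-Lebesgue lemma along the curve *)

Section RiemannLebesgue.
Context {R : realType}.
Local Notation C := R[i].
Variables (g g' : R -> C) (phi psi : C -> C) (b : C).
Hypothesis S : exterior_setting g g' phi psi b.
Let L := set_loop S.
Let E := set_pair S.
Local Notation DG := (exterior (range g) `|` range g).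
Local Notation cont_ext := (cont_ext g).

Let cg : continuous g := curve_continuous L.
Let cg' : continuous g' := loop_cont L.
Let gp := loop_periodic L.
Let gDG s : DG (g s). Proof. by right; exists s. Qed.

Lemma loop_phi_normc u : normc (phi (g u)) = 1.
Proof. by apply: (phi_G E); exists u. Qed.

Lemma loop_phi_surj (w : C) : normc w = 1 -> exists s, phi (g s) = w.
Proof.
by move=> w1; have [s _ sw] := psi_G E w1; exists s; rewrite sw (psiK E)// w1.
Qed.

Lemma continuous_conj_deriv : continuous (fun u => conjc (g' u)).
Proof. by move=> u; exact: (cvg_conjc (@cg' u)). Qed.

Lemma loop_phi_power_conj m : (1 < m)%N ->
  Int (fun u => phi (g u) ^+ m * conjc (g' u)) 0 1 = 0.
Proof.
move=> m1; have cV : cont_ext (fun z => (phi z)^-1 ^+ m).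
  exact: (cont_extX (n := m) (@cont_ext_phiV _ _ _ _ _ _ S)).
have -> : (fun u => phi (g u) ^+ m * conjc (g' u)) =
    (fun u => conjc ((phi (g u))^-1 ^+ m * g' u)).
  apply/funext => u; rewrite conjcM conjcX conjcV.
  by rewrite -(normc_inv_conj (loop_phi_normc u)) invrK.
by rewrite (IntJ 0 1 (continuous_loop S cV)) (loop_phi_power S m1) conjcR.
Qed.

(** The kernel contributes powers of [phi] of degree at least [-N], so only [phi^m] with
    [m >= n - N >= 2] occur. *)
Lemma landau_orthogonal n N (v : C) : (N.+1 < n)%N -> normc v = 1 ->
  Int (fun u => phi (g u) ^+ n *
    (((normc (1 + phi (g u) * v) ^+ 2) ^+ N)%:C * conjc (g' u))) 0 1 = 0.
Proof.
move=> nN v1; have v0 : v != 0 by rewrite -normc_gt0 v1.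
have cterm k : continuous (fun u => (v^-1 ^+ N * v ^+ k *+ 'C(2 * N, k)) *
    (phi (g u) ^+ (n - N + k) * conjc (g' u))).
  move=> u; apply: cvgM; first exact: cvg_cst.
  by apply: cvgM; [exact: (continuous_loop_phiX S)|exact: continuous_conj_deriv].
have -> : (fun u => phi (g u) ^+ n *
    (((normc (1 + phi (g u) * v) ^+ 2) ^+ N)%:C * conjc (g' u))) =
    (fun u => \sum_(k < (2 * N).+1) (v^-1 ^+ N * v ^+ k *+ 'C(2 * N, k)) *
      (phi (g u) ^+ (n - N + k) * conjc (g' u))).
  apply/funext => u; have u1 := loop_phi_normc u.
  have u0 : phi (g u) != 0 by rewrite -normc_gt0 u1.
  rewrite landau_expansion ?normcM ?u1 ?v1 ?mulr1// mulr_suml mulr_sumr.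
  apply: eq_bigr => k _; rewrite invfM !exprMn.
  have -> : phi (g u) ^+ n = phi (g u) ^+ (n - N) * phi (g u) ^+ N.
    by rewrite -exprD subnK// ltnW// ltnW.
  rewrite !mulrnAl !mulrnAr; congr (_ *+ _); rewrite exprD !exprVn.
  by field; rewrite !expf_neq0.
rewrite (@Int_sum _ _ _ (fun (k : 'I_(2 * N).+1) u => (v^-1 ^+ N * v ^+ k *+ 'C(2 * N, k)) *
      (phi (g u) ^+ (n - N + k) * conjc (g' u))) 0 1 (fun k => cterm k)).
apply: big1 => k _; rewrite IntZ.
  by rewrite loop_phi_power_conj ?mulr0//; lia.
by move=> u; apply: cvgM; [exact: (continuous_loop_phiX S)|exact: continuous_conj_deriv].
Qed.

(* H is approximated, uniformly in x, by Laurent polynomials in phi of degree at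
   most N; against phi^n conj(g') these integrate to 0 as soon as n > N + 1. *)
Lemma loop_riemann_lebesgue (T : Type) (H : T -> R -> C) (B : R) :
  (forall x, continuous (H x)) -> (forall x u, normc (H x u) <= B) ->
  (forall eta, 0 < eta -> exists2 rho, 0 < rho & forall x u v,
     normc (phi (g u) - phi (g v)) < rho -> normc (H x u - H x v) <= eta) ->
  forall eta, 0 < eta -> exists N0, forall n x, (N0 <= n)%N ->
    normc (Int (fun u => phi (g u) ^+ n * (H x u * conjc (g' u))) 0 1) <= eta.
Proof.
move=> cH HB Heq eta eta0.
have [M1 M10 HM] := periodic_bounded cg' (curve_deriv_periodic L).
have h0 : 0 < eta / (2 * M1) by rewrite divr_gt0// mulr_gt0.
have [rho rho0 Hrho] := Heq _ h0.
have r2 : 0 < rho ^+ 2 by rewrite exprn_gt0.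
pose B1 := Num.max B 0.
have B10 : 0 <= B1 by rewrite le_max lexx orbT.
(* As in Chebyshev's inequality: where [phi] is at distance at least [rho] from a node, the crude
   bound [2 B1] is at most [Q] times the squared distance, whose weighted mean is [2 / (N + 1)]. *)
pose Q := 2 * B1 / rho ^+ 2.
have Q0 : 0 <= Q by rewrite divr_ge0 ?mulr_ge0// ltW.
pose N := Num.bound (2 * Q / (eta / (2 * M1))).
have NQ : Q * (2 / N.+1%:R) <= eta / (2 * M1).
  have := archi_boundP (divr_ge0 (mulr_ge0 (ler0n R 2) Q0) (ltW h0)).
  rewrite -/N ltr_pdivrMr// => k; rewrite mulrA ler_pdivrMr// [Q * 2]mulrC.
  apply: le_trans (ltW k) _; rewrite [leLHS]mulrC; apply: ler_wpM2l; first exact: ltW.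
  by rewrite ler_nat.
(* [N + 2] nodes: the least number for which the mass formula still holds at order [N + 1], as
   [landau_spread] requires. *)
have [z pz] := @complex_prim_root_exists R N.+2 isT.
have z1 := prim_root_normc pz.
have zj1 j : normc (z ^+ j) = 1 by rewrite normcX z1 expr1n.
have [t Ht] : exists t : nat -> R, forall j, phi (g (t j)) = z ^+ j.
  by have [t Ht] := choice (fun j => loop_phi_surj (zj1 j)); exists t.
pose q j u := (normc (1 + phi (g u) * conjc (z ^+ j)) ^+ 2) ^+ N.
pose W : R := N.+2%:R * 'C(2 * N, N)%:R.
have W0 : 0 < W by rewrite mulr_gt0// ltr0n bin_gt0 mul2n -addnn leq_addr.
have q0 j u : 0 <= q j u by rewrite exprn_ge0// sqr_ge0.
have qW u : \sum_(j < N.+2) q j u = W.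
  by rewrite /q (landau_mass pz)// loop_phi_normc.
have qV u : \sum_(j < N.+2) q j u * normc (phi (g u) - z ^+ j) ^+ 2 = W * (2 / N.+1%:R).
  by rewrite /q (landau_spread pz)// loop_phi_normc.
exists N.+2 => n x nN.
(* Average of the values of [H x] at the nodes with weights of sum 1: a discrete convolution with
   the Landau kernel. *)
pose A u := \sum_(j < N.+2) H x (t j) * (q j u / W)%:C.
have cq j : continuous (fun u => (q j u / W)%:C).
  have cphi : cont_ext phi := @cont_ext_phi _ _ _ _ _ _ S.
  have c1 : continuous (fun u => phi (g u)) := cont_ext_path cphi cg gDG.
  have c2 : continuous (fun u => 1 + phi (g u) * conjc (z ^+ j)).
    by move=> u; apply: cvgD; [exact: cvg_cst|apply: cvgM; [exact: c1|exact: cvg_cst]].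
  have c3 : continuous (fun u => normc (1 + phi (g u) * conjc (z ^+ j)) ^+ 2).
    by move=> u; apply: cvgM; exact: (cvg_Re (cvg_normc (c2 u))).
  have c4 : continuous (q j).
    move=> u; apply: (@continuous_comp _ _ _ (fun u => normc (1 + phi (g u) * conjc (z ^+ j)) ^+ 2) (fun y => y ^+ N)).
      exact: c3.
    exact: exprn_continuous.
  have c5 : continuous (fun u => q j u / W) by move=> u; apply: cvgM; [exact: c4|exact: cvg_cst].
  by move=> u; exact: (cvg_RC (c5 u)).
have cAj (j : 'I_N.+2) : continuous (fun u => H x (t j) * (q j u / W)%:C).
  by move=> u; apply: cvgM; [exact: cvg_cst|exact: cq].
have cA : continuous A by exact: (@continuous_sum R _ (index_enum _) _ cAj).
have cf := @continuous_loop_phiX _ _ _ _ _ _ S n.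
have cP (h : R -> C) : continuous h -> continuous (fun u => phi (g u) ^+ n * (h u * conjc (g' u))).
  by move=> ch u; apply: cvgM; [exact: cf|apply: cvgM; [exact: ch|exact: continuous_conj_deriv]].
have IA : Int (fun u => phi (g u) ^+ n * (A u * conjc (g' u))) 0 1 = 0.
  have -> : (fun u => phi (g u) ^+ n * (A u * conjc (g' u))) =
      (fun u => \sum_(j < N.+2) (H x (t j) * (W^-1)%:C) * (phi (g u) ^+ n * ((q j u)%:C * conjc (g' u)))).
    apply/funext => u; rewrite /A mulr_suml mulr_sumr; apply: eq_bigr => j _.
    by rewrite rcM; ring.
  have cqj j : continuous (fun u => (q j u)%:C).
    have -> : (fun u => (q j u)%:C) = (fun u => W%:C * (q j u / W)%:C).
      by apply/funext => u; rewrite -rcM mulrC divfK ?gt_eqF.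
    by move=> u; apply: cvgM; [exact: cvg_cst|exact: cq].
  have cqP j := cP _ (cqj j).
  rewrite (@Int_sum _ _ _ (fun (j : 'I_N.+2) u => (H x (t j) * (W^-1)%:C) * (phi (g u) ^+ n * ((q j u)%:C * conjc (g' u)))) 0 1).
    apply: big1 => j _; rewrite (IntZ _ 0 1 (cqP j)) landau_orthogonal ?mulr0//.
    by rewrite normcJ.
  by move=> j u; apply: cvgM; [exact: cvg_cst|exact: cqP].
have -> : Int (fun u => phi (g u) ^+ n * (H x u * conjc (g' u))) 0 1 =
    Int (fun u => phi (g u) ^+ n * (H x u * conjc (g' u)) - phi (g u) ^+ n * (A u * conjc (g' u))) 0 1.
  by rewrite (IntB 0 1 (cP _ (cH x)) (cP _ cA)) IA subr0.
have cD : continuous (fun u => phi (g u) ^+ n * (H x u * conjc (g' u)) - phi (g u) ^+ n * (A u * conjc (g' u))).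
  by move=> u; apply: cvgB; [exact: (cP _ (cH x))|exact: (cP _ cA)].
have := Int_bound (M := eta) ler01 cD; rewrite subr0 mulr1; apply=> u _.
have -> : phi (g u) ^+ n * (H x u * conjc (g' u)) - phi (g u) ^+ n * (A u * conjc (g' u)) =
    phi (g u) ^+ n * ((H x u - A u) * conjc (g' u)) by ring.
rewrite !normcM normcX loop_phi_normc expr1n mul1r normcJ.
suff k : normc (H x u - A u) <= eta / M1.
  apply: le_trans (_ : eta / M1 * M1 <= _); last by rewrite divfK ?gt_eqF.
  by apply: ler_pM; rewrite ?normc_ge0.
have -> : H x u - A u = \sum_(j < N.+2) (H x u - H x (t j)) * (q j u / W)%:C.
  rewrite /A; under [RHS]eq_bigr do rewrite mulrBl.
  rewrite sumrB -mulr_sumr -rmorph_sum/= -mulr_suml qW mulfV ?gt_eqF//.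
  by rewrite mulr1.
apply: le_trans (normc_sum _ _ _) _.
have bnd (j : 'I_N.+2) : normc ((H x u - H x (t j)) * (q j u / W)%:C) <=
    eta / (2 * M1) / W * q j u + Q / W * (q j u * normc (phi (g u) - z ^+ j) ^+ 2).
  rewrite normcM normcR ger0_norm; last by rewrite divr_ge0// ltW.
  have qq : 0 <= q j u / W by rewrite divr_ge0// ltW.
  have -> : eta / (2 * M1) / W * q j u + Q / W * (q j u * normc (phi (g u) - z ^+ j) ^+ 2) =
     (eta / (2 * M1) + Q * normc (phi (g u) - z ^+ j) ^+ 2) * (q j u / W) by ring.
  rewrite ler_wpM2r//.
  have [lt|ge] := ltP (normc (phi (g u) - z ^+ j)) rho.
    apply: le_trans (_ : eta / (2 * M1) <= _); last by rewrite lerDl mulr_ge0// sqr_ge0.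
    by apply: Hrho; rewrite Ht.
  apply: le_trans (_ : Q * normc (phi (g u) - z ^+ j) ^+ 2 <= _); last by rewrite lerDr ltW.
  apply: le_trans (_ : Q * rho ^+ 2 <= _); last first.
    by rewrite ler_wpM2l// ler_pXn2r ?nnegrE ?normc_ge0// ltW.
  rewrite /Q divfK ?gt_eqF//; apply: le_trans (normcB _ _) _.
  have BB : B <= B1 by rewrite le_max lexx.
  by have := HB x u; have := HB x (t j); lra.
apply: le_trans (ler_sum _ (fun j _ => bnd j)) _.
rewrite big_split/= -!mulr_sumr qW qV divfK ?gt_eqF//.
have -> : Q / W * (W * (2 / N.+1%:R)) = Q * (2 / N.+1%:R).
  by rewrite mulrA divfK ?gt_eqF.
have -> : eta / M1 = eta / (2 * M1) + eta / (2 * M1) by field; rewrite gt_eqF.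
by rewrite lerD2l.
Qed.

End RiemannLebesgue.

(** * Equicontinuity of the cut-off kernels *)

Section Equicontinuity.
Context {R : realType}.
Local Notation C := R[i].
Variable T : Type.
Implicit Types (H : T -> R -> C).

(** Boundedness is included so that the notion is stable under products. *)
Definition equicontinuous_family H : Prop :=
  (exists B, forall x u, normc (H x u) <= B) /\
  (forall eta, 0 < eta -> exists2 d, 0 < d &
     forall x u v, `|u - v| < d -> normc (H x u - H x v) <= eta).

Lemma equicontinuous_periodic (f : R -> C) : continuous f -> (forall u, f (u + 1) = f u) ->
  equicontinuous_family (fun=> f).
Proof.
move=> cf fp; split.
  by have [M _ HM] := periodic_bounded cf fp; exists M.
move=> eta eta0; have [d d0 Hd] := periodic_uniform_continuity cf fp eta0.
by exists d => // _ u v uv; exact: Hd.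
Qed.

Lemma equicontinuous_cst (k : T -> C) B : (forall x, normc (k x) <= B) ->
  equicontinuous_family (fun x _ => k x).
Proof.
move=> kB; split; first by exists B.
by move=> eta /ltW eta0; exists 1 => // x u v _; rewrite subrr normc0.
Qed.

Lemma equicontinuousB H1 H2 : equicontinuous_family H1 -> equicontinuous_family H2 ->
  equicontinuous_family (fun x u => H1 x u - H2 x u).
Proof.
move=> [[B1 HB1] E1] [[B2 HB2] E2]; split.
  exists (B1 + B2) => x u; apply: le_trans (normcB _ _) _; exact: lerD.
move=> eta eta0; have e2 : 0 < eta / 2 by rewrite divr_gt0.
have [d1 d10 D1] := E1 _ e2; have [d2 d20 D2] := E2 _ e2.
exists (Num.min d1 d2); first by rewrite lt_min d10.
move=> x u v; rewrite lt_min => /andP[/(D1 x) k1 /(D2 x) k2].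
have -> : H1 x u - H2 x u - (H1 x v - H2 x v) = (H1 x u - H1 x v) - (H2 x u - H2 x v) by ring.
by apply: le_trans (normcB _ _) _; rewrite [leRHS]splitr; exact: lerD.
Qed.

Lemma equicontinuousM H1 H2 : equicontinuous_family H1 -> equicontinuous_family H2 ->
  equicontinuous_family (fun x u => H1 x u * H2 x u).
Proof.
move=> [[B1 HB1] E1] [[B2 HB2] E2].
pose M1 := Num.max B1 1; pose M2 := Num.max B2 1.
have M10 : 0 < M1 by rewrite lt_max ltr01 orbT.
have M20 : 0 < M2 by rewrite lt_max ltr01 orbT.
have HM1 x u : normc (H1 x u) <= M1 by rewrite le_max HB1.
have HM2 x u : normc (H2 x u) <= M2 by rewrite le_max HB2.
split; first by exists (M1 * M2) => x u; rewrite normcM; apply: ler_pM; rewrite ?normc_ge0.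
move=> eta eta0.
have [d1 d10 D1] := E1 _ (divr_gt0 eta0 (mulr_gt0 (ltr0n _ 2) M20)).
have [d2 d20 D2] := E2 _ (divr_gt0 eta0 (mulr_gt0 (ltr0n _ 2) M10)).
exists (Num.min d1 d2); first by rewrite lt_min d10.
move=> x u v; rewrite lt_min => /andP[/(D1 x) k1 /(D2 x) k2].
have -> : H1 x u * H2 x u - H1 x v * H2 x v =
   (H1 x u - H1 x v) * H2 x u + (H2 x u - H2 x v) * H1 x v by ring.
apply: le_trans (normcD _ _) _; rewrite !normcM.
have -> : eta = eta / (2 * M2) * M2 + eta / (2 * M1) * M1.
  by field; rewrite !gt_eqF.
by apply: lerD; apply: ler_pM; rewrite ?normc_ge0.
Qed.

Lemma equicontinuous_lipschitz H (f : C -> C) (k : R) : 0 < k ->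
  (forall y z, normc (f y - f z) <= k * normc (y - z)) ->
  equicontinuous_family H -> equicontinuous_family (fun x u => f (H x u)).
Proof.
move=> k0 fk [[B HB] E]; split.
  exists (normc (f 0) + k * B) => x u; rewrite -[f (H x u)](subrK (f 0)) addrC.
  apply: le_trans (normcD _ _) _; rewrite lerD2l; apply: le_trans (fk _ _) _.
  by rewrite subr0 ler_pM2l.
move=> eta eta0; have [d d0 D] := E _ (divr_gt0 eta0 k0).
exists d => // x u v /(D x) h; apply: le_trans (fk _ _) _.
by rewrite mulrC -ler_pdivlMr.
Qed.

End Equicontinuity.

Section CutoffFamily.
Context {R : realType}.
Local Notation C := R[i].
Variables (g g' : R -> C) (phi psi : C -> C) (b : C).
Hypothesis S : exterior_setting g g' phi psi b.
Let L := set_loop S.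
Let E := set_pair S.
Local Notation DG := (exterior (range g) `|` range g).
Local Notation cont_ext := (cont_ext g).

Let cg : continuous g := curve_continuous L.
Let cg' : continuous g' := loop_cont L.
Let gp := loop_periodic L.
Let gDG s : DG (g s). Proof. by right; exists s. Qed.

Lemma loop_inj01 p q : 0 <= p <= 1 -> 0 <= q <= 1 -> g p = g q ->
  [\/ p = q, q = p + 1 | p = q + 1].
Proof.
have aux p0 q0 : p0 <= q0 -> 0 <= p0 -> q0 <= 1 -> g p0 = g q0 -> p0 = q0 \/ q0 = p0 + 1.
  move=> pq p00 q01 gpq; have [->|ne] := eqVneq p0 q0; first by left.
  right; apply/eqP; rewrite eq_le; apply/andP; split; first by lra.
  rewrite leNgt; apply/negP => lt1; have := @curve_inj _ _ _ L p0 (q0 - p0).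
  rewrite subrKC gpq eqxx => /(_ _)/negP; apply => //.
  have pq' : p0 < q0 by rewrite lt_neqAle ne.
  by rewrite gtr0_norm ?subr_gt0 ?pq'//= ltrBlDl.
move=> /andP[p0 p1] /andP[q0 q1] gpq; have [pq|/ltW qp] := leP p q.
  by have [->|->] := aux p q pq p0 q1 gpq; [constructor 1|constructor 2].
by have [->|->] := aux q p qp q0 p1 (esym gpq); [constructor 1|constructor 3].
Qed.

(** [phi] composed with [g] is injective modulo the period, so close values of [phi] come from
    parameters close modulo 1, where a periodic equicontinuous family takes close values;
    compactness makes this quantitative. *)
Lemma equicontinuous_phi (T : Type) (H : T -> R -> C) : equicontinuous_family H ->
  (forall x u, H x (u + 1) = H x u) ->
  forall eta, 0 < eta -> exists2 rho, 0 < rho & forall x u v,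
     normc (phi (g u) - phi (g v)) < rho -> normc (H x u - H x v) <= eta.
Proof.
move=> [_ HE] Hp eta eta0.
have cphi : cont_ext phi := @cont_ext_phi _ _ _ _ _ _ S.
have cf : continuous (fun u => phi (g u)) := cont_ext_path cphi cg gDG.
have [d d0 Hd] := HE _ (divr_gt0 eta0 (ltr0n _ 2)).
pose P e u v := normc (phi (g u) - phi (g v)) < e -> forall x, normc (H x u - H x v) <= eta.
have [||rho rho0 Hrho] := @rect_uniform R P 0 1 0 1 ler01 ler01.
- by move=> e e' u v ee h k; apply: h; exact: lt_le_trans ee.
- move=> p q p01 q01.
  (* If the two values differ, the premise of [P] fails near [(p, q)] for [e = D3], a third of their
     distance. *)
  have [pq|pq] := eqVneq (phi (g p)) (phi (g q)).
    have gpq : g p = g q by rewrite -(phiK E (gDG p)) pq (phiK E (gDG q)).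
    have Hpq x : H x p = H x q.
      by have [->|->|->] := loop_inj01 p01 q01 gpq; rewrite ?Hp.
    exists 1 => //; exists d => // u v up vq _ x.
    have -> : H x u - H x v = (H x u - H x p) - (H x v - H x q) by rewrite Hpq; ring.
    by apply: le_trans (normcB _ _) _; rewrite [leRHS]splitr; apply: lerD; exact: Hd.
  have D0 : 0 < normc (phi (g p) - phi (g q)) by rewrite normc_gt0 subr_eq0.
  pose D3 := normc (phi (g p) - phi (g q)) / 3.
  have D30 : 0 < D3 by rewrite divr_gt0.
  have [r1 r10 R1] := (rcontP _ _).1 (cf p) _ D30.
  have [r2 r20 R2] := (rcontP _ _).1 (cf q) _ D30.
  exists D3 => //; exists (Num.min r1 r2); first by rewrite lt_min r10.
  move=> u v; rewrite !lt_min => /andP[/R1 k1 _] /andP[_ /R2 k2] k x.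
  have := normc_dist3 (phi (g p)) (phi (g u)) (phi (g q)).
  have := normc_dist3 (phi (g u)) (phi (g v)) (phi (g q)).
  rewrite normcBC in k1.
  have : normc (phi (g p) - phi (g q)) = D3 + D3 + D3 by rewrite /D3; field.
  by move=> -> h1 h2; exfalso; lra.
exists rho => // x u v uv.
have [m /andP[m0 m1]] := period_reduce u; have [k /andP[k0 k1]] := period_reduce v.
have red (f : R -> C) (fp : forall s, f (s + 1) = f s) j w : f w = f (w - j%:~R).
  by rewrite -[in LHS](subrK j%:~R w) periodic_int.
rewrite (red (H x) (Hp x) m u) (red (H x) (Hp x) k v).
apply: Hrho; rewrite ?m0 ?k0 ?(ltW m1) ?(ltW k1)//.
by rewrite -(red (fun u => g u) gp m u) -(red (fun u => g u) gp k v).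
Qed.

(** Division by [conj g'] because orthogonality is available for [phi^m conj g']. *)
Definition cutoff_density (d s u : R) : C :=
  (cutoff_kernel g g' d s u)%:C * (conjc (g' u))^-1.

Lemma cutoff_densityK d s u : cutoff_density d s u * conjc (g' u) = (cutoff_kernel g g' d s u)%:C.
Proof.
rewrite /cutoff_density mulrAC -mulrA divff ?mulr1//.
by rewrite -normc_gt0 normcJ normc_gt0 (loop_neq0 L).
Qed.

Lemma conj_deriv_neq0 u : conjc (g' u) != 0.
Proof. by rewrite -normc_gt0 normcJ normc_gt0 (loop_neq0 L). Qed.

Let cV : continuous (fun u => (conjc (g' u))^-1).
Proof. by move=> u; apply: cvgV; [exact: conj_deriv_neq0|exact: (cvg_conjc (@cg' u))]. Qed.

Lemma continuous_cutoff_density d s : 0 < d -> continuous (cutoff_density d s).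
Proof.
by move=> d0 u; apply: cvgM; [exact: (@continuous_cutoff_kernel _ _ _ L d s d0)|exact: cV].
Qed.

Lemma cutoff_density_periodic d s u : cutoff_density d s (u + 1) = cutoff_density d s u.
Proof. by rewrite /cutoff_density /cutoff_kernel gp (curve_deriv_periodic L). Qed.

Lemma inv_max_lipschitz (d : R) (y z : C) : 0 < d ->
  normc (((Num.max (normc y) d)^-1)%:C - ((Num.max (normc z) d)^-1)%:C) <= (d ^+ 2)^-1 * normc (y - z).
Proof.
move=> d0; set m := Num.max _ _; set n := Num.max _ _.
have dm : d <= m by rewrite le_max lexx orbT.
have dn : d <= n by rewrite le_max lexx orbT.
have m0 := lt_le_trans d0 dm; have n0 := lt_le_trans d0 dn.
rewrite -rcB normcR.
have -> : m^-1 - n^-1 = (m * n)^-1 * (n - m) by field; rewrite !gt_eqF.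
have mn : 0 <= (m * n)^-1 by rewrite invr_ge0 mulr_ge0 ?(ltW m0) ?(ltW n0).
rewrite normrM (ger0_norm mn); apply: ler_pM => //.
  by rewrite lef_pV2 ?posrE ?mulr_gt0// expr2 ler_pM// ltW.
have h1 := normcB_ge y z; have h2 := normcB_ge z y; rewrite normcBC in h2.
rewrite ler_norml; apply/andP; split.
  rewrite lerNl opprB lerBlDr ge_max; apply/andP; split.
    have : normc z <= n by rewrite le_max lexx.
    by lra.
  by apply: le_trans dn _; rewrite lerDr normc_ge0.
rewrite lerBlDr ge_max; apply/andP; split.
  have : normc y <= m by rewrite le_max lexx.
  by lra.
by apply: le_trans dm _; rewrite lerDr normc_ge0.
Qed.

Lemma equicontinuous_cutoff_density d : 0 < d -> equicontinuous_family (cutoff_density d).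
Proof.
move=> d0.
have [M M0 HM] := periodic_bounded cg gp.
have fg := @equicontinuous_periodic R R g cg gp.
have fg' := @equicontinuous_periodic R R g' cg' (curve_deriv_periodic L).
have fV : equicontinuous_family (fun (_ : R) u => (conjc (g' u))^-1).
  by apply: equicontinuous_periodic => // u; rewrite (curve_deriv_periodic L).
have fD := equicontinuousB fg (@equicontinuous_cst R R g M HM).
have fJ : equicontinuous_family (fun s u => conjc (g u - g s)).
  apply: (@equicontinuous_lipschitz R R _ conjc 1 ltr01 _ fD).
  by move=> y z; rewrite -conjcB normcJ mul1r.
have fI : equicontinuous_family (fun s u => (Im (conjc (g u - g s) * g' u))%:C).
  apply: (@equicontinuous_lipschitz R R _ (fun z => (Im z)%:C) 1 ltr01 _ (equicontinuousM fJ fg')).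
  by move=> y z; rewrite -rcB -cImN -cImD normcR mul1r normc_Im.
have d2 : 0 < (d ^+ 2)^-1 by rewrite invr_gt0 exprn_gt0.
have fm : equicontinuous_family (fun s u => ((Num.max (normc (g u - g s)) d)^-1)%:C).
  apply: (@equicontinuous_lipschitz R R _ (fun z => ((Num.max (normc z) d)^-1)%:C) _ d2 _ fD).
  by move=> y z; exact: inv_max_lipschitz.
have := equicontinuousM (equicontinuousM fI (equicontinuousM fm fm)) fV.
have -> // : (fun s u => (Im (conjc (g u - g s) * g' u))%:C *
   (((Num.max (normc (g u - g s)) d)^-1)%:C * ((Num.max (normc (g u - g s)) d)^-1)%:C) * (conjc (g' u))^-1) =
   cutoff_density d.
apply/funext => s; apply/funext => u; rewrite /cutoff_density /cutoff_kernel.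
by rewrite -!rcM -invfM -expr2.
Qed.

End CutoffFamily.

(** * The limit of the normalised Faber polynomials on the curve *)

Section FaberLimit.
Context {R : realType}.
Local Notation C := R[i].
Variables (g g' : R -> C) (phi psi : C -> C) (b : C).
Hypothesis S : exterior_setting g g' phi psi b.
Hypothesis dini :
  (\int[lebesgue_measure]_(t in `]0%R, 1%R]) (modulus_of_continuity g' t / t)%:E < +oo)%E.
Let L := set_loop S.
Let E := set_pair S.
Local Notation D := (exterior (range g)).
Local Notation DG := (exterior (range g) `|` range g).
Local Notation cont_ext := (cont_ext g).
Local Notation K := (loop_const g g' phi b).

#[local] Existing Instance cinfty_filter.

Let cg : continuous g := curve_continuous L.
Let cg' : continuous g' := loop_cont L.
Let gDG s : DG (g s). Proof. by right; exists s. Qed.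

Lemma cvg_cinftyX (f : C -> C) (l : C) n : f @ (@cinfty R) --> l ->
  (fun z => f z ^+ n) @ (@cinfty R) --> l ^+ n.
Proof.
move=> fl; elim: n => [|n ih].
  have -> : (fun z => f z ^+ 0) = fun=> 1 by apply/funext => z; rewrite expr0.
  exact: cvg_cst.
have -> : (fun z => f z ^+ n.+1) = (fun z => f z * f z ^+ n).
  by apply/funext => z; rewrite exprS.
by rewrite exprS; apply: cvgM; [exact: fl|exact: ih].
Qed.

(** [(p - phi^n) phi^(-n-1)] times [z] tends to 0 at infinity, since [p - phi^n] does and [z / phi]
    has a limit; its loop integral is therefore 0. *)
Lemma faber_mean n (p : {poly C}) : is_faber_polynomial phi n p ->
  Int (fun s => ((phi (g s))^-1 ^+ n * p.[g s] - 1) * ((phi (g s))^-1 * g' s)) 0 1 = 0.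
Proof.
move=> pF.
pose F z := (p.[z] - phi z ^+ n) * ((phi z)^-1 ^+ n * (phi z)^-1).
have cphi : cont_ext phi := @cont_ext_phi _ _ _ _ _ _ S.
have cV : cont_ext (fun z => (phi z)^-1) := @cont_ext_phiV _ _ _ _ _ _ S.
have cVn : cont_ext (fun z => (phi z)^-1 ^+ n) := cont_extX (n := n) cV.
have cn : cont_ext (fun z => phi z ^+ n) := cont_extX (n := n) cphi.
have cF : cont_ext F.
  move=> z Dz; apply: cvgM.
    by apply: cvgB; [exact: (cont_ext_cderiv (cderiv_horner p))|exact: cn].
  by apply: cvgM; [exact: cVn|exact: cV].
have dF z : D z -> z != 0 -> exists l, cderiv F z l.
  move=> Dz _; have [l1 d1] := cderiv_horner p z.
  have [l2 d2] := cderiv_exp n (set_holo S Dz).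
  have [l3 d3] := holo_phiV S Dz.
  have [l4 d4] := cderiv_exp n (ex_intro _ l3 d3).
  by eexists; apply: cderivM; [exact: (cderivB d1 d2)|exact: (cderivM d4 d3)].
have iF : (fun z => z * F z) @ (@cinfty R) --> 0.
  have -> : (fun z => z * F z) =
      (fun z => - (phi z ^+ n - p.[z]) * ((phi z)^-1 ^+ n * (z * (phi z)^-1))).
    by apply/funext => z; rewrite /F; ring.
  rewrite -(mul0r (0 ^+ n * b^-1)); apply: cvgM.
    by rewrite -oppr0; apply: cvgN; exact: faber_error.
  apply: cvgM; last exact: (cvg_cinfty_phi S).
  by apply: cvg_cinftyX; exact: (cvg_cinfty_phiV S).
have := loop_residue S cF dF iF; rewrite mul0r => <-.
congr (Int _ 0 1); apply/funext => s; rewrite /F.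
have p0 : phi (g s) != 0 by exact: (phi_neq0 S (gDG s)).
by rewrite exprVn; field; rewrite p0 expf_neq0.
Qed.

(* By the boundary identity K (phi^-n F_n - 1) is uniformly close to a constant;
   the constant is 0 because phi^-n F_n - 1 has mean 0 against phi^-1 g'. *)
Lemma faber_quotient_limit (F : nat -> {poly C}) :
  (forall n, is_faber_polynomial phi n (F n)) ->
  forall eta, 0 < eta -> exists N, forall n s, (N <= n)%N ->
    normc ((phi (g s))^-1 ^+ n * (F n).[g s] - 1) <= eta.
Proof.
move=> hF.
have [sg [sg1 Hb]] := faber_boundary S dini.
pose q : C := 2 * 'i%C * (sg * pi)%:C.
(* Dividing the boundary identity by [phi^n] leaves [K (v - 1) + ka] up to the cut-off integral, so
   [-ka] is the uniform limit of [K (v - 1)]. *)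
pose ka := conjc K - q.
pose v n s := (phi (g s))^-1 ^+ n * (F n).[g s].
have u1 s : normc (phi (g s)) = 1 := loop_phi_normc S s.
have n2 : normc (2 : C) = 2 by rewrite -[2]/(2%:R) -(rmorph_nat (real_complex R)) normcR ger0_norm.
have lim eta : 0 < eta -> exists N, forall n s, (N <= n)%N -> normc (K * (v n s - 1) + ka) <= eta.
  move=> eta0.
  have [d d0 Hd] := Hb _ (divr_gt0 eta0 (ltr0n _ 2)).
  have [B HB] := (equicontinuous_cutoff_density S d0).1.
  have eqi := equicontinuous_phi S (equicontinuous_cutoff_density S d0) (cutoff_density_periodic S d).
  have [N HN] := @loop_riemann_lebesgue _ _ _ _ _ _ S R _ B
     (fun s => @continuous_cutoff_density _ _ _ _ _ _ S d s d0) HB eqi _ (divr_gt0 eta0 (ltr0n _ 4)).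
  exists N.+1 => n s nN.
  have n0 : (0 < n)%N by apply: leq_ltn_trans nN.
  have A1 := Hd n (F n) s n0 (hF n).
  have A2 := HN n s (ltnW nN).
  set J := Int _ 0 1 in A2.
  have JE : J = Int (fun u => phi (g u) ^+ n * (cutoff_kernel g g' d s u)%:C) 0 1.
    by rewrite /J; congr (Int _ 0 1); apply/funext => u; rewrite (cutoff_densityK S).
  rewrite -JE in A1.
  have pn0 : phi (g s) ^+ n != 0 by rewrite expf_neq0// -normc_gt0 u1.
  have -> : K * (v n s - 1) + ka = (phi (g s) ^+ n)^-1 *
     ((K * ((F n).[g s] - phi (g s) ^+ n) + conjc K * phi (g s) ^+ n -
       2 * 'i%C * ((sg * pi)%:C * phi (g s) ^+ n + J)) + 2 * 'i%C * J).
    by rewrite /v /ka /q exprVn; field.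
  rewrite normcM normcV normcX u1 expr1n invr1 mul1r.
  apply: le_trans (normcD _ _) _; rewrite [leRHS]splitr; apply: lerD => //.
  rewrite !normcM normci n2 mulr1.
  by apply: le_trans (ler_wpM2l _ A2) _ => //; lra.
have [M M0 HM] := periodic_bounded cg' (curve_deriv_periodic L).
have cw : continuous (fun s => (phi (g s))^-1 * g' s).
  exact: (continuous_loop S (@cont_ext_phiV _ _ _ _ _ _ S)).
have b0 := set_b S.
have cv n : continuous (v n).
  have cVn : cont_ext (fun z => (phi z)^-1 ^+ n).
    exact: (cont_extX (n := n) (@cont_ext_phiV _ _ _ _ _ _ S)).
  have cp : cont_ext (fun z => (F n).[z]) := cont_ext_cderiv (cderiv_horner (F n)).
  exact: (cont_ext_path (cont_extM cVn cp) cg gDG).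
(* Integration of the small quantity [K (v - 1) + ka] against [phi^-1 g']: the first term has mean
   0, and the weight has integral [K / b]. *)
have kaK : normc (ka * (K / b)) = 0.
  apply/le_anti; rewrite normc_ge0 andbT; apply/ler_addgt0Pr => e e0; rewrite add0r.
  have [N HN] := lim _ (divr_gt0 e0 M0).
  have cv1 : continuous (fun s => (v N s - 1) * ((phi (g s))^-1 * g' s)).
    by move=> s; exact: (cvgM (cvgB (@cv N s) (cvg_cst (1 : C))) (@cw s)).
  have c1 : continuous (fun s => K * ((v N s - 1) * ((phi (g s))^-1 * g' s))).
    by move=> s; apply: cvgM; [exact: cvg_cst|exact: cv1].
  have c2 : continuous (fun s => ka * ((phi (g s))^-1 * g' s)).
    by move=> s; apply: cvgM; [exact: cvg_cst|exact: cw].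
  have -> : ka * (K / b) = Int (fun s => K * ((v N s - 1) * ((phi (g s))^-1 * g' s)) +
       ka * ((phi (g s))^-1 * g' s)) 0 1.
    rewrite (IntD 0 1 c1 c2) (IntZ K 0 1 cv1) (IntZ ka 0 1 cw) (faber_mean (hF N)) mulr0 add0r.
    by rewrite /loop_const mulrAC divff// mul1r.
  have cS : continuous (fun s => K * ((v N s - 1) * ((phi (g s))^-1 * g' s)) +
       ka * ((phi (g s))^-1 * g' s)).
    by move=> s; apply: cvgD; [exact: c1|exact: c2].
  have := Int_bound (M := e) ler01 cS; rewrite subr0 mulr1; apply=> s _.
  have -> : K * ((v N s - 1) * ((phi (g s))^-1 * g' s)) + ka * ((phi (g s))^-1 * g' s) =
     (K * (v N s - 1) + ka) * ((phi (g s))^-1 * g' s) by ring.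
  rewrite !normcM normcV u1 invr1 mul1r.
  apply: le_trans (_ : e / M * M <= _); last by rewrite divfK ?gt_eqF.
  by apply: ler_pM; rewrite ?normc_ge0// HN.
have pi0 : 0 < pi :> R by exact: pi_gt0.
have nq : normc q = 2 * pi.
  by rewrite !normcM n2 normci normcR normrM sg1 mul1r mulr1 gtr0_norm.
(* If [K] were 0, the uniformly small quantity would be the constant [-q], of modulus [2 pi]. So
   [ka = 0], that is [conj K = 2 i sigma pi]: here [K] receives its value. *)
have K0 : K != 0.
  apply/eqP => K0; have [N HN] := lim _ pi0.
  have := HN N 0 (leqnn N); rewrite /ka K0 mul0r add0r -[0]/(0%:C) conjcR sub0r normcN nq.
  by lra.
have ka0 : ka = 0.
  move/eqP: kaK; rewrite normc_eq0 mulf_eq0 => /orP[/eqP//|].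
  by rewrite mulf_eq0 invr_eq0 (negPf K0) (negPf b0).
move=> eta eta0; have nK : 0 < normc K by rewrite normc_gt0.
have [N HN] := lim _ (mulr_gt0 eta0 nK).
exists N => n s nN; have := HN n s nN; rewrite ka0 addr0 normcM mulrC.
by rewrite ler_pM2r.
Qed.

End FaberLimit.

(** * Nonzero slope at infinity, and the conclusion *)

Section Degree.
Context {R : realType}.
Local Notation C := R[i].

#[local] Existing Instance cinfty_filter.

(** If [q X + c] tends to 0 at infinity, division by [z] shows that [q] does too, so the
    coefficients vanish by induction. *)
Lemma horner_cvg_cinfty0 (p : {poly C}) :
  (fun z => p.[z]) @ (@cinfty R) --> 0 -> p = 0.
Proof.
elim/poly_ind: p => // q c ih h.
have q0 : q = 0.
  apply: ih.
  have h2 : (fun z => ((q * 'X + c%:P).[z] - c) * z^-1) @ (@cinfty R) --> 0.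
    rewrite -(mulr0 (0 - c)); apply: cvgM; last exact: cvg_cinfty_inv.
    by apply: cvgB; [exact: h|exact: cvg_cst].
  apply: (cvg_cinfty_near (M := 0) _ h2) => z z0.
  by rewrite hornerMXaddC addrK mulfK// -normc_gt0.
move: h; rewrite q0 mul0r add0r => /cvg_cinftyP h.
have -> : c = 0.
  apply/eqP; rewrite -normc_eq0; apply/eqP/le_anti; rewrite normc_ge0 andbT.
  apply/ler_addgt0Pr => e e0; have [M HM] := h _ e0; rewrite add0r.
  have := HM (`|M| + 1)%:C; rewrite hornerC subr0 normcR ger0_norm ?addr_ge0// => k.
  by apply/ltW/k; apply: le_lt_trans (ler_norm M) _; rewrite ltrDl.
by rewrite polyC0.
Qed.

(* Otherwise the first Faber polynomial is constant, so [phi] stays bounded near infinity. *)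
Lemma exterior_map_slope_neq0 (G : set C) (phi psi : C -> C) (b : C) (p : {poly C}) :
  exterior_pair G phi psi -> phi z / z @[z --> @cinfty R] --> b ->
  is_faber_polynomial phi 1 p -> b != 0.
Proof.
move=> E hb pF; apply/eqP => b0; rewrite b0 in hb.
have err := laurent_polynomial_part pF.
have [q [c pqc]] : exists q c, p = q * 'X + c%:P.
  by elim/poly_ind: p {pF err} => [|q c _]; [exists 0, 0; rewrite mul0r addr0|exists q, c].
have q0 : q = 0.
  apply: horner_cvg_cinfty0.
  (* The function is [(p.[z] - c) / z = q.[z]], rewritten through [phi z], whose slope is assumed to
     be 0. *)
  have h2 : (fun z => phi z / z - (phi z ^+ 1 - p.[z]) * z^-1 - c * z^-1) @ (@cinfty R) --> 0.
    have -> : 0 = 0 - 0 * 0 - c * 0 :> C by ring.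
    apply: cvgB; last by apply: cvgM; [exact: cvg_cst|exact: cvg_cinfty_inv].
    by apply: cvgB; [exact: hb|apply: cvgM; [exact: err|exact: cvg_cinfty_inv]].
  apply: (cvg_cinfty_near (M := 0) _ h2) => z z0.
  by rewrite pqc hornerMXaddC expr1; field; rewrite -normc_gt0.
have [M HM] := (cvg_cinftyP _ _).1 err 1 ltr01.
have [N HN] := psi_infty E M.
(* At [psi w] the constant polynomial [c] would be within 1 of [phi (psi w) = w], whereas
   [w > |c| + 1]. *)
pose w : R := 1 + `|N| + normc c + 1.
have w1 : 1 <= w by rewrite /w -!addrA lerDl !addr_ge0 ?normc_ge0.
have wN : N < w by have := ler_norm N; have := normc_ge0 c; rewrite /w; lra.
have nw : normc w%:C = w by rewrite normcR ger0_norm// (le_trans _ w1).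
have := HM (psi w%:C) (HN w%:C _ _); rewrite !nw => /(_ w1 wN).
rewrite (psiK E) ?nw// expr1 subr0 pqc q0 mul0r add0r hornerC => k.
have := normcB_ge w%:C c; rewrite nw /w; have := normr_ge0 N.
by move: k; rewrite /w; lra.
Qed.

End Degree.

Section Setting.
Context {R : realType}.
Local Notation C := R[i].

Lemma dini_exterior_setting (G : set C) (phi : C -> C) (p : {poly C}) :
  dini_smooth_jordan_curve G -> canonical_exterior_map G phi ->
  is_faber_polynomial phi 1 p ->
  exists g g' psi b, [/\ range g = G, exterior_setting g g' phi psi b &
    (\int[lebesgue_measure]_(t in `]0%R, 1%R]) (modulus_of_continuity g' t / t)%:E < +oo)%E].
Proof.
move=> [g [g' [hg dg cg' g'0 dini]]] hphi pF.
have [psi E] := canonical_exterior_pair hphi.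
have [_ dphi lphi _] := hphi.
have gG : range g = G by have [_ _ _ ->] := hg.
have S : exterior_setting g g' phi psi ((log_capacity G)^-1)%:C.
  split.
  - exact: (dini_smooth_loop hg dg cg' g'0).
  - by rewrite gG; exact: E.
  - by rewrite gG => z Dz; apply: derivable_cderiv; exact: dphi.
  - exact: (exterior_map_slope_neq0 E lphi pF).
  - exact: (cvg_cinftyP _ _).1 lphi.
exists g, g', psi, ((log_capacity G)^-1)%:C; split; [exact: gG|exact: S|exact: dini].
Qed.

End Setting.

Local Close Scope complex_scope.

Theorem mainTheorem3 (R : realType) (G : set R[i]) (phi : R[i] -> R[i])
    (F : nat -> {poly R[i]})
    (hG : dini_smooth_jordan_curve G)
    (hphi : canonical_exterior_map G phi)
    (hF : forall n, is_faber_polynomial phi n (F n)) :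
  {uniform G, (fun (n : nat) (z : R[i]) => phi z ^- n * (F n).[z]) @ \oo -->
     (fun _ : R[i] => 1 : R[i])}
  /\ (sup_norm G (fun z => (F n).[z]) @[n --> \oo] --> (1 : R)).
Proof.
have [g [g' [psi [b [gG S dini]]]]] := dini_exterior_setting hG hphi (hF 1%N).
have lim eta : 0 < eta -> exists N, forall n z, (N <= n)%N -> G z ->
    normc (phi z ^- n * (F n).[z] - 1) <= eta.
  move=> eta0; have [N HN] := faber_quotient_limit S dini hF eta0.
  exists N => n z nN; rewrite -gG => -[s _ <-]; rewrite -exprVn; exact: HN.
have G0 : G (g 0) by rewrite -gG; exists 0.
split.
  move=> P /uniform_nbhs[U []]; rewrite -entourage_from_ballE => -[e /= e0 eU] UP.
  (* The radius of the entourage is an element of [R[i]]; being positive, it is real. *)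
  have [er ei] : 0 < Re e /\ Im e = 0.
    by move: e0; rewrite ltcE /= => /andP[/eqP -> ->].
  have [N HN] := lim _ (divr_gt0 er (ltr0n R 2)).
  exists N => // n /= nN; apply: UP => z Gz; apply: eU => /=.
  have Pz := HN n z nN Gz.
  rewrite -ball_normE /= normr_normc normcBC ltcE /= ei eqxx /=.
  by apply: le_lt_trans Pz _; lra.
apply/cvgrPdist_le => e e0.
have [N HN] := lim _ e0.
exists N => // n /= nN.
(* As [|phi| = 1] on the curve, the uniform limit keeps [|F_n|] between [1 - e] and [1 + e]; the
   supremum inherits the lower bound through the point [g 0]. *)
have u1 z : G z -> normc (phi z ^- n * (F n).[z]) = normc (F n).[z].
  rewrite -gG => -[s _ <-].
  by rewrite normcM normcV normcX (loop_phi_normc S) expr1n invr1 mul1r.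
have up z : G z -> normc (F n).[z] <= 1 + e.
  move=> Gz; rewrite -u1//; have := HN n z nN Gz.
  have := normcB_ge (phi z ^- n * (F n).[z]) 1; rewrite normc1; lra.
have dn z : G z -> 1 - e <= normc (F n).[z].
  move=> Gz; rewrite -u1//; have := HN n z nN Gz; rewrite normcBC.
  have := normcB_ge 1 (phi z ^- n * (F n).[z]); rewrite normc1; lra.
have s1 : sup_norm G (fun z => (F n).[z]) <= 1 + e.
  apply: ge_sup; first by exists (normc (F n).[g 0]), (g 0).
  by move=> _ [z Gz <-]; exact: up.
have s2 : 1 - e <= sup_norm G (fun z => (F n).[z]).
  apply: le_trans (dn _ G0) _; apply: ub_le_sup; last by exists (g 0).
  by exists (1 + e) => _ [z Gz <-]; exact: up.
by rewrite ler_norml; apply/andP; split; lra.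
Qed.
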